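(* Let $S=\mathbb{T}\times[-\pi,\pi]$ and let $\rho_s\in C^\infty(S)$ be any stationary solution of the IPM equation in $S$. For any $\epsilon,\gamma>0$, there exists an initial data $\rho_0\in C^\infty(S)$ satisfying $$\|\rho_0-\rho_s\|_{H^{2-\gamma}(S)}\le\epsilon,$$ such that the solution $\rho(\cdot,t)$ to the IPM equation in $S$ with initial data $\rho_0$, provided it remains smooth for all times, satisfies $$\limsup_{t\to\infty} t^{-\frac{s}{2}}\|\rho(t)-\rho_s\|_{\dot H^{s+1}(S)}=\infty\quad\text{for all } s>0.$$
   Context: $\mathbb{T}=[-\pi,\pi)$ with periodic identification; the strip $S=\mathbb{T}\times[-\pi,\pi]$ is periodic in $x_1$. The IPM equation in $S$ is $\partial_t\rho+(u\cdot\nabla)\rho=0$, $\nabla\cdot u=0$, $u+\nabla p=-(0,\rho)$, with $u\cdot n=0$ on $x_2=\pm\pi$. The velocity is $u=\nabla^\perp\psi$, $\nabla^\perp=(-\partial_{x_2},\partial_{x_1})$, where $-\Delta\psi=\partial_{x_1}\rho$ in $S$ and $\psi=0$ on $\partial S$; that is, $u=\nabla^\perp(-\Delta_S)^{-1}\partial_{x_1}\rho$, where $-\Delta_S$ is the Laplacian with zero Dirichlet condition on $x_2=\pm\pi$. A stationary solution is a time-independent solution. Sobolev norms on $S$: $-\Delta_S$ is positive self-adjoint with orthogonal eigenbasis of $L^2(S)$ given by $\omega_{p,q}(x)=e^{ipx_1}b_q(x_2)$, $p\in\mathbb{Z}$, $q\in\mathbb{N}=\{1,2,\dots\}$, where $b_q(x_2)=\cos(qx_2/2)$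 for $q$ odd and $b_q(x_2)=\sin(qx_2/2)$ for $q$ even, with eigenvalues $p^2+q^2/4$. Powers $(-\Delta_S)^s$, $s\in\mathbb{R}$, are defined through this eigenfunction expansion, and $\|f\|_{\dot H^s(S)}^2=\int_S \bar f\,(-\Delta_S)^s f\,dx=\sum_{p,q}(p^2+q^2/4)^s\,|\langle f,\omega_{p,q}\rangle_{L^2(S)}|^2/\|\omega_{p,q}\|_{L^2(S)}^2$ (with value $+\infty$ if the sum diverges). For $s\ge 0$, $\|f\|_{H^s(S)}^2=\|f\|_{\dot H^s(S)}^2+\|f\|_{L^2(S)}^2$; for $s<0$, $H^s(S)$ is understood with the norm $\|\cdot\|_{\dot H^s(S)}$. *)

(* Defs.v *)
From mathcomp Require Export all_boot all_order all_algebra.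
From mathcomp Require Export all_classical all_reals all_analysis.

Set Implicit Arguments.
Unset Strict Implicit.
Unset Printing Implicit Defensive.

Export Order.TTheory GRing.Theory Num.Theory.
Export numFieldNormedType.Exports.

Local Open Scope classical_set_scope.
Local Open Scope ring_scope.

Section Smoothness.
Context {R : realType}.

Fixpoint Cn {V : normedModType R} (n : nat) (f : V -> R) : Prop :=
  if n is m.+1 then
    (forall x, differentiable f x) /\ (forall v, Cn m ('D_v f))
  else continuous f.

Definition smooth {V : normedModType R} (f : V -> R) : Prop :=
  forall n, Cn n f.

(* The strip S = T x [-pi, pi] is handled through its universal cover
   R x [-pi, pi]: a function on S is a function of (x1, x2) that is
   2 pi-periodic in x1, and only its values on [strip] are meaningful. *)
Definition strip : set (R * R) := [set x | - pi <= x.2 <= pi].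

Definition strip_interior : set (R * R) := [set x | - pi < x.2 < pi].

(* C^oo(S), i.e. smooth up to the boundary: restrictions to S of smooth
   functions on T x R. *)
Definition smooth_strip (f : R * R -> R) : Prop :=
  exists F : R * R -> R,
    [/\ smooth F, periodic F (2 * pi, 0) &
        forall x, strip x -> f x = F x].

(* C^oo(S x [0, oo)), in the same sense; the first coordinate is time. *)
Definition smooth_strip_time (rho : R -> R * R -> R) : Prop :=
  exists F : R * (R * R) -> R,
    [/\ smooth F, periodic F (0, (2 * pi, 0)) &
        forall t x, 0 <= t -> strip x -> rho t x = F (t, x)].

End Smoothness.

Section IPM.
Context {R : realType}.
Implicit Types (f rho psi : R * R -> R) (x : R * R).

Definition partial1 f : R * R -> R := 'D_(1, 0) f.

Definition partial2 f : R * R -> R := 'D_(0, 1) f.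

Definition laplacian f x : R :=
  partial1 (partial1 f) x + partial2 (partial2 f) x.

(* psi = (-Delta_S)^-1 (partial1 rho).  The equation is imposed in the open
   strip, where the derivatives only depend on the values on S; it extends to
   the boundary by continuity. *)
Definition stream_function rho psi : Prop :=
  [/\ smooth_strip psi,
      forall x, strip_interior x -> - laplacian psi x = partial1 rho x &
      forall x1 : R, psi (x1, - pi) = 0 /\ psi (x1, pi) = 0].

(* u = nabla^perp psi *)
Definition velocity psi x : R * R := (- partial2 psi x, partial1 psi x).

(* Global-in-time smooth solutions.  As above, the transport equation at t = 0
   and on the boundary follows by continuity. *)
Definition IPM_solution (rho : R -> R * R -> R) : Prop :=
  smooth_strip_time rho /\
  exists psi : R -> R * R -> R,
    (forall t, 0 <= t -> stream_function (rho t) (psi t)) /\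
    (forall t x, 0 < t -> strip_interior x ->
       derive1 (fun tau => rho tau x) t
       + ((velocity (psi t) x).1 * partial1 (rho t) x
          + (velocity (psi t) x).2 * partial2 (rho t) x) = 0).

Definition IPM_stationary rho : Prop := IPM_solution (fun=> rho).

End IPM.

Section Sobolev.
Context {R : realType}.
Implicit Types (f : R * R -> R) (s : R) (p : int) (q : nat).

Local Notation leb2 :=
  ((@lebesgue_measure R) \x (@lebesgue_measure R))%E.

(* a fundamental domain of S *)
Definition cell : set (R * R) := `[- pi, pi[ `*` `[- pi, pi].

Definition b_ q (y : R) : R :=
  if odd q then cos (q%:R * y / 2) else sin (q%:R * y / 2).

(* Real and imaginary parts of omega_{p,q}(x) = e^{i p x1} b_q(x2). *)
Definition omega_re p q (x : R * R) : R := cos (p%:~R * x.1) * b_ q x.2.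

Definition omega_im p q (x : R * R) : R := sin (p%:~R * x.1) * b_ q x.2.

Definition omega_normsq p q : R :=
  \int[leb2]_(x in cell) (omega_re p q x ^+ 2 + omega_im p q x ^+ 2).

(* |<f, omega_{p,q}>|^2 for a real-valued f *)
Definition coef_normsq f p q : R :=
  (\int[leb2]_(x in cell) (f x * omega_re p q x)) ^+ 2
  + (\int[leb2]_(x in cell) (f x * omega_im p q x)) ^+ 2.

Definition Hdot_normsq s f : \bar R :=
  (\esum_(k in [set k : int * nat | (0 < k.2)%N])
    (((k.1%:~R ^+ 2 + k.2%:R ^+ 2 / 4) `^ s
      * (coef_normsq f k.1 k.2 / omega_normsq k.1 k.2))%:E))%E.

Definition Hdot_norm s f : \bar R := sqrte (Hdot_normsq s f).

Definition L2_normsq f : \bar R :=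
  (\int[leb2]_(x in cell) ((f x ^+ 2)%:E))%E.

Definition H_norm s f : \bar R :=
  if 0 <= s then sqrte (Hdot_normsq s f + L2_normsq f)%E else Hdot_norm s f.

End Sobolev.

(* Main.v *)
(* The potential energy E(t) = int x2 rho has E' = - int |grad psi|^2 and is bounded
   below, since int rho^2 is conserved; hence delta(t) = int |grad psi|^2 satisfies
   t delta(t) -> 0 along a sequence of times.  For a stationary solution delta = 0, so
   rho_s only depends on x2.

   Perturb rho_s by a bump, small in H^(2 - gamma), which exceeds M = max rho_s
   somewhere but vanishes on the line x1 = pi.  The flow acts on circles winding around
   S, and every curve winding once around S meets {x1 = pi}: hence for all t each
   horizontal circle contains a point where rho(t) <= M.  As int ((rho - M)_+)^2 is
   conserved and positive, a Poincare inequality on circles gives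
   int |d1 rho(t)|^2 >= c > 0 for all t.

   Finally int |d1 rho|^2 is a sum over modes of weights A_k with
   sum A_k / lam_k <= delta(t), lam_k being the eigenvalues.  When K delta(t) <= c / 2,
   the modes with lam_k > K carry weight at least c / 4, so the squared homogeneous
   H^(s+1) norm is at least K^s c / 4; take K of order 1 / delta(t) >> t. *)
Require Import Defs.
From mathcomp Require Import ring lra.
From mathcomp Require Import measurable_realfun.

Set Implicit Arguments.
Unset Strict Implicit.
Unset Printing Implicit Defensive.

Local Open Scope classical_set_scope.
Local Open Scope ring_scope.

(** * C^n calculus on normed spaces *)

Section CnCalculus.
Context {R : realType} {V : normedModType R}.
Implicit Types (f g : V -> R) (n : nat) (x v w : V).

(** Three obstacles shape the proof. The stream function is given at each time separately, with no
    regularity in time, so no flow map is built. Instead finitely many backward Euler steps, along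
    which the density is nearly constant, are composed into a continuous map commuting with the
    translation by 2 pi in x1. The maximum principle bounds the normal velocity by a multiple of the
    distance to the boundary, which keeps short steps inside the strip. The maximum of [rho_s] may
    sit on the boundary, where the perturbation has to vanish to be small in norms built on
    Dirichlet modes. So the bump gets a boundary slope of fixed size, large enough to beat the slope
    of [rho_s]. At width d its height is of order d, its squared L2 norm is O(d^4) and that of its
    laplacian is O(1); interpolation makes every norm below H^2 small. Finally the lower bound on
    int |d1 rho|^2 must be seen by the modes, which requires their completeness. As d1 rho need not
    vanish on the boundary, uniform approximation is impossible; a cutoff in a thin boundary layer
    gives approximation in L2. *)

Lemma CnW n f : Cn n.+1 f -> Cn n f.
Proof.
elim: n f => [f [fd _] x|n IH f [fd fD]]; first exact/differentiable_continuous.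
by split=> // v; apply/IH/fD.
Qed.

Lemma Cn_le m n f : (m <= n)%N -> Cn n f -> Cn m f.
Proof.
move=> /subnKC <-; elim: (n - m)%N f => [|k IH] f; first by rewrite addn0.
by rewrite addnS => /CnW/IH.
Qed.

Lemma Cn_cont n f : Cn n f -> continuous f.
Proof. by move=> h; apply: (@Cn_le 0%N n). Qed.

Lemma Cn_diff n f x : Cn n.+1 f -> differentiable f x.
Proof. by case. Qed.

Lemma Cn_D n f v : Cn n.+1 f -> Cn n ('D_v f).
Proof. by case=> _; apply. Qed.

Lemma Cn_cst n (c : R) : Cn n (fun _ : V => c).
Proof.
elim: n c => [|n IH] c; first by move=> x; apply: cst_continuous.
split=> [x|v]; first exact: differentiable_cst.
have -> : 'D_v (fun _ : V => c) = (fun=> 0) by apply/funext => x; exact: derive_cst.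
by apply: IH.
Qed.

Lemma derive_add f g x v : differentiable f x -> differentiable g x ->
  'D_v (fun x => f x + g x) x = 'D_v f x + 'D_v g x.
Proof. by move=> df dg; rewrite (@deriveD _ _ _ f g)//; exact: diff_derivable. Qed.

Lemma derive_mul f g x v : differentiable f x -> differentiable g x ->
  'D_v (fun x => f x * g x) x = f x * 'D_v g x + g x * 'D_v f x.
Proof. by move=> df dg; rewrite (@deriveM _ _ f g)//; exact: diff_derivable. Qed.

Lemma derive_opp f x v : differentiable f x ->
  'D_v (fun x => - f x) x = - 'D_v f x.
Proof. by move=> df; rewrite (@deriveN _ _ _ f)//; exact: diff_derivable. Qed.

Lemma derive_scale (c : R) f x v : differentiable f x ->
  'D_v (fun x => c * f x) x = c * 'D_v f x.
Proof.
by move=> df; rewrite derive_mul ?derive_cst ?mulr0 ?addr0.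
Qed.

Lemma Cn_add n f g : Cn n f -> Cn n g -> Cn n (fun x => f x + g x).
Proof.
elim: n f g => [|n IH] f g; first by move=> cf cg x; apply: continuousD; [exact: cf|exact: cg].
move=> [df Df] [dg Dg]; split=> [x|v].
  by apply: (@differentiableD _ _ _ f g).
have -> : 'D_v (fun x => f x + g x) = (fun x => 'D_v f x + 'D_v g x).
  by apply/funext => x; rewrite derive_add.
by apply: IH; [exact: Df|exact: Dg].
Qed.

Lemma Cn_mul n f g : Cn n f -> Cn n g -> Cn n (fun x => f x * g x).
Proof.
elim: n f g => [|n IH] f g.
  by move=> cf cg x; apply: (@continuousM _ _ f g); [exact: cf|exact: cg].
move=> Cf Cg; have [df Df] := Cf; have [dg Dg] := Cg; split=> [x|v].
  by apply: (@differentiableM _ _ f g).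
have -> : 'D_v (fun x => f x * g x) = (fun x => f x * 'D_v g x + g x * 'D_v f x).
  by apply/funext => x; rewrite derive_mul.
by apply: Cn_add; apply: IH; [exact: CnW|exact: Dg|exact: CnW|exact: Df].
Qed.

Lemma Cn_scale n (c : R) f : Cn n f -> Cn n (fun x => c * f x).
Proof. by move=> Cf; apply: Cn_mul => //; exact: Cn_cst. Qed.

Lemma Cn_opp n f : Cn n f -> Cn n (fun x => - f x).
Proof.
move=> /(Cn_scale (-1)); congr (Cn n _).
by apply/funext => x; rewrite mulN1r.
Qed.

Lemma Cn_sub n f g : Cn n f -> Cn n g -> Cn n (fun x => f x - g x).
Proof. by move=> Cf Cg; apply: Cn_add => //; exact: Cn_opp. Qed.

Lemma Cn_exp n k f : Cn n f -> Cn n (fun x => f x ^+ k).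
Proof.
move=> Cf; elim: k => [|k IH]; first exact: Cn_cst.
have -> : (fun x => f x ^+ k.+1) = (fun x => f x * f x ^+ k).
  by apply/funext => x; rewrite exprS.
exact: Cn_mul.
Qed.

Lemma derive_comp1 (phi : R -> R) f x v : differentiable f x ->
  derivable phi (f x) 1 ->
  'D_v (fun x => phi (f x)) x = derive1 phi (f x) * 'D_v f x.
Proof.
move=> df dphi; have dp : differentiable phi (f x) by exact/derivable1_diffP.
have -> : (fun x => phi (f x)) = phi \o f by [].
rewrite deriveE; last exact: differentiable_comp.
by rewrite diff_comp//= (deriveE _ df) deriv1E// mulrC.
Qed.

End CnCalculus.

Section Composition.
Context {R : realType} {W V : normedModType R}.
Implicit Types (f : V -> R) (A L : W -> V).

Lemma comp_diff f A L y : is_diff y A L -> differentiable f (A y) ->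
  differentiable (fun y => f (A y)) y.
Proof. by move=> [dA _] df; apply: (@differentiable_comp _ _ _ _ A f). Qed.

Lemma comp_derive f A L y w : is_diff y A L -> differentiable f (A y) ->
  'D_w (fun y => f (A y)) y = 'D_(L w) f (A y).
Proof.
move=> dA' df; have [dA dAE] := dA'; rewrite deriveE; last exact: (comp_diff dA' df).
by rewrite (@diff_comp _ _ _ _ A f)//= dAE deriveE.
Qed.

Lemma Cn_comp n f A L : (forall y, is_diff y A L) ->
  Cn n f -> Cn n (fun y => f (A y)).
Proof.
move=> dA; elim: n f => [|n IH] f.
  move=> cf y; apply: (@continuous_comp _ _ _ A f); last exact: cf.
  by have [/differentiable_continuous] := dA y.
move=> [df Df]; split=> [y|w]; first exact: comp_diff.
have -> : 'D_w (fun y => f (A y)) = (fun y => 'D_(L w) f (A y)).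
  by apply/funext => y; apply: comp_derive.
exact: (IH _ (Df (L w))).
Qed.

End Composition.

Section Lines.
Context {R : realType} {V : normedModType R}.
Implicit Types (f : V -> R) (x v : V).

Lemma is_diff_line x v (r : R) : is_diff r (fun h : R => x + h *: v) (fun h => h *: v).
Proof.
have dx : is_diff r (cst x : R -> V) 0 by exact: is_diff_cst.
have dv : is_diff r ( *:%R^~ v : R -> V) ( *:%R^~ v) by exact: is_diff_scalel.
have := is_diffD dx dv; rewrite add0r; exact.
Qed.

Lemma is_derive_line f x v (r : R) : differentiable f (x + r *: v) ->
  is_derive r 1 (fun h : R => f (x + h *: v)) ('D_v f (x + r *: v)).
Proof.
move=> df; have dl := is_diff_line x v r; apply: DeriveDef.
  apply: diff_derivable; exact: (comp_diff dl df).
by rewrite (comp_derive _ dl df) scale1r.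
Qed.

Lemma is_diff_shift (W : normedModType R) (a y : W) : is_diff y (fun y => y + a) id.
Proof.
have dx : is_diff y (cst a : W -> W) 0 by exact: is_diff_cst.
have dv : is_diff y (id : W -> W) id by exact: is_diff_id.
have := is_diffD dv dx; rewrite addr0; exact.
Qed.

Lemma derive_shiftE f a x v : differentiable f (x + a) ->
  'D_v (fun x => f (x + a)) x = 'D_v f (x + a).
Proof. by move=> df; rewrite (comp_derive _ (is_diff_shift a x) df). Qed.

Lemma periodic_derive f a v : (forall x, differentiable f x) -> periodic f a ->
  periodic ('D_v f) a.
Proof.
move=> df pf x; rewrite -derive_shiftE//; congr (derive _ _ _).
by apply/funext => y; exact: pf.
Qed.

Lemma deriveDl f x v w : differentiable f x ->
  'D_(v + w) f x = 'D_v f x + 'D_w f x.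
Proof. by move=> df; rewrite !deriveE// linearD. Qed.

Lemma deriveZl f x (c : R) v : differentiable f x ->
  'D_(c *: v) f x = c * 'D_v f x.
Proof. by move=> df; rewrite !deriveE// linearZ. Qed.

End Lines.

(** * Symmetry of mixed second derivatives *)

Section Schwarz.
Context {R : realType} {V : normedModType R}.
Implicit Types (f : V -> R) (x v w : V) (h : R).

Lemma mvt_line f x v h : (forall y, differentiable f y) -> 0 < h ->
  exists2 c, 0 < c < h & f (x + h *: v) - f x = h * 'D_v f (x + c *: v).
Proof.
move=> df h0.
have dl r := is_derive_line (df (x + r *: v)).
have [|c] := @MVT R (fun r => f (x + r *: v)) (fun r => 'D_v f (x + r *: v)) 0 h h0 (fun r _ => dl r).
  apply: continuous_subspaceT => r.
  by apply/differentiable_continuous/derivable1_diffP; have [] := dl r.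
rewrite in_itv /= => c0h; rewrite scale0r addr0 subr0 => E.
by exists c => //; rewrite E mulrC.
Qed.

(** Mean value theorem twice: along [v] for the increment [g y = f (y + h *: w) - f y], then along
    [w] for ['D_v f]. *)
Lemma second_difference f x v w h : Cn 2 f -> 0 < h ->
  exists a b, [/\ 0 <= a <= h, 0 <= b <= h &
   f (x + h *: v + h *: w) - f (x + h *: v) - (f (x + h *: w) - f x) =
   h ^+ 2 * 'D_w ('D_v f) (x + a *: v + b *: w)].
Proof.
move=> C2 h0; have df y : differentiable f y by case: C2.
pose g y := f (y + h *: w) - f y.
have dfs y : differentiable (fun y => f (y + h *: w)) y.
  exact: (comp_diff (is_diff_shift (h *: w) y) (df _)).
have dg y : differentiable g y by apply: (@differentiableB _ _ _ (fun y => f (y + h *: w)) f).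
have [a /andP[a0 ah] E] := mvt_line x v dg h0.
have [b /andP[b0 bh] E'] := mvt_line (x + a *: v) w (fun y => Cn_diff y (Cn_D v C2)) h0.
exists a, b; split; rewrite ?ltW//.
rewrite /g in E; rewrite E /g derive_add//; last exact: differentiableN.
by rewrite derive_opp// derive_shiftE// E' expr2 mulrA.
Qed.

Lemma second_difference_cvg f x v w e : Cn 2 f -> 0 < e ->
  \forall h \near (0 : R)^'+,
  `| 'D_w ('D_v f) x -
   h ^- 2 * (f (x + h *: v + h *: w) - f (x + h *: v) - (f (x + h *: w) - f x))| < e.
Proof.
move=> C2 e0; have /cvgrPdist_lt := Cn_cont (Cn_D w (Cn_D v C2)) (x := x).
move=> /(_ e e0) /nbhs_normP[d /= d0 dE].
have nvw : 0 < `|v| + `|w| + 1 by rewrite ltr_pwDr// addr_ge0.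
near=> h.
have h0 : 0 < h by near: h; exact: nbhs_right_gt.
have [a [b [/andP[a0 ah] /andP[b0 bh] ->]]] := second_difference x v w C2 h0.
rewrite mulrA mulVf ?mul1r ?expf_neq0 ?gt_eqF//; apply: dE => /=.
rewrite -addrA opprD addrA subrr sub0r normrN.
apply: (le_lt_trans (ler_normD _ _)); rewrite !normrZ !ger0_norm//.
apply: (@le_lt_trans _ _ (h * (`|v| + `|w| + 1))).
  apply: (@le_trans _ _ (h * `|v| + h * `|w|)); first by rewrite lerD// ler_wpM2r.
  by rewrite !mulrDr mulr1 lerDl ltW.
rewrite -ltr_pdivlMr//; near: h; apply: nbhs_right_lt.
by rewrite divr_gt0.
Unshelve. all: by end_near. Qed.

(** The second difference is symmetric in [v] and [w], so both mixed derivatives are limits of the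
    same quotient. *)
Theorem schwarz f v w : Cn 2 f -> 'D_v ('D_w f) = 'D_w ('D_v f).
Proof.
move=> C2; apply/funext => x; apply/eqP; rewrite -subr_eq0 -normr_le0.
apply/ler_addgt0Pr => e e0; rewrite add0r.
have e20 : 0 < e / 2 by rewrite divr_gt0.
near (0 : R)^'+ => h.
have A : `| 'D_w ('D_v f) x -
   h ^- 2 * (f (x + h *: v + h *: w) - f (x + h *: v) - (f (x + h *: w) - f x))| < e / 2.
  by near: h; exact: second_difference_cvg.
have B : `| 'D_v ('D_w f) x -
   h ^- 2 * (f (x + h *: w + h *: v) - f (x + h *: w) - (f (x + h *: v) - f x))| < e / 2.
  by near: h; exact: second_difference_cvg.
have E : f (x + h *: w + h *: v) - f (x + h *: w) - (f (x + h *: v) - f x) =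
  f (x + h *: v + h *: w) - f (x + h *: v) - (f (x + h *: w) - f x).
  by rewrite (addrAC x); ring.
rewrite E in B; rewrite (splitr e); apply: ltW.
by apply: le_lt_trans (ltrD B A); rewrite [X in _ <= _ + X]distrC; apply: ler_distD.
Unshelve. all: by end_near. Qed.

End Schwarz.

Section SmoothComposition.
Context {R : realType} {V : normedModType R}.
Implicit Types (f : V -> R) (n : nat).

Lemma Cn_cos_sin n f : Cn n f -> Cn n (fun x => cos (f x)) /\ Cn n (fun x => sin (f x)).
Proof.
elim: n f => [|n IH] f Cf.
  split=> x; apply: (@continuous_comp _ _ _ f); try exact: Cf.
    exact: continuous_cos.
  exact: continuous_sin.
have [Cc Cs] := IH f (CnW Cf).
have dp (phi : R -> R) x : derivable phi (f x) 1 -> differentiable (fun x => phi (f x)) x.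
  move=> /derivable1_diffP dphi.
  by apply: (@differentiable_comp _ _ _ _ f phi) => //; exact: Cn_diff Cf.
split; split=> [x|v].
- by apply: (dp cos); exact: derivable_cos.
- have -> : 'D_v (fun x => cos (f x)) = (fun x => - sin (f x) * 'D_v f x).
    apply/funext => x; rewrite (derive_comp1 v (Cn_diff x Cf) (@derivable_cos R (f x))).
    by rewrite derive1E derive_val.
  by apply: Cn_mul; [exact: Cn_opp|exact: Cn_D].
- by apply: (dp sin); exact: derivable_sin.
- have -> : 'D_v (fun x => sin (f x)) = (fun x => cos (f x) * 'D_v f x).
    apply/funext => x; rewrite (derive_comp1 v (Cn_diff x Cf) (@derivable_sin R (f x))).
    by rewrite derive1E derive_val.
  by apply: Cn_mul; [|exact: Cn_D].
Qed.

Lemma Cn_expR n f : Cn n f -> Cn n (fun x => expR (f x)).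
Proof.
elim: n f => [|n IH] f Cf.
  by move=> x; apply: (@continuous_comp _ _ _ f); [exact: Cf|exact: continuous_expR].
split=> [x|v].
  apply: (@differentiable_comp _ _ _ _ f expR); first exact: Cn_diff Cf.
  by apply/derivable1_diffP; exact: derivable_expR.
have -> : 'D_v (fun x => expR (f x)) = (fun x => expR (f x) * 'D_v f x).
  apply/funext => x; rewrite (derive_comp1 v (Cn_diff x Cf) (@derivable_expR R (f x))).
  by rewrite derive1E derive_val.
by apply: Cn_mul; [exact/IH/CnW|exact: Cn_D].
Qed.

End SmoothComposition.

Section Plane.
Context {R : realType}.
Implicit Types (f : R * R -> R) (x v : R * R) (n : nat).

Lemma is_diff_fst x : is_diff x (fst : R * R -> R) fst.
Proof.
have cf : continuous (fst : R * R -> R) by move=> y; exact: cvg_fst.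
apply: DiffDef; first exact: linear_differentiable.
by rewrite diff_lin.
Qed.

Lemma is_diff_snd x : is_diff x (snd : R * R -> R) snd.
Proof.
have cf : continuous (snd : R * R -> R) by move=> y; exact: cvg_snd.
apply: DiffDef; first exact: linear_differentiable.
by rewrite diff_lin.
Qed.

Lemma Cn_id n : Cn n (fun x : R => x).
Proof.
case: n => [|n]; first by move=> x; exact: cvg_id.
split=> [x|v]; first by have [] := is_diff_id x.
have -> : 'D_v (fun x : R => x) = (fun=> v).
  by apply/funext => x; rewrite (derive_id x v).
exact: Cn_cst.
Qed.

Lemma Cn_fst n (g : R -> R) : Cn n g -> Cn n (fun x : R * R => g x.1).
Proof. by apply: Cn_comp; exact: is_diff_fst. Qed.

Lemma Cn_snd n (g : R -> R) : Cn n g -> Cn n (fun x : R * R => g x.2).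
Proof. by apply: Cn_comp; exact: is_diff_snd. Qed.

Lemma derive_fst (g : R -> R) x v : differentiable g x.1 ->
  'D_v (fun x : R * R => g x.1) x = v.1 * derive1 g x.1.
Proof.
move=> dg; rewrite (comp_derive _ (is_diff_fst x) dg) derive1E.
by rewrite -[in LHS](mulr1 v.1) (@deriveZl _ _ g x.1 v.1 1).
Qed.

Lemma derive_snd (g : R -> R) x v : differentiable g x.2 ->
  'D_v (fun x : R * R => g x.2) x = v.2 * derive1 g x.2.
Proof.
move=> dg; rewrite (comp_derive _ (is_diff_snd x) dg) derive1E.
by rewrite -[in LHS](mulr1 v.2) (@deriveZl _ _ g x.2 v.2 1).
Qed.

End Plane.

(** * Integrals over the cell *)

Lemma continuous_pairf (T A B : topologicalType) (f : T -> A) (g : T -> B) (t : T) :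
  {for t, continuous f} -> {for t, continuous g} ->
  {for t, continuous (fun t => (f t, g t))}.
Proof. exact: (@cvg_pair T A B (nbhs t) (nbhs (f t)) (nbhs (g t))). Qed.

Section PlaneIntegral.
Context {R : realType}.
Implicit Types (f g : R * R -> R).

Notation mu := (@lebesgue_measure R).
Notation mu2 := (mu \x mu)%E.

Lemma continuous_fix1 f a : continuous f -> continuous (fun y => f (a, y)).
Proof.
move=> cf y; apply: (@continuous_comp _ _ _ (fun y : R => (a, y)) f); last exact: cf.
by apply: continuous_pairf; [exact: cst_continuous|exact: cvg_id].
Qed.

Lemma continuous_fix2 f b : continuous f -> continuous (fun x => f (x, b)).
Proof.
move=> cf y; apply: (@continuous_comp _ _ _ (fun x : R => (x, b)) f); last exact: cf.
by apply: continuous_pairf; [exact: cvg_id|exact: cst_continuous].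
Qed.

(** Measurability is for the product sigma-algebra. Rounding x.1 down to a grid of mesh 1/(n+1)
    turns [f] into a countable gluing, over vertical bands, of continuous functions of x.2 alone;
    [f] is the pointwise limit of these. *)
Lemma continuous_measurable2 f : continuous f -> measurable_fun setT f.
Proof.
move=> cf.
pose q (n : nat) (x : R) : R := (Num.floor (n.+1%:R * x))%:~R / n.+1%:R.
apply: (@measurable_fun_cvg _ _ _ _ (fun n x => f (q n x.1, x.2))).
- move=> n _ /= A mA; rewrite setTI.
  rewrite (_ : _ @^-1` _ = \bigcup_(k : int)
     ([set x | n.+1%:R^-1 * k%:~R <= x < n.+1%:R^-1 * (k + 1)%:~R] `*`
      [set y | A (f (k%:~R / n.+1%:R, y))])); last first.
    apply/seteqP; split=> [x /= Ax|x [k _ [/= xk]]].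
      exists (Num.floor (n.+1%:R * x.1)) => //; split=> //=.
      by rewrite ler_pdivrMl// ltr_pdivlMl// floor_itv.
    rewrite /q => Ax /=; suff -> : Num.floor (n.+1%:R * x.1) = k by [].
    by apply: floor_def; rewrite -ler_pdivrMl// -ltr_pdivlMl.
  apply: (@countable_bigcupT_measurable _ _ int) => [|k]; first exact: countableP.
  apply: measurableX.
    rewrite (_ : [set x | _] = `[n.+1%:R^-1 * k%:~R, n.+1%:R^-1 * (k + 1)%:~R[%classic); first exact: measurable_itv.
    by apply/seteqP; split=> x /=; rewrite in_itv.
  have cfk : continuous (fun y => f (k%:~R / n.+1%:R, y)).
    exact: continuous_fix1.
  by have := continuous_measurable_fun cfk measurableT mA; rewrite setTI.
- move=> x _; have -> : x = (x.1, x.2) by case: x.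
  have qx : q n x.1 @[n --> \oo] --> x.1.
    apply/cvgrPdist_lt => e e0; near=> n.
    rewrite /q; have /andP[fl1 fl2] := floor_itv (n.+1%:R * x.1).
    have n0 : (0 : R) < n.+1%:R by [].
    have ne : 1 < e * n.+1%:R.
      rewrite -ltr_pdivrMr// div1r; near: n.
      exact: (near_infty_natSinv_lt (PosNum e0)).
    rewrite intrD in fl2.
    have h1 : (Num.floor (n.+1%:R * x.1))%:~R / n.+1%:R <= x.1.
      by rewrite ler_pdivrMr// (mulrC x.1).
    have h2 : x.1 - e < (Num.floor (n.+1%:R * x.1))%:~R / n.+1%:R.
      by rewrite ltr_pdivlMr// mulrBl (mulrC x.1); lra.
    by rewrite ger0_norm ?subr_ge0// ltrBlDr addrC -ltrBlDr.
  apply: (@cvg_comp _ _ _ (fun n => (q n x.1, x.2)) f _ (nbhs (x.1, x.2))); last exact: cf.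
  by apply: (@cvg_pair _ _ _ _ (nbhs x.1) (nbhs x.2)) => //; exact: cvg_cst.
Unshelve. all: by end_near. Qed.

(** The compact closure of [cell], on which extreme values are taken; by periodicity in x1 it
    controls the whole strip. *)
Definition clcell : set (R * R) := `[- pi, pi] `*` `[- pi, pi].

Lemma compact_clcell : compact clcell.
Proof. by apply: compact_setX; exact: segment_compact. Qed.

Lemma cell_clcell : cell `<=` clcell.
Proof.
move=> x [/= x1 x2]; split => //=; move: x1; rewrite !in_itv /= => /andP[-> /ltW ->] //.
Qed.

Lemma clcell_bounded f : continuous f -> exists2 M : R, 0 <= M & forall x, clcell x -> `|f x| <= M.
Proof.
move=> cf; have [||c _ cmax] := @compact_EVT_max _ R (fun x => `|f x|) clcell _ compact_clcell.
- by exists (0, 0); split => /=; rewrite in_itv /= oppr_le0 pi_ge0.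
- apply: continuous_subspaceT => x.
  by apply: (@continuous_comp _ _ _ f); [exact: cf|exact: norm_continuous].
- by exists `|f c| => // x xc; apply: cmax; rewrite inE.
Qed.

Lemma measurable_cell : measurable (cell : set (R * R)).
Proof. by apply: measurableX; exact: measurable_itv. Qed.

Lemma mu2_cell : (mu2 (cell : set (R * R)) < +oo)%E.
Proof.
rewrite product_measure1E; [|exact: measurable_itv|exact: measurable_itv].
rewrite /= !lebesgue_measure_itv /=.
by case: ifP => _; rewrite ?mule0 ?mul0e ?ltry// -EFinD -EFinM ltry.
Qed.

Lemma cell_integrable f : continuous f -> mu2.-integrable cell (EFin \o f).
Proof.
move=> cf; apply: measurable_bounded_integrable.
- exact: measurable_cell.
- exact: mu2_cell.
- by apply: measurable_funTS; exact: continuous_measurable2.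
- have [M M0 fM] := clcell_bounded cf; exists M; split; first exact: num_real.
  by move=> N MN x /= /cell_clcell/fM/le_trans; apply; exact: ltW.
Qed.

Definition cint f : R := \int[mu2]_(x in cell) f x.

Definition seg : set R := `[- pi, pi].
Definition sint (g : R -> R) : R := \int[mu]_(x in seg) g x.

Lemma mu_seg : mu seg = (2 * pi)%:E.
Proof.
apply: etrans (lebesgue_measure_itv _) _.
by rewrite /= lte_fin gtrN ?pi_gt0// -EFinD opprK -mulr2n mulr_natl.
Qed.

Lemma sint_cst c : sint (fun=> c) = c * (2 * pi).
Proof.
rewrite /sint; apply: etrans; first by apply: Rintegral_cst; exact: measurable_itv.
congr (_ * _); rewrite -[RHS]/(fine (2 * pi)%:E); congr fine; exact: mu_seg.
Qed.

Lemma co_seg : [set` `[- pi, pi[ : interval R] `<=` seg.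
Proof. by move=> x; rewrite /seg /= !in_itv /= => /andP[-> /ltW]. Qed.

Lemma seg_integrable (g : R -> R) : continuous g -> mu.-integrable seg (EFin \o g).
Proof.
move=> cg; apply: continuous_compact_integrable; first exact: segment_compact.
exact: continuous_subspaceT.
Qed.

(** Tube argument: around each (a, b) there is a box where [F] stays within e/2 of its centre value,
    and the near-covering form of compactness makes the neighbourhood of [a] uniform in [b]. *)
Lemma near_compact_dist (A : topologicalType) (B : topologicalType) (K : set B)
    (F : A * B -> R) (a : A) (e : R) : compact K -> continuous F -> 0 < e ->
  \forall a' \near a, forall b, K b -> `|F (a, b) - F (a', b)| < e.
Proof.
move=> /compact_near_coveringP cK cF e0.
apply: (cK A (nbhs a) (fun a' b => `|F (a, b) - F (a', b)| < e)) => b Kb.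
have e20 : 0 < e / 2 by rewrite divr_gt0.
have /cvgrPdist_lt/(_ _ e20) [[/= U V] [Ua Vb] UV] := cF (a, b).
exists (V, U) => // -[b' a'] [/= Vb' Ua'].
have A1 := UV (a, b') (conj (nbhs_singleton Ua) Vb').
have A2 := UV (a', b') (conj Ua' Vb').
rewrite /= in A1 A2; rewrite (splitr e).
apply: le_lt_trans (ltrD A1 A2); rewrite [X in _ <= X + _]distrC; exact: ler_distD.
Qed.

Lemma sint_near (F : R * R -> R) (a e : R) : continuous F -> 0 < e ->
  \forall a' \near a, `|sint (fun y => F (a, y)) - sint (fun y => F (a', y))| < e.
Proof.
move=> cF e0.
have e20 : 0 < e / (2 * pi + 1).
  by rewrite divr_gt0// ltr_pwDr// mulr_ge0// pi_ge0.
have := near_compact_dist a (@segment_compact R (- pi) pi) cF e20.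
apply: filterS => a' ha'.
have c1 := @continuous_fix1 F a cF; have c2 := @continuous_fix1 F a' cF.
rewrite /sint -RintegralB//; [|exact: measurable_itv|exact: seg_integrable..].
have cB : continuous (fun y => F (a, y) - F (a', y)).
  by move=> y; apply: (@continuousB _ _ _ (fun y => F (a, y)) (fun y => F (a', y))); [exact: c1|exact: c2].
apply: le_lt_trans (le_normr_Rintegral _ _) _; first exact: measurable_itv.
  exact: seg_integrable.
apply: (@le_lt_trans _ _ (\int[mu]_(x in seg) (e / (2 * pi + 1)))).
  apply: le_Rintegral.
  - exact: measurable_itv.
  - apply: (@seg_integrable (fun x => `|F (a, x) - F (a', x)|)) => x.
    by apply: (@continuous_comp _ _ _ (fun y => F (a, y) - F (a', y))); [exact: cB|exact: norm_continuous].
  - by apply: (@seg_integrable (fun=> _)) => x; exact: cst_continuous.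
  - by move=> x xs; apply/ltW/ha'.
rewrite -/(sint (fun=> e / (2 * pi + 1))) sint_cst.
rewrite mulrAC ltr_pdivrMr; last by rewrite ltr_pwDr// mulr_ge0// pi_ge0.
by rewrite ltr_pM2l// ltrDl.
Qed.

Lemma sint_continuous (F : R * R -> R) : continuous F ->
  continuous (fun x => sint (fun y => F (x, y))).
Proof.
by move=> cF a; apply/cvgrPdist_lt => e e0; exact: sint_near.
Qed.

Lemma swap_continuous f : continuous f -> continuous (fun x : R * R => f (x.2, x.1)).
Proof.
move=> cf x; apply: (@continuous_comp _ _ _ (fun x : R * R => (x.2, x.1)) f); last exact: cf.
by apply: continuous_pairf; [exact: cvg_snd|exact: cvg_fst].
Qed.

Lemma sint_itv_bndo (g : R -> R) : continuous g -> \int[mu]_(x in `[- pi, pi[) g x = sint g.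
Proof.
move=> cg; rewrite Rintegral_itv_bndo_bndc//; apply: integrableS (seg_integrable cg).
- exact: measurable_itv.
- exact: measurable_itv.
- exact: co_seg.
Qed.

Lemma cint_restrict f : continuous f -> mu2.-integrable setT ((EFin \o f) \_ cell).
Proof.
move=> cf; apply/integrable_restrict; rewrite ?setTI//; first exact: measurable_cell.
exact: cell_integrable.
Qed.

Lemma cint_iter1 f : continuous f -> cint f = sint (fun x => sint (fun y => f (x, y))).
Proof.
move=> cf; rewrite /cint /Rintegral integral_mkcond.
rewrite -(integral12_prod_meas1 (cint_restrict cf)) /fubini_F.
rewrite -[RHS]sint_itv_bndo; last exact: sint_continuous.
rewrite [in RHS]/Rintegral; congr fine; rewrite [RHS]integral_mkcond.
apply: eq_integral => x _; rewrite patchE; case: ifPn => [|] xc.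
  rewrite /sint /Rintegral /= fineK; last first.
    apply: (@integrable_fin_num _ _ _ mu) => //; first exact: measurable_itv.
    by apply: seg_integrable; exact: continuous_fix1.
  rewrite [RHS]integral_mkcond; apply: eq_integral => y _.
  rewrite !patchE; congr (if _ then _ else _).
  apply/idP/idP; rewrite !inE; first by case.
  by move=> yc; split=> //; rewrite inE in xc.
apply: integral0_eq => y _; rewrite patchE ifF//; apply/negP; rewrite inE => -[/= x1 _].
by move/negP: xc; apply; rewrite inE.
Qed.

Lemma cint_iter2 f : continuous f -> cint f = sint (fun y => sint (fun x => f (x, y))).
Proof.
move=> cf; rewrite /cint /Rintegral integral_mkcond.
rewrite -(integral21_prod_meas1 (cint_restrict cf)) /fubini_G.
rewrite -[RHS]/(fine (\int[mu]_(y in seg) (sint (fun x => f (x, y)))%:E)%E).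
congr fine; rewrite [RHS]integral_mkcond.
apply: eq_integral => y _; rewrite patchE; case: ifPn => [|] yc.
  have cfy := @continuous_fix2 f y cf.
  rewrite -sint_itv_bndo// /Rintegral /= fineK; last first.
    apply: (@integrable_fin_num _ _ _ mu) => //.
    apply: integrableS (seg_integrable cfy).
    - exact: measurable_itv.
    - exact: measurable_itv.
    - exact: co_seg.
  rewrite [RHS]integral_mkcond; apply: eq_integral => x _.
  rewrite !patchE; congr (if _ then _ else _).
  apply/idP/idP; rewrite !inE; first by case.
  by move=> xc; split=> //; rewrite inE in yc.
apply: integral0_eq => x _; rewrite patchE ifF//; apply/negP; rewrite inE => -[/= _ y1].
by move/negP: yc; apply; rewrite inE.
Qed.

End PlaneIntegral.

Section Continuity.
Context {R : realType} {T : topologicalType}.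
Implicit Types (f g : T -> R).

Lemma cont_add f g : continuous f -> continuous g -> continuous (fun x => f x + g x).
Proof. by move=> cf cg x; apply: (@continuousD _ _ _ f g); [exact: cf|exact: cg]. Qed.

Lemma cont_mul f g : continuous f -> continuous g -> continuous (fun x => f x * g x).
Proof. by move=> cf cg x; apply: (@continuousM _ _ f g); [exact: cf|exact: cg]. Qed.

Lemma cont_cst (c : R) : continuous (fun _ : T => c).
Proof. by move=> x; apply: cst_continuous. Qed.

Lemma cont_scale (c : R) f : continuous f -> continuous (fun x => c * f x).
Proof. by move=> cf; apply: cont_mul => //; exact: cont_cst. Qed.

Lemma cont_opp f : continuous f -> continuous (fun x => - f x).
Proof. by move=> cf x; apply: (@continuousN _ _ _ f); exact: cf. Qed.

Lemma cont_sub f g : continuous f -> continuous g -> continuous (fun x => f x - g x).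
Proof. by move=> cf cg; apply: cont_add => //; exact: cont_opp. Qed.

Lemma cont_exp k f : continuous f -> continuous (fun x => f x ^+ k).
Proof.
move=> cf; elim: k => [|k IH]; first exact: cont_cst.
rewrite (_ : (fun x => _) = (fun x => f x * f x ^+ k)); first exact: cont_mul.
by apply/funext => x; rewrite exprS.
Qed.

Lemma cont_norm f : continuous f -> continuous (fun x => `|f x|).
Proof. by move=> cf x; apply: (@continuous_comp _ _ _ f); [exact: cf|exact: norm_continuous]. Qed.

End Continuity.

Section PartialLines.
Context {R : realType}.

(* partial1 and partial2 behind opaque proofs: comparing the two by unfolding is
   hopelessly slow for the unifier. *)
Lemma partial1_sealed : {D : (R * R -> R) -> R * R -> R | D = partial1}.
Proof. by exists partial1. Qed.

Lemma partial2_sealed : {D : (R * R -> R) -> R * R -> R | D = partial2}.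
Proof. by exists partial2. Qed.

Definition dx1 : (R * R -> R) -> R * R -> R := sval partial1_sealed.
Definition dx2 : (R * R -> R) -> R * R -> R := sval partial2_sealed.

Lemma dx1E : dx1 = partial1. Proof. exact: (svalP partial1_sealed). Qed.
Lemma dx2E : dx2 = partial2. Proof. exact: (svalP partial2_sealed). Qed.

Lemma laplacianE (f : R * R -> R) x : laplacian f x = dx1 (dx1 f) x + dx2 (dx2 f) x.
Proof. by rewrite dx1E dx2E. Qed.

Lemma Cn_partial1 n (f : R * R -> R) : Cn n.+1 f -> Cn n (dx1 f).
Proof. by rewrite ?dx1E ?dx2E; case=> _; apply. Qed.

Lemma Cn_partial2 n (f : R * R -> R) : Cn n.+1 f -> Cn n (dx2 f).
Proof. by rewrite ?dx1E ?dx2E; case=> _; apply. Qed.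

Lemma partial1_mul (f g : R * R -> R) x : differentiable f x -> differentiable g x ->
  dx1 (fun x => f x * g x) x = f x * dx1 g x + g x * dx1 f x.
Proof. rewrite ?dx1E ?dx2E; exact: derive_mul. Qed.

Lemma partial2_mul (f g : R * R -> R) x : differentiable f x -> differentiable g x ->
  dx2 (fun x => f x * g x) x = f x * dx2 g x + g x * dx2 f x.
Proof. rewrite ?dx1E ?dx2E; exact: derive_mul. Qed.

Lemma partial1_add (f g : R * R -> R) x : differentiable f x -> differentiable g x ->
  dx1 (fun x => f x + g x) x = dx1 f x + dx1 g x.
Proof. rewrite ?dx1E ?dx2E; exact: derive_add. Qed.

Lemma partial2_add (f g : R * R -> R) x : differentiable f x -> differentiable g x ->
  dx2 (fun x => f x + g x) x = dx2 f x + dx2 g x.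
Proof. rewrite ?dx1E ?dx2E; exact: derive_add. Qed.

Lemma partial1_scale c (f : R * R -> R) x : differentiable f x ->
  dx1 (fun x => c * f x) x = c * dx1 f x.
Proof. rewrite ?dx1E ?dx2E; exact: derive_scale. Qed.

Lemma partial2_scale c (f : R * R -> R) x : differentiable f x ->
  dx2 (fun x => c * f x) x = c * dx2 f x.
Proof. rewrite ?dx1E ?dx2E; exact: derive_scale. Qed.

Lemma partial1_opp (f : R * R -> R) x : differentiable f x ->
  dx1 (fun x => - f x) x = - dx1 f x.
Proof. rewrite ?dx1E ?dx2E; exact: derive_opp. Qed.

Lemma partial2_opp (f : R * R -> R) x : differentiable f x ->
  dx2 (fun x => - f x) x = - dx2 f x.
Proof. rewrite ?dx1E ?dx2E; exact: derive_opp. Qed.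

Lemma periodic_partial1 (f : R * R -> R) a : (forall x, differentiable f x) -> periodic f a ->
  periodic (dx1 f) a.
Proof. rewrite ?dx1E ?dx2E; exact: periodic_derive. Qed.

Lemma periodic_partial2 (f : R * R -> R) a : (forall x, differentiable f x) -> periodic f a ->
  periodic (dx2 f) a.
Proof. rewrite ?dx1E ?dx2E; exact: periodic_derive. Qed.

Lemma partial_swap (f : R * R -> R) : Cn 2 f -> dx1 (dx2 f) = dx2 (dx1 f).
Proof. rewrite ?dx1E ?dx2E; exact: schwarz. Qed.

Implicit Types (h : R * R -> R) (x y : R).

Lemma is_derive_x h x y : differentiable h (x, y) ->
  is_derive x (1 : R) (fun r => h (r, y)) (dx1 h (x, y)).
Proof.
rewrite ?dx1E ?dx2E.
have E r : ((0, y) : R * R) + r *: ((1, 0) : R * R) = (r, y).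
  by congr (_, _); rewrite /= /GRing.scale /= ?mulr1 ?mulr0 ?add0r ?addr0.
have -> : (fun r => h (r, y)) = (fun r => h (((0, y) : R * R) + r *: ((1, 0) : R * R))).
  by apply/funext => r; rewrite E.
by have := @is_derive_line _ _ h (0, y) (1, 0) x; rewrite E.
Qed.

Lemma is_derive_y h x y : differentiable h (x, y) ->
  is_derive y (1 : R) (fun r => h (x, r)) (dx2 h (x, y)).
Proof.
rewrite ?dx1E ?dx2E.
have E r : ((x, 0) : R * R) + r *: ((0, 1) : R * R) = (x, r).
  by congr (_, _); rewrite /= /GRing.scale /= ?mulr1 ?mulr0 ?add0r ?addr0.
have -> : (fun r => h (x, r)) = (fun r => h (((x, 0) : R * R) + r *: ((0, 1) : R * R))).
  by apply/funext => r; rewrite E.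
by have := @is_derive_line _ _ h (x, 0) (0, 1) y; rewrite E.
Qed.

End PartialLines.

Section IntegralAlgebra.
Context {R : realType}.
Implicit Types (f g : R * R -> R) (u v : R -> R).

Notation mu := (@lebesgue_measure R).
Notation mu2 := (mu \x mu)%E.

Lemma eq_cint f g : (forall x, cell x -> f x = g x) -> cint f = cint g.
Proof. by move=> fg; apply: eq_Rintegral => x; rewrite inE => /fg. Qed.

Lemma cintD f g : continuous f -> continuous g ->
  cint (fun x => f x + g x) = cint f + cint g.
Proof.
by move=> cf cg; apply: RintegralD; [exact: measurable_cell|exact: cell_integrable..].
Qed.

Lemma cintZ (c : R) f : continuous f -> cint (fun x => c * f x) = c * cint f.
Proof.
by move=> cf; apply: RintegralZl; [exact: measurable_cell|exact: cell_integrable].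
Qed.

Lemma cintN f : continuous f -> cint (fun x => - f x) = - cint f.
Proof.
move=> cf; rewrite -mulN1r -cintZ//; apply: eq_cint => x _; by rewrite mulN1r.
Qed.

Lemma cintB f g : continuous f -> continuous g ->
  cint (fun x => f x - g x) = cint f - cint g.
Proof. by move=> cf cg; rewrite cintD ?cintN//; exact: cont_opp. Qed.

Lemma cint_ge0 f : (forall x, cell x -> 0 <= f x) -> 0 <= cint f.
Proof. by move=> f0; apply: Rintegral_ge0 => x /f0. Qed.

Lemma le_cint f g : continuous f -> continuous g ->
  (forall x, cell x -> f x <= g x) -> cint f <= cint g.
Proof.
by move=> cf cg fg; apply: le_Rintegral => //; [exact: measurable_cell|exact: cell_integrable..].
Qed.

Lemma eq_sint u v : (forall x, - pi <= x <= pi -> u x = v x) -> sint u = sint v.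
Proof. by move=> uv; apply: eq_Rintegral => x; rewrite inE /seg /= in_itv => /uv. Qed.

Lemma sintD u v : continuous u -> continuous v ->
  sint (fun x => u x + v x) = sint u + sint v.
Proof.
by move=> cf cg; apply: RintegralD; [exact: measurable_itv|exact: seg_integrable..].
Qed.

Lemma sintZ (c : R) u : continuous u -> sint (fun x => c * u x) = c * sint u.
Proof.
by move=> cf; apply: RintegralZl; [exact: measurable_itv|exact: seg_integrable].
Qed.

Lemma sint_ge0 u : (forall x, - pi <= x <= pi -> 0 <= u x) -> 0 <= sint u.
Proof. by move=> u0; apply: Rintegral_ge0 => x; rewrite /seg /= in_itv; exact: u0. Qed.

Lemma le_sint u v : continuous u -> continuous v ->
  (forall x, - pi <= x <= pi -> u x <= v x) -> sint u <= sint v.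
Proof.
move=> cf cg fg; apply: le_Rintegral; [exact: measurable_itv|exact: seg_integrable..|].
by move=> x; rewrite /seg /= in_itv; exact: fg.
Qed.

Lemma cint_tensor u v : continuous u -> continuous v ->
  cint (fun x => u x.1 * v x.2) = sint u * sint v.
Proof.
move=> cu cv; rewrite cint_iter1; last first.
  by apply: cont_mul => x; apply: continuous_comp; try exact: cu; try exact: cv;
    [exact: cvg_fst|exact: cvg_snd].
rewrite mulrC -sintZ//; apply: eq_sint => x _.
by rewrite /= sintZ// mulrC.
Qed.

Lemma sint_FTC u (du : R -> R) : (forall x : R, is_derive x (1 : R) u (du x)) -> continuous du ->
  sint du = u pi - u (- pi).
Proof.
move=> hu cdu; have cu : continuous u.
  by move=> x; apply/differentiable_continuous/derivable1_diffP; have [] := hu x.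
rewrite /sint /Rintegral /seg.
have /= -> := @continuous_FTC2 R du u (- pi) pi.
- by [].
- by rewrite gtrN// pi_gt0.
- exact: continuous_subspaceT.
- split=> [x _||]; first by have [] := hu x.
    exact/cvg_at_right_filter/cu.
  exact/cvg_at_left_filter/cu.
- by move=> x _; rewrite derive1E; have [_] := hu x.
Qed.

Lemma cint_D1 (h : R * R -> R) : Cn 1 h -> periodic h (2 * pi, 0) -> cint (dx1 h) = 0.
Proof.
move=> Ch ph; rewrite cint_iter2; last exact: Cn_cont (Cn_partial1 Ch).
rewrite -[RHS](mul0r (2 * pi)) -sint_cst; apply: eq_sint => y _.
have -> : sint (fun x => dx1 h (x, y)) = h (pi, y) - h (- pi, y).
  apply: (@sint_FTC (fun x => h (x, y))); last exact: (@continuous_fix2 _ (dx1 h) y (Cn_cont (Cn_partial1 Ch))).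
  by move=> x; apply: is_derive_x; exact: Cn_diff Ch.
rewrite -(ph (- pi, y)) -[RHS](subrr (h (pi, y))); congr (_ - h _).
by congr (_, _); rewrite /= ?addr0//; ring.
Qed.

Lemma cint_D2 (h : R * R -> R) : Cn 1 h -> (forall x, h (x, - pi) = 0 /\ h (x, pi) = 0) -> cint (dx2 h) = 0.
Proof.
move=> Ch ph; rewrite cint_iter1; last exact: Cn_cont (Cn_partial2 Ch).
rewrite -[RHS](mul0r (2 * pi)) -sint_cst; apply: eq_sint => x _.
have -> : sint (fun y => dx2 h (x, y)) = h (x, pi) - h (x, - pi).
  apply: (@sint_FTC (fun y => h (x, y))); last exact: (@continuous_fix1 _ (dx2 h) x (Cn_cont (Cn_partial2 Ch))).
  by move=> y; apply: is_derive_y; exact: Cn_diff Ch.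
by have [-> ->] := ph x; rewrite subr0.
Qed.

(** By continuity [u] exceeds [u x0 / 2] on an interval around [x0]; its radius [d'] is cut down so
    that the interval lies in [seg]. *)
Lemma sint_gt0 u x0 : continuous u -> (forall x, - pi <= x <= pi -> 0 <= u x) ->
  - pi < x0 < pi -> 0 < u x0 -> 0 < sint u.
Proof.
move=> cu u0 /andP[x1 x2] ux0.
have ux2 : 0 < u x0 / 2 by rewrite divr_gt0.
have /cvgrPdist_lt/(_ _ ux2) /nbhs_normP[d /= d0 dE] := cu x0.
pose d' := Num.min (d / 2) (Num.min (x0 + pi) (pi - x0)).
have d'0 : 0 < d' by rewrite !lt_min divr_gt0//= subr_gt0 x2 -ltrBlDr sub0r x1.
have dd : d' < d.
  by apply: (@le_lt_trans _ _ (d / 2)); rewrite ?ge_min ?lexx// ltr_pdivrMr// ltr_pMr// ltr1n.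
have dl : d' <= x0 + pi by rewrite !ge_min lexx !orbT.
have dr : d' <= pi - x0 by rewrite !ge_min lexx !orbT.
pose Q : set R := [set` `[x0 - d', x0 + d']].
have Qseg : Q `<=` seg.
  by move=> x; rewrite /Q /seg /= !in_itv /= => /andP[h1 h2]; apply/andP; split; lra.
have cut : \int[mu]_(x in Q) (u x0 / 2) <= sint u.
  apply: (@le_trans _ _ (\int[mu]_(x in Q) u x)).
    apply: le_Rintegral.
    - exact: measurable_itv.
    - apply: integrableS (seg_integrable (@cont_cst _ _ (u x0 / 2))) => //; exact: measurable_itv.
    - apply: integrableS (seg_integrable cu) => //; exact: measurable_itv.
    - move=> x; rewrite /Q /= in_itv /= => /andP[h1 h2].
      have /dE : ball_ Num.norm x0 d x.
        by rewrite /ball_ /=; apply: le_lt_trans dd; rewrite ler_norml; apply/andP; split; lra.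
      by rewrite /= ltr_norml => /andP[]; lra.
  rewrite /sint /Rintegral; apply: fine_le.
  - apply: integrable_fin_num; first exact: measurable_itv.
    by apply: integrableS (seg_integrable cu) => //; exact: measurable_itv.
  - apply: integrable_fin_num; first exact: measurable_itv.
    exact: seg_integrable.
  - apply: ge0_subset_integral.
    + exact: measurable_itv.
    + exact: measurable_itv.
    + by have /integrableP[] := seg_integrable cu.
    + by move=> x; rewrite /seg /= in_itv /= lee_fin; exact: u0.
    + exact: Qseg.
apply: lt_le_trans cut.
rewrite Rintegral_cst; last exact: measurable_itv.
apply: mulr_gt0 => //.
rewrite (_ : fine _ = d' *+ 2) ?pmulrn_lgt0//.
rewrite -[RHS]/(fine (d' *+ 2)%:E); congr fine.
apply: etrans (lebesgue_measure_itv _) _.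
rewrite /= lte_fin ltrD2l gtrN// -EFinD; congr (_%:E); ring.
Qed.

Lemma cint_gt0 f x0 : continuous f -> (forall x, clcell x -> 0 <= f x) ->
  - pi < x0.1 < pi -> - pi < x0.2 < pi -> 0 < f x0 -> 0 < cint f.
Proof.
move=> cf f0 h1 h2 fx0; rewrite cint_iter1//; apply: (sint_gt0 (x0 := x0.1)) => //.
- exact: sint_continuous.
- move=> x hx; apply: sint_ge0 => y hy; apply: f0; split; by rewrite /= in_itv.
- apply: (sint_gt0 (x0 := x0.2)) => //.
  + exact: continuous_fix1.
  + move=> y hy; apply: f0; split; rewrite /= in_itv //=.
    by case/andP: h1 => /ltW -> /ltW ->.
  + by case: x0 fx0 {h1 h2}.
Qed.

End IntegralAlgebra.

(** * Bessel's inequality and the modes *)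

Section Bilinear.
Context {R : realType} {T : Type} {J : eqType}.
(** [C] is the regularity class on which the form [B] is bilinear. The section is instantiated
    twice, with the L2 form on continuous functions and with the Dirichlet form on C^1 functions;
    [P] selects the modes with q > 0, those of positive square norm. *)
Variables (C : (T -> R) -> Prop) (B : (T -> R) -> (T -> R) -> R).
Hypothesis C0 : C (fun=> 0).
Hypothesis CL : forall a u v, C u -> C v -> C (fun t => a * u t + v t).
Hypothesis BL : forall a u v w, C u -> C v -> C w ->
  B (fun t => a * u t + v t) w = a * B u w + B v w.
Hypothesis BS : forall u v, B u v = B v u.
Hypothesis Bge0 : forall u, C u -> 0 <= B u u.
Variables (e : J -> T -> R) (n : J -> R) (P : pred J).
Hypothesis Ce : forall j, C (e j).
Hypothesis n0 : forall j, P j -> 0 < n j.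
Hypothesis orth : forall i j, P i -> P j -> B (e i) (e j) = if i == j then n i else 0.
Implicit Types (s : seq J) (c : J -> R) (f u : T -> R).

Definition lincomb s c : T -> R := fun t => \sum_(j <- s) c j * e j t.

Lemma lincomb_cons j s c : lincomb (j :: s) c = (fun t => c j * e j t + lincomb s c t).
Proof. by apply/funext => t; rewrite /lincomb big_cons. Qed.

Lemma lincomb_C s c : C (lincomb s c).
Proof.
elim: s => [|j s IH]; last by rewrite lincomb_cons; exact: CL.
by rewrite (_ : lincomb _ _ = fun=> 0)//; apply/funext => t; rewrite /lincomb big_nil.
Qed.

Lemma form0l u : C u -> B (fun=> 0) u = 0.
Proof.
move=> Cu; have := BL 1 C0 C0 Cu; rewrite (_ : (fun t => _) = (fun=> 0)); last first.
  by apply/funext => t; rewrite mulr0 addr0.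
by rewrite mul1r => /eqP; rewrite -subr_eq0 opprD addNKr oppr_eq0 => /eqP.
Qed.

Lemma form_lincomb s c u : C u -> B (lincomb s c) u = \sum_(j <- s) c j * B (e j) u.
Proof.
move=> Cu; elim: s => [|j s IH].
  rewrite big_nil (_ : lincomb _ _ = fun=> 0) ?form0l//.
  by apply/funext => t; rewrite /lincomb big_nil.
by rewrite lincomb_cons BL// ?big_cons ?IH//; exact: lincomb_C.
Qed.

Lemma form_lincomb2 s c : uniq s -> all P s ->
  B (lincomb s c) (lincomb s c) = \sum_(j <- s) c j ^+ 2 * n j.
Proof.
move=> us /allP Ps; rewrite form_lincomb; last exact: lincomb_C.
apply: eq_big_seq => j js; rewrite BS form_lincomb//.
rewrite (bigD1_seq j)//= orth ?eqxx ?Ps// big_seq_cond big1 ?addr0; last first.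
  by move=> i /andP[si ij]; rewrite orth ?Ps// (negbTE ij) mulr0.
ring.
Qed.

Lemma form_residual f s c : C f -> uniq s -> all P s ->
  B (fun t => f t - lincomb s c t) (fun t => f t - lincomb s c t) =
  B f f - \sum_(j <- s) (2 * c j * B f (e j) - c j ^+ 2 * n j).
Proof.
move=> Cf us Ps; have Cl := lincomb_C s c.
have E : (fun t => f t - lincomb s c t) = (fun t => (-1) * lincomb s c t + f t).
  by apply/funext => t; rewrite mulN1r addrC.
have CE : C (fun t => (-1) * lincomb s c t + f t) by exact: CL.
rewrite E BL// (BS (lincomb s c)) (BS f) !BL// (BS f) form_lincomb2// form_lincomb//.
rewrite sumrB; under [in RHS]eq_bigr do rewrite BS -mulrA.
rewrite -mulr_sumr; ring.
Qed.

Lemma bessel f s : C f -> uniq s -> all P s ->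
  \sum_(j <- s) B f (e j) ^+ 2 / n j <= B f f.
Proof.
move=> Cf us Ps; pose c j := B f (e j) / n j.
have := Bge0 (CL (-1) (lincomb_C s c) Cf).
rewrite (_ : (fun t => _) = (fun t => f t - lincomb s c t)); last first.
  by apply/funext => t; rewrite mulN1r addrC.
rewrite form_residual// subr_ge0; congr (_ <= _).
apply: eq_big_seq => j js; rewrite /c.
have : n j != 0 by rewrite gt_eqF// n0//; exact: (allP Ps).
by move=> nj; field.
Qed.

(** Completing the square: for each mode the two sides differ by (B f e_j - c_j n_j)^2 / n_j, so
    Fourier coefficients are at least as good as any others. *)
Lemma best_approx f s c : C f -> uniq s -> all P s ->
  B f f - \sum_(j <- s) B f (e j) ^+ 2 / n j <=
  B (fun t => f t - lincomb s c t) (fun t => f t - lincomb s c t).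
Proof.
move=> Cf us Ps; rewrite form_residual// lerB// big_seq [leRHS]big_seq.
apply: ler_sum => j js; have nj : 0 < n j by rewrite n0//; exact: (allP Ps).
rewrite -subr_ge0 (_ : _ - _ = (B f (e j) - c j * n j) ^+ 2 / n j); last first.
  by field; rewrite gt_eqF.
by rewrite divr_ge0// ?sqr_ge0// ltW.
Qed.

Definition in_span (w : T -> R) := exists s c, [/\ uniq s, all P s & w = lincomb s c].

Lemma in_span0 : in_span (fun=> 0).
Proof. by exists [::], (fun=> 0); split=> //; apply/funext => t; rewrite /lincomb big_nil. Qed.

(** Index lists are kept duplicate-free, as orthogonality sums require; a mode already present has
    its coefficient updated instead of being listed again. *)
Lemma in_span_cons a j w : P j -> in_span w -> in_span (fun t => a * e j t + w t).
Proof.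
move=> Pj [s [c [us Ps ->]]].
have [js|js] := boolP (j \in s).
  exists s, (fun i => if i == j then a + c j else c i); split=> //.
  apply/funext => t; rewrite /lincomb !(bigD1_seq j js us)/= eqxx.
  rewrite mulrDl -addrA; congr (_ + (_ + _)).
  by apply: eq_bigr => i /negbTE ->.
exists (j :: s), (fun i => if i == j then a else c i); split=> /=.
- by rewrite js.
- by rewrite Pj.
- rewrite lincomb_cons eqxx; apply/funext => t; congr (_ + _).
  apply: eq_big_seq => i si; case: eqP => // ij; by rewrite -ij si in js.
Qed.

Lemma in_span_e j : P j -> in_span (e j).
Proof.
move=> Pj; have := in_span_cons 1 Pj in_span0; congr in_span.
by apply/funext => t; rewrite mul1r addr0.
Qed.

Lemma in_span_lin a u w : in_span u -> in_span w -> in_span (fun t => a * u t + w t).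
Proof.
move=> [s [c [us Ps ->]]] Sw; elim: s us Ps => [|j s IH] /= us Ps.
  rewrite (_ : (fun t => _) = w)//; apply/funext => t.
  by rewrite /lincomb big_nil mulr0 add0r.
move/andP: us => [js us]; move/andP: Ps => [Pj Ps].
rewrite lincomb_cons; have := in_span_cons (a * c j) Pj (IH us Ps); congr in_span.
by apply/funext => t; rewrite mulrDr mulrA addrA.
Qed.

End Bilinear.

(** * One-dimensional integrals of the trigonometric profiles *)

Section Trig.
Context {R : realType}.
Implicit Types (x y c : R) (m : int) (q : nat).

Lemma is_derive_lin c x : is_derive x (1 : R) (fun x : R => c * x) c.
Proof.
have := @is_deriveZ R R R id c x 1 1 _; rewrite /GRing.scale /= mulr1; exact.
Qed.

Lemma is_derive_cosM c x : is_derive x (1 : R) (fun x : R => cos (c * x)) (- (c * sin (c * x))).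
Proof.
have dl := is_derive_lin c x.
have := is_derive1_comp (is_derive_cos (c * x)) dl.
by rewrite mulNr (mulrC _ c).
Qed.

Lemma is_derive_sinM c x : is_derive x (1 : R) (fun x : R => sin (c * x)) (c * cos (c * x)).
Proof.
have dl := is_derive_lin c x.
have := is_derive1_comp (is_derive_sin (c * x)) dl.
by rewrite (mulrC _ c).
Qed.

Lemma cont_lin c : continuous (fun x : R => c * x).
Proof. by apply: cont_scale => x; exact: cvg_id. Qed.

Lemma cont_cosM c : continuous (fun x : R => cos (c * x)).
Proof. by move=> x; apply: (@continuous_comp _ _ _ (fun x => c * x)); [exact: cont_lin|exact: continuous_cos]. Qed.

Lemma cont_sinM c : continuous (fun x : R => sin (c * x)).
Proof. by move=> x; apply: (@continuous_comp _ _ _ (fun x => c * x)); [exact: cont_lin|exact: continuous_sin]. Qed.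

Lemma sin_intpi m : sin (m%:~R * pi : R) = 0.
Proof.
have sn (k : nat) : sin (k%:R * pi : R) = 0.
  elim: k => [|k IH]; first by rewrite mul0r sin0.
  by rewrite -addn1 natrD mulrDl mul1r sinDpi IH oppr0.
case: m => k; first exact: sn.
by rewrite NegzE mulrNz mulNr sinN -[k.+1%:~R]/(k.+1%:R) sn oppr0.
Qed.

Lemma sint_cos m : sint (fun x : R => cos (m%:~R * x)) = if m == 0 then 2 * pi else 0.
Proof.
case: eqP => [->|/eqP m0].
  rewrite -[RHS]mul1r -sint_cst; apply: eq_sint => x _.
  by rewrite mul0r cos0.
have mR : m%:~R != 0 :> R by rewrite intr_eq0.
have : sint (fun x : R => m%:~R * cos (m%:~R * x)) = 0.
  rewrite (sint_FTC (is_derive_sinM m%:~R)); last by apply: cont_scale; exact: cont_cosM.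
  by rewrite mulrN sinN sin_intpi oppr0 subrr.
by rewrite sintZ; [move/eqP; rewrite mulf_eq0 (negbTE mR) => /eqP|exact: cont_cosM].
Qed.

Lemma sint_sin m : sint (fun x : R => sin (m%:~R * x)) = 0.
Proof.
case: (eqVneq m 0) => [->|m0].
  rewrite -[RHS](mul0r (2 * pi)) -sint_cst; apply: eq_sint => x _.
  by rewrite mul0r sin0.
have mR : m%:~R != 0 :> R by rewrite intr_eq0.
have dc x : is_derive x (1 : R) (fun x : R => cos (m%:~R * x)) (- m%:~R * sin (m%:~R * x)).
  by have := is_derive_cosM m%:~R x; rewrite mulNr.
have : sint (fun x : R => - m%:~R * sin (m%:~R * x)) = 0.
  rewrite (sint_FTC dc); last by apply: cont_scale; exact: cont_sinM.
  by rewrite mulrN cosN subrr.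
by rewrite sintZ; [move/eqP; rewrite mulf_eq0 oppr_eq0 (negbTE mR) => /eqP|exact: cont_sinM].
Qed.

Definition db q y : R :=
  if odd q then - (q%:R / 2) * sin (q%:R / 2 * y) else q%:R / 2 * cos (q%:R / 2 * y).

Lemma bE q : b_ q = (fun y : R => if odd q then cos (q%:R / 2 * y) else sin (q%:R / 2 * y)).
Proof. by apply/funext => y; rewrite /b_ (mulrAC _ y). Qed.

Lemma is_derive_b q y : is_derive y (1 : R) (b_ q) (db q y).
Proof.
rewrite bE /db; case: (odd q); last exact: is_derive_sinM.
by have := is_derive_cosM (q%:R / 2) y; rewrite mulNr.
Qed.

Lemma is_derive_db q y : is_derive y (1 : R) (db q) (- (q%:R ^+ 2 / 4) * b_ q y).
Proof.
have E : (q%:R ^+ 2 / 4 : R) = q%:R / 2 * (q%:R / 2) by field.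
rewrite bE /db E; case: (odd q).
  have := @is_deriveZ _ _ _ _ (- (q%:R / 2)) _ _ _ (is_derive_sinM (q%:R / 2) y).
  by rewrite /GRing.scale /= => D; apply: (is_derive_eq D); ring.
have := @is_deriveZ _ _ _ _ (q%:R / 2) _ _ _ (is_derive_cosM (q%:R / 2) y).
by rewrite /GRing.scale /= => D; apply: (is_derive_eq D); ring.
Qed.

Lemma cont_b q : continuous (b_ q : R -> R).
Proof. by rewrite bE; case: (odd q); [exact: cont_cosM|exact: cont_sinM]. Qed.

Lemma cont_db q : continuous (db q).
Proof.
by rewrite /db; case: (odd q); apply: cont_scale; [exact: cont_sinM|exact: cont_cosM].
Qed.

Lemma b_pi q : b_ q (pi : R) = 0 /\ b_ q (- pi : R) = 0.
Proof.
rewrite bE mulrN cosN sinN; case: ifPn => oq; last first.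
  suff -> : sin (q%:R / 2 * pi : R) = 0 by rewrite oppr0.
  rewrite -[in LHS](even_halfK oq) -muln2 natrM mulfK ?pnatr_eq0//.
  exact: (sin_intpi q./2).
suff -> : cos (q%:R / 2 * pi : R) = 0 by [].
rewrite -[in LHS](odd_double_half q) oq add1n -addn1 natrD -muln2 natrM.
rewrite (_ : (_ / 2 * pi : R) = q./2%:R * pi + pi / 2); last by field.
by rewrite cosDpihalf (sin_intpi q./2) oppr0.
Qed.

(** For q = r, integrating (b b')' gives int b'^2 = (q^2/4) int b^2, while cos^2 + sin^2 = 1 says
    that (q^2/4) b^2 + b'^2 is the constant q^2/4. For q <> r, the Wronskian b_q' b_r - b_q b_r'
    vanishes at both ends and has derivative (r^2/4 - q^2/4) b_q b_r. *)
Lemma sint_bb q r : (0 < q)%N -> (0 < r)%N ->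
  sint (fun y : R => b_ q y * b_ r y) = if q == r then pi else 0.
Proof.
move=> q0 r0; have [bq1 bq2] := b_pi q; have [br1 br2] := b_pi r.
have cbb : continuous (fun y : R => b_ q y * b_ r y) by apply: cont_mul; exact: cont_b.
case: eqP => [qr|/eqP qr].
  subst r.
  have dbb y : is_derive y (1 : R) (fun y => b_ q y * db q y)
      (db q y ^+ 2 + -1 * (q%:R ^+ 2 / 4 * (b_ q y * b_ q y))).
    have := @is_deriveM _ _ _ _ _ _ _ _ (is_derive_b q y) (is_derive_db q y).
    rewrite /GRing.scale /= => D; apply: (is_derive_eq D); ring.
  have db2 : sint (fun y : R => db q y ^+ 2) = q%:R ^+ 2 / 4 * sint (fun y : R => b_ q y * b_ q y).
    rewrite -sintZ//; apply/eqP; rewrite -subr_eq0 -mulN1r -sintZ; last exact: cont_scale.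
    rewrite -sintD; [|exact/cont_exp/cont_db|exact/cont_scale/cont_scale].
    rewrite (@sint_FTC _ (fun y => b_ q y * db q y) _ dbb).
      by rewrite bq1 bq2 !mul0r subrr.
    by apply: cont_add; [exact/cont_exp/cont_db|exact/cont_scale/cont_scale].
  have E : sint (fun y : R => q%:R ^+ 2 / 4 * (b_ q y * b_ q y) + db q y ^+ 2) = q%:R ^+ 2 / 4 * (2 * pi).
    rewrite -sint_cst; apply: eq_sint => y _; rewrite bE /db.
    have := cos2Dsin2 (q%:R / 2 * y); case: (odd q) => h; rewrite -[RHS]mulr1 -[X in _ = _ * X]h; by field.
  have q2 : (q%:R ^+ 2 / 4 : R) != 0 by rewrite mulf_neq0// ?invr_eq0 ?expf_neq0// pnatr_eq0 -lt0n.
  move: E; rewrite sintD; [|exact: cont_scale|exact/cont_exp/cont_db].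
  rewrite db2 sintZ// -mulrDr => /(mulfI q2); lra.
have dW y : is_derive y (1 : R) (fun y => db q y * b_ r y - b_ q y * db r y)
    ((r%:R ^+ 2 / 4 - q%:R ^+ 2 / 4) * (b_ q y * b_ r y)).
  have D1 := @is_deriveM _ _ _ _ _ _ _ _ (is_derive_db q y) (is_derive_b r y).
  have D2 := @is_deriveM _ _ _ _ _ _ _ _ (is_derive_b q y) (is_derive_db r y).
  have := @is_deriveB _ _ _ _ _ _ _ _ _ D1 D2.
  rewrite /GRing.scale /= => D; apply: (is_derive_eq D); ring.
have : sint (fun y : R => (r%:R ^+ 2 / 4 - q%:R ^+ 2 / 4) * (b_ q y * b_ r y)) = 0.
  rewrite (sint_FTC dW); last exact: cont_scale.
  by rewrite bq1 bq2 br1 br2 !mul0r !mulr0 subrr.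
rewrite sintZ// => /eqP; rewrite mulf_eq0 => /orP[|/eqP//].
rewrite -mulrBl mulf_eq0 invr_eq0 pnatr_eq0 orbF subr_eq0 eqrXn2 ?ler0n//.
by rewrite eqr_nat eq_sym (negbTE qr).
Qed.

End Trig.

Section Tensor.
Context {R : realType}.
Implicit Types (u v du dv ddu ddv : R -> R).

Lemma is_derive_differentiable u x (d : R) : is_derive x (1 : R) u d -> differentiable u x.
Proof. by case=> /derivable1_diffP. Qed.

Lemma tensor_D1 u v du dv : (forall x : R, is_derive x (1 : R) u (du x)) ->
  (forall x : R, is_derive x (1 : R) v (dv x)) ->
  dx1 (fun x : R * R => u x.1 * v x.2) = (fun x => du x.1 * v x.2).
Proof.
move=> hu hv; apply/funext => x.
have dfu := is_derive_differentiable (hu x.1); have dfv := is_derive_differentiable (hv x.2).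
rewrite dx1E /partial1 derive_mul; last 2 first.
- exact: (comp_diff (is_diff_fst x) dfu).
- exact: (comp_diff (is_diff_snd x) dfv).
rewrite /dx1 derive_fst// derive_snd//= !derive1E.
by have [_ ->] := hu x.1; rewrite mul0r mulr0 add0r mul1r mulrC.
Qed.

Lemma tensor_D2 u v du dv : (forall x : R, is_derive x (1 : R) u (du x)) ->
  (forall x : R, is_derive x (1 : R) v (dv x)) ->
  dx2 (fun x : R * R => u x.1 * v x.2) = (fun x => u x.1 * dv x.2).
Proof.
move=> hu hv; apply/funext => x.
have dfu := is_derive_differentiable (hu x.1); have dfv := is_derive_differentiable (hv x.2).
rewrite dx2E /partial2 derive_mul; last 2 first.
- exact: (comp_diff (is_diff_fst x) dfu).
- exact: (comp_diff (is_diff_snd x) dfv).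
rewrite /dx2 derive_fst// derive_snd//= !derive1E.
by have [_ ->] := hv x.2; rewrite mul0r mulr0 addr0 mul1r.
Qed.

Lemma laplacian_tensor u v du dv ddu ddv x :
  (forall x : R, is_derive x (1 : R) u (du x)) ->
  (forall x : R, is_derive x (1 : R) du (ddu x)) ->
  (forall x : R, is_derive x (1 : R) v (dv x)) ->
  (forall x : R, is_derive x (1 : R) dv (ddv x)) ->
  laplacian (fun x : R * R => u x.1 * v x.2) x = ddu x.1 * v x.2 + u x.1 * ddv x.2.
Proof.
move=> h1 h2 h3 h4; rewrite laplacianE.
by rewrite (tensor_D1 h1 h3) (tensor_D1 h2 h3) (tensor_D2 h1 h3) (tensor_D2 h1 h4).
Qed.

Lemma Cn_tensor n u v : Cn n u -> Cn n v -> Cn n (fun x : R * R => u x.1 * v x.2).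
Proof. by move=> cu cv; apply: Cn_mul; [exact: Cn_fst|exact: Cn_snd]. Qed.

Lemma Cn_cosM n (c : R) : Cn n (fun x : R => cos (c * x)).
Proof. by have [] := @Cn_cos_sin _ _ n (fun x : R => c * x) (Cn_scale c (@Cn_id R n)). Qed.

Lemma Cn_sinM n (c : R) : Cn n (fun x : R => sin (c * x)).
Proof. by have [] := @Cn_cos_sin _ _ n (fun x : R => c * x) (Cn_scale c (@Cn_id R n)). Qed.

Lemma Cn_b n q : Cn n (b_ q : R -> R).
Proof. by rewrite bE; case: (odd q); [exact: Cn_cosM|exact: Cn_sinM]. Qed.

End Tensor.

(** * Green's formula and the effect of derivatives on coefficients *)

Section Green.
Context {R : realType}.
Implicit Types (h g P f : R * R -> R).

Definition vanish f := forall x : R, f (x, - pi) = 0 /\ f (x, pi) = 0.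

Definition grad_dot h g x : R :=
  dx1 h x * dx1 g x + dx2 h x * dx2 g x.

Lemma Cn_lap n f : Cn n.+2 f -> Cn n (laplacian f).
Proof.
move=> Cf; rewrite (_ : laplacian f = fun x => dx1 (dx1 f) x + dx2 (dx2 f) x); last first.
  by apply/funext => x; rewrite laplacianE.
apply: Cn_add; [exact/Cn_partial1/Cn_partial1|exact/Cn_partial2/Cn_partial2].
Qed.

Lemma cont_grad_dot h g : Cn 1 h -> Cn 1 g -> continuous (grad_dot h g).
Proof.
move=> Ch Cg; apply: cont_add.
  exact: (cont_mul (Cn_cont (Cn_partial1 Ch)) (Cn_cont (Cn_partial1 Cg))).
exact: (cont_mul (Cn_cont (Cn_partial2 Ch)) (Cn_cont (Cn_partial2 Cg))).
Qed.

(** Integrate the divergence of h grad g: the x1-flux cancels by periodicity and the x2-flux because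
    [h] vanishes on the boundary. *)
Lemma green h g : Cn 1 h -> periodic h (2 * pi, 0) -> vanish h ->
  Cn 2 g -> periodic g (2 * pi, 0) ->
  cint (grad_dot h g) = - cint (fun x => h x * laplacian g x).
Proof.
move=> Ch ph vh Cg pg; have Cg1 := CnW Cg.
have D1 : Cn 1 (fun x => h x * dx1 g x) := Cn_mul Ch (Cn_partial1 Cg).
have D2 : Cn 1 (fun x => h x * dx2 g x) := Cn_mul Ch (Cn_partial2 Cg).
have c1 : continuous (dx1 (fun x => h x * dx1 g x)) := Cn_cont (Cn_partial1 D1).
have c2 : continuous (dx2 (fun x => h x * dx2 g x)) := Cn_cont (Cn_partial2 D2).
have I1 : cint (dx1 (fun x => h x * dx1 g x)) = 0.
  apply: (cint_D1 D1) => x; rewrite ph; congr (_ * _).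
  exact: (periodic_partial1 (fun y => Cn_diff y Cg) pg).
have I2 : cint (dx2 (fun x => h x * dx2 g x)) = 0.
  by apply: (cint_D2 D2) => x; have [-> ->] := vh x; rewrite !mul0r.
have c3 : continuous (fun x => h x * laplacian g x).
  by apply: cont_mul; [exact: Cn_cont Ch|exact: (@Cn_cont _ _ 0 _ (Cn_lap Cg))].
apply/eqP; rewrite -addr_eq0 -(cintD (cont_grad_dot Ch Cg1) c3).
rewrite (@eq_cint _ _ (fun x => dx1 (fun x => h x * dx1 g x) x +
    dx2 (fun x => h x * dx2 g x) x)).
  by rewrite (cintD c1 c2) I1 I2 addr0.
move=> x _.
rewrite (partial1_mul (Cn_diff x Ch) (Cn_diff x (Cn_partial1 Cg))).
rewrite (partial2_mul (Cn_diff x Ch) (Cn_diff x (Cn_partial2 Cg))).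
rewrite /grad_dot laplacianE; ring.
Qed.

End Green.

Section Modes.
Context {R : realType}.
Implicit Types (P f : R * R -> R) (p : int) (q : nat) (k : int * nat).

Definition lam k : R := k.1%:~R ^+ 2 + k.2%:R ^+ 2 / 4.

Lemma omega_smooth n p q : Cn n (omega_re p q : R * R -> R) /\ Cn n (omega_im p q : R * R -> R).
Proof.
split.
  exact: (Cn_tensor (Cn_cosM n (p%:~R)) (Cn_b n q)).
exact: (Cn_tensor (Cn_sinM n (p%:~R)) (Cn_b n q)).
Qed.

Lemma cos_int_periodic p : periodic (fun x : R => cos (p%:~R * x)) (2 * pi).
Proof.
rewrite mulr_natl.
have cn (k : nat) (x : R) : cos (x + k%:R * (pi *+ 2)) = cos x.
  elim: k => [|k IH]; first by rewrite mul0r addr0.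
  by rewrite -addn1 natrD mulrDl mul1r addrA cosD2pi IH.
case: p => k x; rewrite mulrDr; first exact: cn.
by rewrite NegzE mulrNz !mulNr -opprD !cosN -[k.+1%:~R]/(k.+1%:R) cn.
Qed.

Lemma sin_int_periodic p : periodic (fun x : R => sin (p%:~R * x)) (2 * pi).
Proof.
rewrite mulr_natl.
have cn (k : nat) (x : R) : sin (x + k%:R * (pi *+ 2)) = sin x.
  elim: k => [|k IH]; first by rewrite mul0r addr0.
  by rewrite -addn1 natrD mulrDl mul1r addrA sinD2pi IH.
case: p => k x; rewrite mulrDr; first exact: cn.
by rewrite NegzE mulrNz !mulNr -opprD !sinN -[k.+1%:~R]/(k.+1%:R) cn.
Qed.

Lemma omega_periodic p q : periodic (omega_re p q : R * R -> R) (2 * pi, 0) /\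
  periodic (omega_im p q : R * R -> R) (2 * pi, 0).
Proof.
split=> x; rewrite /omega_re /omega_im /= addr0; congr (_ * _).
  exact: cos_int_periodic.
exact: sin_int_periodic.
Qed.

Lemma omega_vanish p q : vanish (omega_re p q : R * R -> R) /\ vanish (omega_im p q : R * R -> R).
Proof.
by have [h1 h2] := @b_pi R q; split=> x; rewrite /omega_re /omega_im /= h1 h2 !mulr0.
Qed.

Lemma omega_laplacian p q x :
  laplacian (omega_re p q : R * R -> R) x = - lam (p, q) * omega_re p q x /\
  laplacian (omega_im p q : R * R -> R) x = - lam (p, q) * omega_im p q x.
Proof.
have d2c y : is_derive y (1 : R) (fun x : R => - (p%:~R * sin (p%:~R * x))) (- p%:~R ^+ 2 * cos (p%:~R * y)).
  have := @is_deriveN _ _ _ _ _ _ _ (@is_deriveZ _ _ _ _ (p%:~R) _ _ _ (is_derive_sinM (p%:~R : R) y)).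
  by move=> D; apply: (is_derive_eq D); rewrite /GRing.scale /=; ring.
have d2s y : is_derive y (1 : R) (fun x : R => (p%:~R * cos (p%:~R * x))) (- p%:~R ^+ 2 * sin (p%:~R * y)).
  have := @is_deriveZ _ _ _ _ (p%:~R) _ _ _ (is_derive_cosM (p%:~R : R) y).
  by move=> D; apply: (is_derive_eq D); rewrite /GRing.scale /=; ring.
rewrite (laplacian_tensor x (is_derive_cosM p%:~R) d2c (is_derive_b q) (is_derive_db q)).
rewrite (laplacian_tensor x (is_derive_sinM p%:~R) d2s (is_derive_b q) (is_derive_db q)).
by rewrite /omega_re /omega_im /lam /=; split; field.
Qed.

Lemma green_omega P p q : Cn 1 P -> periodic P (2 * pi, 0) -> vanish P ->
  cint (grad_dot P (omega_re p q)) = lam (p, q) * cint (fun x => P x * omega_re p q x) /\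
  cint (grad_dot P (omega_im p q)) = lam (p, q) * cint (fun x => P x * omega_im p q x).
Proof.
move=> CP pP vP; have [Cr Ci] := omega_smooth 2 p q; have [pr pi] := omega_periodic p q.
rewrite !green//; split.
  rewrite -cintN -?cintZ; try by [apply: cont_mul; [exact: Cn_cont CP|exact: Cn_cont Cr]
    | apply: cont_mul; [exact: Cn_cont CP|exact: (@Cn_cont _ _ 0 _ (Cn_lap Cr))]].
  by apply: eq_cint => x _; rewrite (omega_laplacian p q x).1; ring.
rewrite -cintN -?cintZ; try by [apply: cont_mul; [exact: Cn_cont CP|exact: Cn_cont Ci]
    | apply: cont_mul; [exact: Cn_cont CP|exact: (@Cn_cont _ _ 0 _ (Cn_lap Ci))]].
by apply: eq_cint => x _; rewrite (omega_laplacian p q x).2; ring.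
Qed.

Lemma grad_dotC f P : grad_dot f P = grad_dot P f.
Proof. by apply/funext => x; rewrite /grad_dot; ring. Qed.

(** Both [P] and the mode vanish on the boundary, so Green's formula applies in both directions and
    moves the laplacian onto the mode, where it is multiplication by [- lam]. *)
Lemma coef_laplacian P p q : Cn 2 P -> periodic P (2 * pi, 0) -> vanish P ->
  coef_normsq (laplacian P) p q = lam (p, q) ^+ 2 * coef_normsq P p q.
Proof.
move=> CP pP vP; have [Cr Ci] := omega_smooth 2 p q; have [pr pi] := omega_periodic p q.
have [vr vi] := omega_vanish p q.
have [G1 G2] := green_omega p q (CnW CP) pP vP.
rewrite grad_dotC green// in G1; last exact: CnW.
rewrite grad_dotC green// in G2; last exact: CnW.
rewrite /coef_normsq -/(cint _) -/(cint _) -/(cint _) -/(cint _).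
have E w : cint (fun x => laplacian P x * w x) = cint (fun x => w x * laplacian P x).
  by apply: eq_cint => x _; rewrite mulrC.
rewrite !E; move/eqP: G1; rewrite eqr_oppLR => /eqP ->; move/eqP: G2; rewrite eqr_oppLR => /eqP ->.
ring.
Qed.

(** Integration by parts in x1 exchanges the real and imaginary parts of the mode up to a factor p
    or -p. Only periodicity enters, so [f] may be nonzero on the boundary, as the density is. *)
Lemma coef_D1 f p q : Cn 1 f -> periodic f (2 * pi, 0) ->
  coef_normsq (dx1 f) p q = p%:~R ^+ 2 * coef_normsq f p q.
Proof.
move=> Cf pf; have [Cr Ci] := omega_smooth 1 p q; have [pr pim] := omega_periodic p q.
have parts w : Cn 1 w -> periodic w (2 * pi, 0) ->
    cint (fun x => dx1 f x * w x) = - cint (fun x => f x * dx1 w x).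
  move=> Cw pw; have Cfw := Cn_mul Cf Cw.
  have c1 : continuous (fun x => dx1 f x * w x).
    by apply: cont_mul; [exact: Cn_cont (Cn_partial1 Cf)|exact: Cn_cont Cw].
  have c2 : continuous (fun x => f x * dx1 w x).
    by apply: cont_mul; [exact: Cn_cont Cf|exact: Cn_cont (Cn_partial1 Cw)].
  apply/eqP; rewrite -addr_eq0 -(cintD c1 c2).
  rewrite (@eq_cint _ _ (dx1 (fun x => f x * w x))).
    by rewrite (cint_D1 Cfw)// => x; rewrite pf pw.
  by move=> x _; rewrite (partial1_mul (Cn_diff x Cf) (Cn_diff x Cw)); ring.
rewrite /coef_normsq -/(cint _) -/(cint _) -/(cint _) -/(cint _) (parts _ Cr pr) (parts _ Ci pim).
have -> : dx1 (omega_re p q : R * R -> R) = fun x => - (p%:~R * sin (p%:~R * x.1)) * b_ q x.2.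
  exact: tensor_D1 (is_derive_cosM p%:~R) (is_derive_b q).
have -> : dx1 (omega_im p q : R * R -> R) = fun x => (p%:~R * cos (p%:~R * x.1)) * b_ q x.2.
  exact: tensor_D1 (is_derive_sinM p%:~R) (is_derive_b q).
have -> : cint (fun x => f x * (- (p%:~R * sin (p%:~R * x.1)) * b_ q x.2)) =
    - p%:~R * cint (fun x => f x * omega_im p q x).
  rewrite -cintZ; last by apply: cont_mul; [exact: Cn_cont Cf|exact: Cn_cont Ci].
  by apply: eq_cint => x _; rewrite /omega_im; ring.
have -> : cint (fun x => f x * (p%:~R * cos (p%:~R * x.1) * b_ q x.2)) =
    p%:~R * cint (fun x => f x * omega_re p q x).
  rewrite -cintZ; last by apply: cont_mul; [exact: Cn_cont Cf|exact: Cn_cont Cr].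
  by apply: eq_cint => x _; rewrite /omega_re; ring.
ring.
Qed.

Lemma sint_1 : sint (fun _ : R => 1) = 2 * pi.
Proof. by rewrite sint_cst mul1r. Qed.

Lemma omega_normsqE p q : (0 < q)%N -> omega_normsq p q = 2 * pi * pi :> R.
Proof.
move=> q0; rewrite /omega_normsq -/(cint _).
transitivity (cint (fun x : R * R => (fun=> 1) x.1 * (b_ q x.2 * b_ q x.2))).
  apply: eq_cint => x _; rewrite /omega_re /omega_im mul1r.
  have := cos2Dsin2 (p%:~R * x.1) => h.
  rewrite -[RHS]mul1r -[X in _ = X * _]h; ring.
rewrite (cint_tensor (u := fun=> 1) (v := fun y => b_ q y * b_ q y)); last 2 first.
- exact: cont_cst.
- by apply: cont_mul; exact: cont_b.
by rewrite sint_1 sint_bb// eqxx.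
Qed.

End Modes.

Section Modes2.
Context {R : realType}.
Implicit Types (P f : R * R -> R) (k : int * nat) (s : seq (int * nat)).
Local Notation T := (bool * (R * R))%type.
Local Notation J := (bool * (int * nat))%type.

(* For real c, s the complex mode c * omega and its multiple by i, as pairs of
   real functions; the Boolean selects the real or imaginary component. *)
Definition mode (j : J) (t : T) : R :=
  match j.1, t.1 with
  | false, false | true, true => omega_re j.2.1 j.2.2 t.2
  | false, true => omega_im j.2.1 j.2.2 t.2
  | true, false => - omega_im j.2.1 j.2.2 t.2
  end.

Definition real_part f : T -> R := fun t => if t.1 then 0 else f t.2.

(** The real part of the Hermitian L2 product: a symmetric real form, so that the real Bessel
    inequality covers complex modes. *)
Definition l2form (u v : T -> R) : R :=
  cint (fun x => u (false, x) * v (false, x) + u (true, x) * v (true, x)).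

Definition h1form (u v : T -> R) : R :=
  cint (fun x => grad_dot (fun x => u (false, x)) (fun x => v (false, x)) x
               + grad_dot (fun x => u (true, x)) (fun x => v (true, x)) x).

Definition CnT n (u : T -> R) := forall b, Cn n (fun x => u (b, x)).

Definition posmode (j : J) := (0 < j.2.2)%N.

Lemma CnT0 n : CnT n (fun=> 0).
Proof. by move=> b; exact: Cn_cst. Qed.

Lemma CnT_lin n a u v : CnT n u -> CnT n v -> CnT n (fun t => a * u t + v t).
Proof. by move=> cu cv b; apply: Cn_add; [apply: Cn_scale; exact: cu|exact: cv]. Qed.

Lemma CnT_mode n j : CnT n (mode j).
Proof.
by case: j => -[] [p q] []; have [Cr Ci] := @omega_smooth R n p q => //; exact: Cn_opp.
Qed.

Lemma CnT_real n f : Cn n f -> CnT n (real_part f).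
Proof. by move=> Cf []; [exact: Cn_cst|exact: Cf]. Qed.

Lemma l2formS u v : l2form u v = l2form v u.
Proof. by apply: eq_cint => x _; ring. Qed.

Lemma h1formS u v : h1form u v = h1form v u.
Proof. by apply: eq_cint => x _; rewrite /grad_dot; ring. Qed.

Lemma l2form_cont u v : CnT 0 u -> CnT 0 v ->
  continuous (fun x => u (false, x) * v (false, x) + u (true, x) * v (true, x)).
Proof. by move=> cu cv; apply: cont_add; apply: cont_mul; [exact: cu|exact: cv|exact: cu|exact: cv]. Qed.

Lemma l2formL a u v w : CnT 0 u -> CnT 0 v -> CnT 0 w ->
  l2form (fun t => a * u t + v t) w = a * l2form u w + l2form v w.
Proof.
move=> cu cv cw; have c1 := l2form_cont cu cw; have c2 := l2form_cont cv cw.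
rewrite /l2form -(@cintZ _ a _ c1) -(cintD (@cont_scale _ _ a _ c1) c2).
by apply: eq_cint => x _; ring.
Qed.

Lemma h1formL a u v w : CnT 1 u -> CnT 1 v -> CnT 1 w ->
  h1form (fun t => a * u t + v t) w = a * h1form u w + h1form v w.
Proof.
move=> cu cv cw.
have cg u' v' : CnT 1 u' -> CnT 1 v' -> continuous (fun x =>
   grad_dot (fun x => u' (false, x)) (fun x => v' (false, x)) x
               + grad_dot (fun x => u' (true, x)) (fun x => v' (true, x)) x).
  by move=> h1 h2; apply: cont_add; apply: cont_grad_dot; [exact: h1|exact: h2|exact: h1|exact: h2].
have c1 := cg _ _ cu cw; have c2 := cg _ _ cv cw.
rewrite /h1form -(@cintZ _ a _ c1) -(cintD (@cont_scale _ _ a _ c1) c2).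
apply: eq_cint => x _; rewrite /grad_dot.
have du b := Cn_diff x (cu b); have dv b := Cn_diff x (cv b).
have dau b : differentiable (fun x => a * u (b, x)) x := Cn_diff x (@Cn_scale _ _ _ a _ (cu b)).
rewrite !(partial1_add (dau _) (dv _)) !(partial2_add (dau _) (dv _)).
rewrite !(partial1_scale a (du _)) !(partial2_scale a (du _)); ring.
Qed.

Lemma l2form_ge0 u : CnT 0 u -> 0 <= l2form u u.
Proof. by move=> _; apply: cint_ge0 => x _; rewrite -!expr2 addr_ge0// sqr_ge0. Qed.

Lemma h1form_ge0 u : CnT 1 u -> 0 <= h1form u u.
Proof.
by move=> _; apply: cint_ge0 => x _; rewrite /grad_dot -!expr2 !addr_ge0// sqr_ge0.
Qed.

(** According to the Booleans, the form is the real part ([cosE]) or, up to sign, the imaginary part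
    ([sinE]) of the Hermitian product of two modes; the addition formulas reduce the x1-factor to a
    cosine or sine of (p - p') x1. *)
Lemma mode_orth i j : posmode i -> posmode j ->
  l2form (mode i) (mode j) = if i == j then 2 * pi * pi else 0.
Proof.
case: i => a [p q]; case: j => b [p' q']; rewrite /posmode /= => q0 q'0.
rewrite !xpair_eqE.
have cosE : cint (fun x : R * R => omega_re p q x * omega_re p' q' x + omega_im p q x * omega_im p' q' x)
    = if (p == p') && (q == q') then 2 * pi * pi else 0.
  transitivity (cint (fun x : R * R => cos ((p - p')%:~R * x.1) * (b_ q x.2 * b_ q' x.2))).
    by apply: eq_cint => x _; rewrite intrB mulrBl cosB /omega_re /omega_im; ring.
  rewrite (cint_tensor (u := fun x => cos ((p - p')%:~R * x)) (v := fun y => b_ q y * b_ q' y)); last 2 first.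
  - exact: cont_cosM.
  - by apply: cont_mul; exact: cont_b.
  rewrite sint_cos sint_bb// subr_eq0.
  by case: eqP; case: eqP => //; rewrite ?mul0r ?mulr0.
have sinE : cint (fun x : R * R => omega_im p q x * omega_re p' q' x - omega_re p q x * omega_im p' q' x) = 0.
  transitivity (cint (fun x : R * R => sin ((p - p')%:~R * x.1) * (b_ q x.2 * b_ q' x.2))).
    by apply: eq_cint => x _; rewrite intrB mulrBl sinB /omega_re /omega_im; ring.
  rewrite (cint_tensor (u := fun x => sin ((p - p')%:~R * x)) (v := fun y => b_ q y * b_ q' y)); last 2 first.
  - exact: cont_sinM.
  - by apply: cont_mul; exact: cont_b.
  by rewrite sint_sin mul0r.
have cn : continuous (fun x : R * R => omega_im p q x * omega_re p' q' x - omega_re p q x * omega_im p' q' x).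
  have [Cr Ci] := @omega_smooth R 0 p q; have [Cr' Ci'] := @omega_smooth R 0 p' q'.
  by apply: cont_sub; apply: cont_mul.
case: a; case: b; rewrite /l2form /mode /=.
- by rewrite -cosE; apply: eq_cint => x _; ring.
- by rewrite -[RHS]oppr0 -sinE -cintN//; apply: eq_cint => x _; ring.
- by rewrite -[RHS]sinE; apply: eq_cint => x _; ring.
- by rewrite -cosE.
Qed.

End Modes2.

Section BesselModes.
Context {R : realType}.
Implicit Types (P f : R * R -> R) (k : int * nat) (s : seq (int * nat)).
Local Notation T := (bool * (R * R))%type.
Local Notation J := (bool * (int * nat))%type.
Local Notation mode := (@mode R).
Local Notation lam := (@lam R).

Lemma pi2_gt0 : 0 < 2 * pi * pi :> R.
Proof. by rewrite !mulr_gt0// pi_gt0. Qed.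

Lemma lam_gt0 k : (0 < k.2)%N -> 0 < lam k.
Proof.
by move=> k0; rewrite ltr_wpDl ?sqr_ge0// divr_gt0// exprn_gt0// ltr0n.
Qed.

Lemma l2form_real f : continuous f -> l2form (real_part f) (real_part f) = cint (fun x => f x ^+ 2).
Proof. by move=> cf; apply: eq_cint => x _; rewrite /real_part /=; ring. Qed.

Lemma dx_cst (c : R) x : dx1 (fun=> c) x = 0 /\ dx2 (fun=> c) x = 0.
Proof. by rewrite dx1E dx2E; split; exact: derive_cst. Qed.

Lemma h1form_real f : h1form (real_part f) (real_part f) = cint (grad_dot f f).
Proof.
apply: eq_cint => x _.
rewrite (_ : (fun x => real_part f (true, x)) = fun=> 0)// (_ : (fun x => real_part f (false, x)) = f)//.
have [e1 e2] := dx_cst 0 x.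
by rewrite /grad_dot e1 e2; ring.
Qed.

Lemma l2form_mode f k : continuous f ->
  l2form (real_part f) (mode (false, k)) ^+ 2 + l2form (real_part f) (mode (true, k)) ^+ 2
  = coef_normsq f k.1 k.2.
Proof.
move=> cf; rewrite /coef_normsq -/(cint _) -/(cint _); have [Cr Ci] := @omega_smooth R 0 k.1 k.2.
congr (_ ^+ 2 + _).
  by apply: eq_cint => x _; rewrite /real_part /mode /=; ring.
rewrite -[RHS]sqrrN -(cintN (cont_mul cf (Ci : continuous _))).
congr (_ ^+ 2); apply: eq_cint => x _; rewrite /real_part /mode /=; ring.
Qed.

Definition modes s : seq J := map (pair false) s ++ map (pair true) s.

Lemma modes_uniq s : uniq s -> uniq (modes s).
Proof.
move=> us; rewrite cat_uniq !map_inj_uniq ?us/= ?andbT//; try by move=> x y [].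
by apply/hasPn => x /mapP[k ks ->]; apply/negP => /mapP[].
Qed.

Lemma modes_pos s : all (fun k => 0 < k.2)%N s -> all posmode (modes s).
Proof. by move=> ps; rewrite all_cat !all_map; apply/andP; split. Qed.

Lemma l2_bessel f s : continuous f -> uniq s -> all (fun k => 0 < k.2)%N s ->
  \sum_(k <- s) coef_normsq f k.1 k.2 / omega_normsq k.1 k.2 <= cint (fun x => f x ^+ 2).
Proof.
move=> cf us ps; have := bessel (@CnT0 R 0) (@CnT_lin R 0) (@l2formL R) (@l2formS R) (@l2form_ge0 R)
  (@CnT_mode R 0) (fun _ _ => pi2_gt0) (@mode_orth R) (@CnT_real R 0 f cf) (modes_uniq us) (modes_pos ps).
rewrite (l2form_real cf) big_cat !big_map /= -big_split /=; apply: le_trans.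
rewrite big_seq [leRHS]big_seq; apply: ler_sum => k ks.
by rewrite /= -mulrDl (l2form_mode k cf) omega_normsqE//; exact: (allP ps).
Qed.

(** Modes are eigenfunctions of the Dirichlet laplacian, so against them the Dirichlet form is [lam]
    times the L2 form. *)
Lemma h1form_mode (u : T -> R) j : CnT 1 u ->
  (forall b, periodic (fun x => u (b, x)) (2 * pi, 0)) -> (forall b, vanish (fun x => u (b, x))) ->
  h1form u (mode j) = lam j.2 * l2form u (mode j).
Proof.
move=> cu pu vu; case: j => a [p q].
have [Cr Ci] := @omega_smooth R 1 p q.
have cr : continuous (omega_re p q : R * R -> R) := Cn_cont Cr.
have ci : continuous (omega_im p q : R * R -> R) := Cn_cont Ci.
have [F1 F2] := green_omega p q (cu false) (pu false) (vu false).
have [T1 T2] := green_omega p q (cu true) (pu true) (vu true).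
have cc b : continuous (fun x => u (b, x)) := Cn_cont (cu b).
have gr b : continuous (grad_dot (fun x => u (b, x)) (omega_re p q)) := cont_grad_dot (cu b) Cr.
have gi b : continuous (grad_dot (fun x => u (b, x)) (omega_im p q)) := cont_grad_dot (cu b) Ci.
rewrite /h1form /l2form; case: a; rewrite /mode /=.
  transitivity (cint (fun x => - grad_dot (fun x => u (false, x)) (omega_im p q) x +
       grad_dot (fun x => u (true, x)) (omega_re p q) x)).
    apply: eq_cint => x _; rewrite /grad_dot.
    by rewrite (partial1_opp (Cn_diff x Ci)) (partial2_opp (Cn_diff x Ci)); ring.
  rewrite (cintD (cont_opp (gi false)) (gr true)) (cintN (gi false)).
  rewrite F2 T1 -mulrN -mulrDr -(cintN (cont_mul (cc false) ci)).
  rewrite -(cintD (cont_opp (cont_mul (cc false) ci)) (cont_mul (cc true) cr)).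
  by congr (_ * _); apply: eq_cint => x _; ring.
rewrite (cintD (gr false) (gi true)) F1 T2 -mulrDr.
by rewrite -(cintD (cont_mul (cc false) cr) (cont_mul (cc true) ci)).
Qed.

Lemma mode_orth_h1 i j : posmode i -> posmode j ->
  h1form (mode i) (mode j) = if i == j then lam i.2 * (2 * pi * pi) else 0.
Proof.
move=> hi pj; rewrite h1form_mode.
- rewrite (mode_orth hi pj); case: eqP => [->//|_]; by rewrite mulr0.
- exact: CnT_mode.
- case: i {hi} => -[] [p q] []; have [h1 h2] := @omega_periodic R p q; try exact: h1; try exact: h2.
  by move=> x; rewrite /mode /= h2.
- case: i {hi} => -[] [p q] []; have [h1 h2] := @omega_vanish R p q; try exact: h1; try exact: h2.
  by move=> x; rewrite /mode /=; have [-> ->] := h2 x; rewrite oppr0.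
Qed.

(** A Dirichlet coefficient is [lam] times the L2 one, and so is the squared Dirichlet norm of a
    mode; squared coefficient over squared norm thus leaves one factor [lam]. For a stream function
    this is the dissipation seen mode by mode. *)
Lemma h1_bessel f s : Cn 1 f -> periodic f (2 * pi, 0) -> vanish f ->
  uniq s -> all (fun k => 0 < k.2)%N s ->
  \sum_(k <- s) lam k * (coef_normsq f k.1 k.2 / omega_normsq k.1 k.2) <= cint (grad_dot f f).
Proof.
move=> cf pf vf us ps.
have n0 (j : J) : posmode j -> 0 < lam j.2 * (2 * pi * pi).
  by move=> pj; rewrite mulr_gt0 ?pi2_gt0// lam_gt0.
have := bessel (@CnT0 R 1) (@CnT_lin R 1) (@h1formL R) (@h1formS R) (@h1form_ge0 R)
  (@CnT_mode R 1) n0 mode_orth_h1 (@CnT_real R 1 f cf) (modes_uniq us) (modes_pos ps).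
rewrite h1form_real big_cat !big_map /= -big_split /=; apply: le_trans.
rewrite big_seq [leRHS]big_seq; apply: ler_sum => k ks.
have k0 : (0 < k.2)%N := allP ps k ks.
have hm a : h1form (real_part f) (mode (a, k)) = lam k * l2form (real_part f) (mode (a, k)).
  apply: (@h1form_mode _ (a, k)).
  - exact: CnT_real.
  - by case=> x; [|exact: pf].
  - by case=> x; [|exact: vf].
rewrite /= -mulrDl !hm !exprMn -mulrDr (l2form_mode k (Cn_cont cf)) (omega_normsqE _ k0).
have l0 : lam k != 0 by rewrite gt_eqF// lam_gt0.
have p0 : (pi : R) != 0 by rewrite gt_eqF// pi_gt0.
rewrite le_eqVlt; apply/orP; left; apply/eqP; move: l0 p0.
by move: (pi : R) (lam k) (coef_normsq f k.1 k.2) => p l c l0 p0; field; rewrite ?l0 ?p0.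
Qed.

End BesselModes.

(** * Completeness of the modes *)

Section CosineKernel.
Context {R : realType}.
Implicit Types (x y u : R) (n m : nat).

(** This is cos(u/2)^2, a nonnegative trigonometric polynomial equal to 1 only at multiples of 2 pi.
    Its powers, once normalized, form an approximate identity; they also provide the x1-profile of
    the bump. *)
Definition bell u : R := (1 + cos u) / 2.

Lemma bell_ge0 u : 0 <= bell u.
Proof. by have := cos_geN1 u; rewrite /bell; lra. Qed.

Lemma bell_le1 u : bell u <= 1.
Proof. by have := cos_le1 u; rewrite /bell; lra. Qed.

Lemma cont_bell : continuous bell.
Proof.
apply: (cont_mul (f := fun u => 1 + cos u) (g := fun=> 2^-1)); last exact: cont_cst.
by apply: cont_add; [exact: cont_cst|exact: continuous_cos].
Qed.

Lemma cont_bellB x : continuous (fun y : R => bell (x - y)).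
Proof.
move=> y; apply: (@continuous_comp _ _ _ (fun y => x - y) bell); last exact: cont_bell.
by apply: (cont_sub (f := fun=> x) (g := id)) => z; [exact: cst_continuous|exact: cvg_id].
Qed.

Lemma is_derive_pow (g : R -> R) y d n : is_derive y (1 : R) g d ->
  is_derive y (1 : R) (fun y => g y ^+ n) (n%:R * g y ^+ n.-1 * d).
Proof.
move=> D; have := @is_deriveX _ _ g n _ _ _ D.
by rewrite (_ : g ^+ n = fun y => g y ^+ n)//; apply/funext => z; rewrite exprfctE.
Qed.

Definition bellJ n x : R := sint (fun y => bell (x - y) ^+ n).

(** Wallis recursion: - sin(x - y) bell(x - y)^n takes equal values at y = -pi and y = pi, and sin^2
    = 4 bell (1 - bell), cos = 2 bell - 1 turn its derivative into a combination of bell^(n+1) and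
    bell^n. *)
Lemma bellJS n x : (2 * n + 2)%:R * bellJ n.+1 x = (2 * n + 1)%:R * bellJ n x.
Proof.
have cb k : continuous (fun y => bell (x - y) ^+ k) by apply: cont_exp; exact: cont_bellB.
apply/eqP; rewrite -subr_eq0 -(sintZ _ (cb _)) -[_ * bellJ n x]opprK -mulNr -(sintZ _ (cb _)) opprK.
have c1 : continuous (fun y => (2 * n + 2)%:R * bell (x - y) ^+ n.+1) by exact: cont_scale.
have c2 : continuous (fun y => - (2 * n + 1)%:R * bell (x - y) ^+ n) by exact: cont_scale.
rewrite -(sintD c1 c2).
have dB y : is_derive y (1 : R) (fun y => x - y) (-1).
  by have := @is_deriveB _ _ _ (cst x) id y 1 0 1 _ _; rewrite sub0r; exact.
have dS y : is_derive y (1 : R) (fun y => sin (x - y)) (- cos (x - y)).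
  have := @is_derive1_comp R sin (fun y => x - y) y _ _ (is_derive_sin (x - y)) (dB y).
  by rewrite mulrN1.
have dC y : is_derive y (1 : R) (fun y => bell (x - y)) (sin (x - y) / 2).
  have D1 := @is_derive1_comp R cos (fun y => x - y) y _ _ (is_derive_cos (x - y)) (dB y).
  have D2 := @is_deriveD _ _ _ _ _ _ _ _ _ (is_derive_cst (1 : R) y 1) D1.
  have D3 := @is_deriveM _ _ _ _ _ _ _ _ D2 (is_derive_cst (2^-1 : R) y 1).
  by apply: (is_derive_eq D3); rewrite /GRing.scale /cst /=; field.
have dF y : is_derive y (1 : R) (fun y => - 1 * (sin (x - y) * bell (x - y) ^+ n))
   ((2 * n + 2)%:R * bell (x - y) ^+ n.+1 + - (2 * n + 1)%:R * bell (x - y) ^+ n).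
  have D1 := is_derive_pow n (dC y).
  have D2 := @is_deriveZ _ _ _ _ (-1) _ _ _ (@is_deriveM _ _ _ _ _ _ _ _ (dS y) D1).
  apply: (is_derive_eq D2); rewrite /GRing.scale /=.
  have E : sin (x - y) ^+ 2 = 4 * bell (x - y) * (1 - bell (x - y)).
    rewrite /bell; have := cos2Dsin2 (x - y); move: (cos _) (sin _) => c s h.
    have -> : s ^+ 2 = 1 - c ^+ 2 by lra.
    by field.
  have E2 : cos (x - y) = 2 * bell (x - y) - 1 by rewrite /bell; field.
  rewrite E2; case: n {c1 c2 D1 D2} => [|n] /=.
    by rewrite !expr0 muln0 !add0n expr1; ring.
  have -> : sin (x - y) * (n.+1%:R * bell (x - y) ^+ n * (sin (x - y) / 2)) =
     n.+1%:R * bell (x - y) ^+ n * (sin (x - y) ^+ 2 / 2) by field.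
  by rewrite E !natrD !natrM !exprS -[n.+1]addn1 natrD; field.
rewrite (sint_FTC dF); last exact: cont_add.
have E : sin (x - (- pi)) = sin (x - pi).
  by rewrite opprK -[in LHS](subrK pi x) -addrA -mulr2n sinD2pi.
have E' : bell (x - (- pi)) = bell (x - pi).
  by rewrite /bell opprK -[in LHS](subrK pi x) -addrA -mulr2n cosD2pi.
by rewrite E E' subrr.
Qed.

Lemma bellJ0 x : bellJ 0 x = 2 * pi.
Proof.
by rewrite -[RHS]mul1r -sint_cst; apply: eq_sint => y _; rewrite expr0.
Qed.

(** The recursion determines every [bellJ] from [bellJ 0], which does not depend on the point; no
    change of variables is made. *)
Lemma bellJ_indep n x y : bellJ n x = bellJ n y.
Proof.
elim: n => [|n IH]; first by rewrite !bellJ0.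
have n0 : (2 * n + 2)%:R != 0 :> R by rewrite pnatr_eq0 addn2.
by apply: (mulfI n0); rewrite !bellJS IH.
Qed.

Lemma bellJ_gt0 n x : 0 < bellJ n x.
Proof.
elim: n => [|n IH]; first by rewrite bellJ0 mulr_gt0// pi_gt0.
have n0 : (0 : R) < (2 * n + 2)%:R by rewrite ltr0n addn2.
by rewrite -(pmulr_rgt0 _ n0) bellJS mulr_gt0// ltr0n addn1.
Qed.

Lemma bellJ_sub n x : bellJ n x - bellJ n.+1 x = bellJ n x / (2 * n + 2)%:R.
Proof.
have n0 : (2 * n + 2)%:R != 0 :> R by rewrite pnatr_eq0 addn2.
apply: (mulfI n0); rewrite mulrBr bellJS mulrCA mulfV// mulr1.
by rewrite -mulrBl -natrB ?leq_add2l// subnDl mul1r.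
Qed.

(** The left side is nonincreasing in n: with N = 2n, the recursion reduces this to (N+1)^2 (N+3) <=
    (N+2)^2 (N+1). So the mass decays like n^(-1/2), which measures both the boundary cutoff and the
    width of the bump. *)
Lemma bellJ_le n x : bellJ n x ^+ 2 * (2 * n + 1)%:R <= (2 * pi) ^+ 2.
Proof.
elim: n => [|n IH]; first by rewrite bellJ0 mulr1.
apply: le_trans IH.
have n0 : (0 : R) < (2 * n + 2)%:R by rewrite ltr0n addn2.
have -> : (2 * n.+1 + 1)%:R = (2 * n)%:R + 3 :> R.
  by rewrite -natrD -[n.+1]addn1 mulnDr muln1 -addnA.
have := bellJS n x; rewrite -(ler_pM2l (exprn_gt0 2 n0)) mulrA -exprMn => ->.
have key (a N : R) : 0 <= N -> ((N + 1) * a) ^+ 2 * (N + 3) <= (N + 2) ^+ 2 * (a ^+ 2 * (N + 1)).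
  move=> N0; rewrite -subr_ge0 (_ : _ - _ = a ^+ 2 * (N + 1)); last by ring.
  by rewrite mulr_ge0 ?sqr_ge0 ?addr_ge0.
by rewrite !natrD; apply: key.
Qed.

End CosineKernel.

Section Periodicity.
Context {R : realType}.

Lemma periodic_int (U V : zmodType) (f : U -> V) (a : U) (k : int) (x : U) :
  periodic f a -> f (x + a *~ k) = f x.
Proof.
move=> pf; have pn n y : f (y + a *+ n) = f y.
  by elim: n => [|n IH]; rewrite ?addr0// mulrSr addrA pf.
case: k => n; first exact: pn.
by rewrite NegzE mulrNz -(pn n.+1) subrK.
Qed.

Lemma angle_reduce (u : R) : exists k : int, `|u + (2 * pi) *~ k| <= pi.
Proof.
have p0 : 0 < 2 * pi :> R by rewrite mulr_gt0// pi_gt0.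
exists (- Num.floor ((u + pi) / (2 * pi))).
have /andP[] := floor_itv ((u + pi) / (2 * pi)).
rewrite intrD -[1%:~R]/(1 : R) ler_pdivlMr// ltr_pdivrMr//; move: (Num.floor _) => m h1 h2.
rewrite mulrNz -mulrzl ler_norml; apply/andP; split; lra.
Qed.

Lemma bell_int (u : R) k : bell (u + (2 * pi) *~ k) = bell u.
Proof.
rewrite /bell (periodic_int (f := cos))// => x.
by rewrite mulr_natl cosD2pi.
Qed.

Lemma bellN (u : R) : bell (- u) = bell u.
Proof. by rewrite /bell cosN. Qed.

Lemma bell_far (d : R) : 0 < d -> exists2 c, 0 < c & forall u, d <= `|u| <= pi -> c <= 1 - bell u.
Proof.
move=> d0; pose d' : R := Num.min d pi.
have d'0 : 0 < d' by rewrite lt_min d0 pi_gt0.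
have d'pi : d' <= pi by rewrite ge_min lexx orbT.
exists (1 - bell d').
  have : cos d' < cos 0 :> R.
    by rewrite ltr_cos// in_itv/= ?lexx ?pi_ge0 ?(ltW d'0).
  by rewrite cos0 /bell; lra.
move=> u /andP[du up]; have -> : bell u = bell `|u|.
  by case: (ger0P u) => _ //; rewrite bellN.
have : cos `|u| <= cos d'.
  have [->//|ne] := eqVneq d' `|u|.
  apply/ltW; rewrite ltr_cos ?in_itv/= ?normr_ge0 ?up ?(ltW d'0)//.
  by rewrite lt_neqAle ne/= (le_trans _ du)// ge_min lexx.
by rewrite /bell; lra.
Qed.

Lemma norm_cint_le (f g : R * R -> R) : continuous f -> continuous g ->
  (forall x, `|f x| <= g x) -> `|cint f| <= cint g.
Proof.
move=> cf cg fg; rewrite ler_norml -(cintN cg); apply/andP; split; apply: le_cint => //.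
- exact: cont_opp.
- by move=> x _; have := fg x; rewrite ler_norml => /andP[].
- by move=> x _; have := fg x; rewrite ler_norml => /andP[].
Qed.

End Periodicity.

Section Approximation.
Context {R : realType}.
Variable phi : R * R -> R.
Hypothesis cphi : continuous phi.
Hypothesis per1 : periodic phi (2 * pi, 0).
Hypothesis per2 : periodic phi (0, 2 * pi).

Lemma phi_int (x y : R) (k l : int) : phi (x + (2 * pi) *~ k, y + (2 * pi) *~ l) = phi (x, y).
Proof.
rewrite (@periodic_int _ _ (fun x => phi (x, _)) (2 * pi)); last first.
  by move=> u; rewrite -[RHS]per1; congr phi; congr (_, _); rewrite /= ?addr0.
rewrite (@periodic_int _ _ (fun y => phi (x, y)) (2 * pi))//.
by move=> u; rewrite -[RHS]per2; congr phi; congr (_, _); rewrite /= ?addr0.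
Qed.

Lemma phi_bounded : exists2 M, 0 <= M & forall z, `|phi z| <= M.
Proof.
have [M M0 hM] := clcell_bounded cphi; exists M => // -[x y].
have [k hk] := angle_reduce x; have [l hl] := angle_reduce y.
rewrite -(phi_int x y k l); apply: hM; split; rewrite /= in_itv /=.
  by rewrite -ler_norml.
by rewrite -ler_norml.
Qed.

(** Close points are handled by uniform continuity. For the others one of the two deficits 1 - bell
    is at least some c > 0, and the crude bound 2M is absorbed with C = 2M/c. A modulus linear in
    the deficits can be integrated exactly against powers of [bell]. *)
Lemma phi_modulus e : 0 < e -> exists2 C, 0 <= C & forall z w, clcell z ->
  `|phi w - phi z| <= e + C * ((1 - bell (z.1 - w.1)) + (1 - bell (z.2 - w.2))).
Proof.
move=> e0.
have cF : continuous (fun p : (R * R) * (R * R) => phi (p.2 + p.1)).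
  have cs : continuous (fun p : (R * R) * (R * R) => p.2 + p.1).
    by move=> p; apply: cvgD; [exact: cvg_snd|exact: cvg_fst].
  by move=> p; exact: (cvg_comp _ _ (cs p) (@cphi (p.2 + p.1))).
have := near_compact_dist (0 : R * R) (@compact_clcell R) cF e0.
move=> /nbhs_normP[d /= d0 dE].
have [c c0 hc] := bell_far d0.
have [M M0 hM] := phi_bounded.
exists (2 * M / c); first by rewrite divr_ge0 ?(ltW c0)// mulr_ge0.
move=> [zx zy] [wx wy] zc /=.
have [k hk] := angle_reduce (wx - zx); have [l hl] := angle_reduce (wy - zy).
pose ux := wx - zx + (2 * pi) *~ k; pose uy := wy - zy + (2 * pi) *~ l.
have Ew : phi (wx, wy) = phi ((zx, zy) + (ux, uy)).
  rewrite -(phi_int wx wy k l); congr phi.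
  by rewrite /ux /uy; congr (_, _); rewrite /=; ring.
have Ex : bell (zx - wx) = bell ux by rewrite /ux bell_int -bellN opprB.
have Ey : bell (zy - wy) = bell uy by rewrite /uy bell_int -bellN opprB.
rewrite Ew Ex Ey.
have bx := bell_le1 ux; have by_ := bell_le1 uy.
have C0 : 0 <= 2 * M / c by rewrite divr_ge0 ?(ltW c0)// mulr_ge0.
have far : c <= (1 - bell ux) + (1 - bell uy) -> `|phi ((zx, zy) + (ux, uy)) - phi (zx, zy)| <=
   e + 2 * M / c * ((1 - bell ux) + (1 - bell uy)).
  move=> h; apply: (@le_trans _ _ (2 * M)).
    apply: (le_trans (ler_normB _ _)).
    by rewrite mulr_natl mulr2n lerD.
  apply: (@le_trans _ _ (2 * M / c * ((1 - bell ux) + (1 - bell uy)))); last by rewrite lerDr ltW.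
  by rewrite mulrAC ler_pdivlMr// ler_wpM2l// mulr_ge0.
have [dx|dx] := leP d `|ux|.
  by apply: far; have := hc ux; rewrite dx hk => /(_ isT); lra.
have [dy|dy] := leP d `|uy|.
  by apply: far; have := hc uy; rewrite dy hl => /(_ isT); lra.
have /dE/(_ _ zc)/= : ball_ Num.norm (0 : R * R) d (ux, uy).
  by rewrite /ball_ /= sub0r normrN prod_normE/= gt_max dx dy.
rewrite addr0 distrC => /ltW/le_trans; apply.
by rewrite lerDl mulr_ge0// addr_ge0// subr_ge0.
Qed.

Definition smear n (z : R * R) : R :=
  cint (fun w => bell (z.1 - w.1) ^+ n * bell (z.2 - w.2) ^+ n * phi w).

Lemma cont_bells n m (z : R * R) :
  continuous (fun w : R * R => bell (z.1 - w.1) ^+ n * bell (z.2 - w.2) ^+ m).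
Proof.
apply: cont_mul; apply: cont_exp => w.
  by apply: (@continuous_comp _ _ _ fst (fun y => bell (z.1 - y))); [exact: cvg_fst|exact: cont_bellB].
by apply: (@continuous_comp _ _ _ snd (fun y => bell (z.2 - y))); [exact: cvg_snd|exact: cont_bellB].
Qed.

Lemma cint_bells n m (z : R * R) :
  cint (fun w : R * R => bell (z.1 - w.1) ^+ n * bell (z.2 - w.2) ^+ m) = bellJ n 0 * bellJ m 0.
Proof.
rewrite (cint_tensor (u := fun y => bell (z.1 - y) ^+ n) (v := fun y => bell (z.2 - y) ^+ m)).
- by congr (_ * _); apply: bellJ_indep.
- by apply: cont_exp; exact: cont_bellB.
- by apply: cont_exp; exact: cont_bellB.
Qed.

(** Korovkin-style argument: by [bellJ_sub] the normalized kernel gives each deficit 1 - bell the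
    average 1/(2n+2), so integrating [phi_modulus] at level e/2 leaves the error e/2 + 2C/(2n+2). *)
Lemma smear_approx e : 0 < e -> exists n, forall z, clcell z ->
  `|smear n z / bellJ n 0 ^+ 2 - phi z| <= e.
Proof.
move=> e0; have e20 : 0 < e / 2 by rewrite divr_gt0.
have [C C0 hC] := phi_modulus e20.
have [n hn] : exists n : nat, 2 * C / (2 * n + 2)%:R <= e / 2.
  pose n := Num.bound (2 * C / e); exists n.
  have hb : 2 * C / e < n%:R by apply: archi_boundP; rewrite divr_ge0 ?(ltW e0)// mulr_ge0.
  have n2 : (0 : R) < (2 * n + 2)%:R by rewrite ltr0n addn2.
  rewrite (ler_pdivrMr _ _ n2) natrD natrM.
  by move: hb; rewrite ltr_pdivrMr//; nra.
exists n => z zc.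
set J := bellJ n 0; have J0 : 0 < J := bellJ_gt0 n 0.
have ck := @cont_bells n n z.
have cp : continuous (fun w => phi w - phi z) by apply: cont_sub; [exact: cphi|exact: cont_cst].
pose b1 (w : R * R) := bell (z.1 - w.1); pose b2 (w : R * R) := bell (z.2 - w.2).
have Ediff : smear n z - J ^+ 2 * phi z = cint (fun w => b1 w ^+ n * b2 w ^+ n * (phi w - phi z)).
  rewrite /smear expr2 -(cint_bells n n z) mulrC -(@cintZ _ (phi z) _ ck).
  rewrite -(cintB (cont_mul ck cphi) (@cont_scale _ _ (phi z) _ ck)).
  by apply: eq_cint => w _; rewrite /b1 /b2; ring.
have maj : `|smear n z - J ^+ 2 * phi z| <= (e / 2 + 2 * C / (2 * n + 2)%:R) * J ^+ 2.
  (* The majorant comes from b^n (1 - b) = b^n - b^(n+1) in each variable. *)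
  rewrite Ediff; apply: (@le_trans _ _ (cint (fun w => (e / 2 + 2 * C) * (b1 w ^+ n * b2 w ^+ n) +
     (- C * (b1 w ^+ n.+1 * b2 w ^+ n) + - C * (b1 w ^+ n * b2 w ^+ n.+1))))).
    apply: norm_cint_le; first exact: cont_mul.
      apply: cont_add; first exact: cont_scale.
      by apply: cont_add; apply: cont_scale; exact: cont_bells.
    move=> w; have h := hC z w zc.
    have B0 : 0 <= b1 w ^+ n * b2 w ^+ n by rewrite mulr_ge0// exprn_ge0// bell_ge0.
    rewrite normrM ger0_norm//; apply: le_trans (ler_wpM2l B0 h) _.
    rewrite -/(b1 w) -/(b2 w) !exprS le_eqVlt; apply/orP; left; apply/eqP; ring.
  have c1 := @cont_bells n.+1 n z; have c2 := @cont_bells n n.+1 z.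
  rewrite (cintD (@cont_scale _ _ (e / 2 + 2 * C) _ ck)
    (cont_add (@cont_scale _ _ (- C) _ c1) (@cont_scale _ _ (- C) _ c2))).
  rewrite (cintD (@cont_scale _ _ (- C) _ c1) (@cont_scale _ _ (- C) _ c2)).
  rewrite (cintZ _ ck) (cintZ _ c1) (cintZ _ c2) !cint_bells -/J.
  have : bellJ n.+1 0 = J - J / (2 * n + 2)%:R by rewrite -bellJ_sub opprB addrCA subrr addr0.
  move=> ->; rewrite le_eqVlt; apply/orP; left; apply/eqP.
  have N0 : (2 * n + 2)%:R != 0 :> R by rewrite pnatr_eq0 addn2.
  by move: N0; move: (2 * n + 2)%:R => N N0; field.
have -> : smear n z / J ^+ 2 - phi z = (smear n z - J ^+ 2 * phi z) / J ^+ 2.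
  by field; rewrite gt_eqF.
have J20 : 0 < J ^+ 2 by rewrite exprn_gt0.
rewrite normrM normfV (gtr0_norm J20) ler_pdivrMr//.
apply: (le_trans maj); rewrite ler_wpM2r ?(ltW J20)//.
by rewrite [leRHS](splitr e) lerD2l.
Qed.

End Approximation.

(** * Trigonometric polynomials and their antisymmetric part *)

Section TrigSpan.
Context {R : realType}.
Implicit Types (f g h : R * R -> R) (a b : bool) (p q : int) (x y : R).

Definition tg a p x : R := if a then sin (p%:~R * x) else cos (p%:~R * x).

Lemma tg_mul a b p q x : tg a p x * tg b q x =
  (if a && b then - 2^-1 else 2^-1) * tg (a (+) b) (p + q) x +
  (if ~~ a && b then - 2^-1 else 2^-1) * tg (a (+) b) (p - q) x.
Proof.
rewrite /tg; case: a; case: b; rewrite /= intrD intrB mulrDl mulrBl ?cosB ?sinB ?cosD ?sinD; by field.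
Qed.

Inductive trigspan : (R * R -> R) -> Prop :=
| trigspan0 : trigspan (fun=> 0)
| trigspan_cons c a p b q g : trigspan g ->
    trigspan (fun z => c * (tg a p z.1 * tg b q z.2) + g z).

Lemma trigspan_add f g : trigspan f -> trigspan g -> trigspan (fun z => f z + g z).
Proof.
move=> + Sg; elim=> [|c a p b q h _ IH].
  by rewrite (_ : (fun z => _) = g)//; apply/funext => z; rewrite add0r.
have := trigspan_cons c a p b q IH; congr trigspan.
by apply/funext => z; rewrite addrA.
Qed.

Lemma trigspan_scale c f : trigspan f -> trigspan (fun z => c * f z).
Proof.
elim=> [|d a p b q h _ IH].
  rewrite (_ : (fun z => _) = fun=> 0); first exact: trigspan0.
  by apply/funext => z; rewrite mulr0.
have := trigspan_cons (c * d) a p b q IH; congr trigspan.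
by apply/funext => z; ring.
Qed.

Lemma trigspan_mul1 a p f : trigspan f -> trigspan (fun z => tg a p z.1 * f z).
Proof.
elim=> [|d a' p' b q h _ IH].
  rewrite (_ : (fun z => _) = fun=> 0); first exact: trigspan0.
  by apply/funext => z; rewrite mulr0.
have := trigspan_cons (d * (if a && a' then - 2^-1 else 2^-1)) (a (+) a') (p + p') b q
  (trigspan_cons (d * (if ~~ a && a' then - 2^-1 else 2^-1)) (a (+) a') (p - p') b q IH).
congr trigspan; apply/funext => z.
transitivity (d * ((tg a p z.1 * tg a' p' z.1) * tg b q z.2) + tg a p z.1 * h z); last by ring.
by rewrite tg_mul; ring.
Qed.

Lemma trigspan_mul2 a p f : trigspan f -> trigspan (fun z => tg a p z.2 * f z).
Proof.
elim=> [|d b q a' p' h _ IH].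
  rewrite (_ : (fun z => _) = fun=> 0); first exact: trigspan0.
  by apply/funext => z; rewrite mulr0.
have := trigspan_cons (d * (if a && a' then - 2^-1 else 2^-1)) b q (a (+) a') (p + p')
  (trigspan_cons (d * (if ~~ a && a' then - 2^-1 else 2^-1)) b q (a (+) a') (p - p') IH).
congr trigspan; apply/funext => z.
transitivity (d * (tg b q z.1 * (tg a p z.2 * tg a' p' z.2)) + tg a p z.2 * h z); last by ring.
by rewrite tg_mul; ring.
Qed.

(** Kernel factors are peeled off one at a time with bell(z - w) = (1 + cos z cos w + sin z sin
    w)/2: the factors in w are absorbed into [f], which is why the induction is general in [f], and
    those in z act on the span. *)
Lemma trigspan_smear n m f : continuous f ->
  trigspan (fun z => cint (fun w => bell (z.1 - w.1) ^+ n * bell (z.2 - w.2) ^+ m * f w)).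
Proof.
have cc (F : R -> R) : continuous F -> continuous (fun w : R * R => F w.1).
  by move=> cF w; apply: (@continuous_comp _ _ _ fst F); [exact: cvg_fst|exact: cF].
have cc2 (F : R -> R) : continuous F -> continuous (fun w : R * R => F w.2).
  by move=> cF w; apply: (@continuous_comp _ _ _ snd F); [exact: cvg_snd|exact: cF].
elim: n f => [|n IH] f cf.
  elim: m f cf => [|m IH] f cf.
    have := trigspan_cons (cint f) false 0 false 0 trigspan0; congr trigspan.
    apply/funext => z; rewrite /tg !mul0r cos0 !mulr1 addr0.
    by apply: eq_cint => w _ /=; rewrite ?expr0 ?mul1r ?mulr1.
  have c1 : continuous (fun w => cos w.2 * f w) by apply: cont_mul => //; exact/cc2/continuous_cos.
  have c2 : continuous (fun w => sin w.2 * f w) by apply: cont_mul => //; exact/cc2/continuous_sin.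
  have := trigspan_scale 2^-1 (trigspan_add (IH f cf) (trigspan_add (trigspan_mul2 false 1 (IH _ c1))
     (trigspan_mul2 true 1 (IH _ c2)))).
  congr trigspan; apply/funext => z; rewrite /tg !mul1r.
  have k1 := cont_mul (@cont_bells R 0 m z) cf.
  have k2 := cont_mul (@cont_bells R 0 m z) c1.
  have k3 := cont_mul (@cont_bells R 0 m z) c2.
  rewrite -(cintZ (cos z.2) k2) -(cintZ (sin z.2) k3).
  rewrite -(cintD (@cont_scale _ _ (cos z.2) _ k2) (@cont_scale _ _ (sin z.2) _ k3)).
  rewrite -(cintD k1 (cont_add (@cont_scale _ _ (cos z.2) _ k2) (@cont_scale _ _ (sin z.2) _ k3))).
  rewrite -(cintZ 2^-1 (cont_add k1 (cont_add (@cont_scale _ _ (cos z.2) _ k2) (@cont_scale _ _ (sin z.2) _ k3)))).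
  apply: eq_cint => w _; rewrite exprS.
  have -> : bell (z.2 - w.2) = 2^-1 * (1 + cos z.2 * cos w.2 + sin z.2 * sin w.2).
    by rewrite /bell cosB; ring.
  by ring.
have c1 : continuous (fun w => cos w.1 * f w) by apply: cont_mul => //; exact/cc/continuous_cos.
have c2 : continuous (fun w => sin w.1 * f w) by apply: cont_mul => //; exact/cc/continuous_sin.
have := trigspan_scale 2^-1 (trigspan_add (IH f cf) (trigspan_add (trigspan_mul1 false 1 (IH _ c1))
   (trigspan_mul1 true 1 (IH _ c2)))).
congr trigspan; apply/funext => z; rewrite /tg !mul1r.
have k1 := cont_mul (@cont_bells R n m z) cf.
have k2 := cont_mul (@cont_bells R n m z) c1.
have k3 := cont_mul (@cont_bells R n m z) c2.
rewrite -(cintZ (cos z.1) k2) -(cintZ (sin z.1) k3).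
rewrite -(cintD (@cont_scale _ _ (cos z.1) _ k2) (@cont_scale _ _ (sin z.1) _ k3)).
rewrite -(cintD k1 (cont_add (@cont_scale _ _ (cos z.1) _ k2) (@cont_scale _ _ (sin z.1) _ k3))).
rewrite -(cintZ 2^-1 (cont_add k1 (cont_add (@cont_scale _ _ (cos z.1) _ k2) (@cont_scale _ _ (sin z.1) _ k3)))).
apply: eq_cint => w _; rewrite exprS.
have -> : bell (z.1 - w.1) = 2^-1 * (1 + cos z.1 * cos w.1 + sin z.1 * sin w.1).
  by rewrite /bell cosB; ring.
by ring.
Qed.

(* Antisymmetrization about Y = pi/2 in the angle Y = x2/2: it kills exactly the
   trigonometric modes that do not vanish at x2 = pi and x2 = -pi. *)
Definition asym g (z : R * R) : R := (g (z.1, z.2 / 2) - g (z.1, pi - z.2 / 2)) / 2.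

Lemma cos_natpi (n : nat) : cos (n%:R * pi : R) = (-1) ^+ n.
Proof.
elim: n => [|n IH]; first by rewrite mul0r cos0.
by rewrite -addn1 natrD mulrDl mul1r cosDpi IH exprD expr1 mulrN1.
Qed.

(** Under Y -> pi - Y, cos(nY) is multiplied by (-1)^n and sin(nY) by (-1)^(n+1). The antisymmetric
    survivors are the cosines with n odd and the sines with n even, which are the [b_ n]. *)
Lemma asym_tg b q : exists c : R, forall y,
  (tg b q (y / 2) - tg b q (pi - y / 2)) / 2 = c * b_ (absz q) y.
Proof.
have main (n : nat) : exists c : R, forall y,
    (tg b n%:Z (y / 2) - tg b n%:Z (pi - y / 2)) / 2 = c * b_ n y.
  have sp := sin_intpi n%:Z : sin (n%:~R * pi : R) = 0.
  have cp := cos_natpi n.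
  exists (if odd n (+) b then 1 else 0) => y; rewrite bE /tg.
  have Ey : n%:~R * (y / 2) = n%:R / 2 * y by rewrite mulrA mulrAC.
  rewrite mulrBr Ey sinB cosB sp -[n%:~R]/(n%:R) cp -signr_odd.
  case: b; case: (odd n) => /=; rewrite ?expr0 ?expr1; by field.
case: q => n; first exact: main.
have [c hc] := main n.+1; exists (if b then - c else c) => y.
change (absz (Negz n)) with n.+1; rewrite NegzE; move: (hc y); rewrite /tg.
case: (b) => h; rewrite ?mulNr -h ?sinN ?cosN -[n.+1%:~R]/(n.+1%:R) //; by field.
Qed.

(** Cosine and sine in x1 are recovered from the modes of frequencies p and -p, whose imaginary
    components cancel in the combination. *)
Lemma real_mode a p (n : nat) : (0 < n)%N ->
  in_span (@mode R) posmode (real_part (fun z => tg a p z.1 * b_ n z.2)).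
Proof.
move=> n0.
have S1 := in_span_e (@mode R) (n0 : posmode (a, (p, n))).
have S2 := in_span_e (@mode R) (n0 : posmode (a, (- p, n))).
have S0 := in_span0 (@mode R) posmode.
have := in_span_lin (if a then - 2^-1 else 2^-1) S1 (in_span_lin 2^-1 S2 S0).
congr in_span; apply/funext => -[[] z]; rewrite /real_part /mode /tg /=;
  case: a {S1 S2} => /=; rewrite /omega_re /omega_im mulrNz (mulNr p%:~R) ?cosN ?sinN; by field.
Qed.

Lemma asym_span g : trigspan g -> in_span (@mode R) posmode (real_part (asym g)).
Proof.
elim=> [|c a p b q h _ IH].
  have := in_span0 (@mode R) posmode; congr in_span.
  by apply/funext => -[[] z]; rewrite /real_part /asym /= ?subrr ?mul0r.
have [d hd] := asym_tg b q.
have E : real_part (asym (fun z => c * (tg a p z.1 * tg b q z.2) + h z)) =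
   fun t => (c * d) * real_part (fun z => tg a p z.1 * b_ (absz q) z.2) t + real_part (asym h) t.
  apply/funext => -[[] z]; rewrite /real_part /asym /= ?mulr0 ?addr0//.
  transitivity (c * (tg a p z.1 * ((tg b q (z.2 / 2) - tg b q (pi - z.2 / 2)) / 2)) +
    (h (z.1, z.2 / 2) - h (z.1, pi - z.2 / 2)) / 2); first by field.
  by rewrite hd; ring.
(* Frequency 0 is not an admissible mode, but [b_ 0] is sin 0 = 0, so the term disappears. *)
rewrite E; have [q0|q0] := posnP (absz q); last exact: in_span_lin (real_mode a p q0) IH.
move: IH; congr in_span; apply/funext => -[[] z]; rewrite /real_part /= ?mulr0 ?add0r//.
by rewrite q0 /b_ /= mul0r mul0r sin0 !mulr0 add0r.
Qed.

End TrigSpan.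

(** * Odd extension across the boundary, with a cutoff *)

Section Fold.
Context {R : realType}.
Implicit Types (x y t : R) (m : nat) (f : R * R -> R).

(** In the angle Y = x2/2 this returns x2 on [-pi/2, pi/2] and continues by reflection about pi/2:
    [f] composed with it is defined for all angles, 2 pi-periodic and even about pi/2. *)
Definition fold y : R := 2 * asin (sin y).

Lemma sin_range y : -1 <= sin y <= 1.
Proof. by rewrite sin_geN1 sin_le1. Qed.

Lemma asin_gt (s t : R) : -1 <= s <= 1 -> - (pi / 2) <= t <= pi / 2 ->
  ((t < asin s) = (sin t < s)) * ((asin s < t) = (s < sin t)).
Proof.
move=> s1 t1; have [a1 a2] := asin_def s1.
have tI : t \in `[- (pi / 2), pi / 2] by rewrite in_itv.
have aI : asin s \in `[- (pi / 2), pi / 2] by rewrite in_itv.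
by split; rewrite -(ltr_sin _ _) // a2.
Qed.

(** By monotonicity of sin on [-pi/2, pi/2], bounds on asin (sin z) become bounds on sin z; where
    the shifted level leaves that interval, the range of asin suffices. This covers the endpoints,
    where asin is not differentiable. *)
Lemma continuous_fold : continuous fold.
Proof.
apply: cont_scale => y; apply/cvgrPdist_lt => e e0.
have [/andP[a1 a2] _] := asin_def (sin_range y).
have pp := @pi_gt0 R.
have L : \forall z \near y, asin (sin y) - e < asin (sin z).
  have [h|h] := ltP (asin (sin y) - e) (- (pi / 2)).
    apply: (@filterE _ (nbhs y)) => z; apply: (lt_le_trans h).
    by have [/andP[]] := asin_def (sin_range z).
  have hI : - (pi / 2) <= asin (sin y) - e <= pi / 2 by rewrite h; lra.
  have : sin (asin (sin y) - e) < sin y by rewrite -(asin_gt (sin_range y) hI).1; lra.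
  move=> hlt; have H := @cvgr_gt R R (nbhs y) _ sin (sin y) (@continuous_sin R y) _ hlt.
  by near=> z; rewrite (asin_gt (sin_range z) hI).1; near: z; exact: H.
have U : \forall z \near y, asin (sin z) < asin (sin y) + e.
  have [h|h] := ltP (pi / 2) (asin (sin y) + e).
    apply: (@filterE _ (nbhs y)) => z; apply: (le_lt_trans _ h).
    by have [/andP[]] := asin_def (sin_range z).
  have hI : - (pi / 2) <= asin (sin y) + e <= pi / 2 by rewrite h; lra.
  have : sin y < sin (asin (sin y) + e) by rewrite -(asin_gt (sin_range y) hI).2; lra.
  move=> hlt; have H := @cvgr_lt R R (nbhs y) _ sin (sin y) (@continuous_sin R y) _ hlt.
  by near=> z; rewrite (asin_gt (sin_range z) hI).2; near: z; exact: H.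
near=> z; have h1 : asin (sin y) - e < asin (sin z) by near: z.
have h2 : asin (sin z) < asin (sin y) + e by near: z.
by rewrite ltr_norml; apply/andP; split; lra.
Unshelve. all: by end_near. Qed.

Lemma fold_half y : - pi <= y <= pi -> fold (y / 2) = y.
Proof.
move=> /andP[h1 h2]; rewrite /fold sinK ?in_itv/=; last by apply/andP; split; lra.
by field.
Qed.

Lemma sin_refl y : sin (pi - y) = sin y.
Proof. by rewrite sinB sinpi cospi; ring. Qed.

Lemma cos_refl y : cos (pi - y) = - cos y.
Proof. by rewrite cosB sinpi cospi; ring. Qed.

(** Truncation of t to [-1, 1], written so that oddness and continuity are immediate. *)
Definition clamp t : R := (`|t + 1| - `|t - 1|) / 2.

Lemma cont_clamp : continuous clamp.
Proof.
have ci : continuous (fun t : R => t) by move=> t; exact: cvg_id.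
apply: (cont_mul (f := fun t => `|t + 1| - `|t - 1|) (g := fun=> 2^-1)); last exact: cont_cst.
by apply: cont_sub; apply: cont_norm; [apply: cont_add|apply: cont_sub] => //; exact: cont_cst.
Qed.

Lemma clampN t : clamp (- t) = - clamp t.
Proof.
rewrite /clamp (_ : - t + 1 = - (t - 1)); last by ring.
rewrite (_ : - t - 1 = - (t + 1)); last by ring.
by rewrite !normrN; field.
Qed.

Lemma clamp_ge0 t : 0 <= t -> 0 <= 1 - clamp t <= 1 /\ (1 <= t -> clamp t = 1) /\ (t <= 1 -> clamp t = t).
Proof.
move=> t0; rewrite /clamp (ger0_norm (_ : 0 <= t + 1)); last by lra.
have [h|h] := leP 1 t.
  rewrite ger0_norm ?subr_ge0// (_ : (t + 1 - (t - 1)) / 2 = 1); last by field.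
  split; first by rewrite subrr lexx ler01.
  by split=> // t1; apply/eqP; rewrite eq_le h t1.
rewrite ler0_norm; last by lra.
split; first by apply/andP; split; lra.
by split=> ?; lra.
Qed.

(** The folded function is even about Y = pi/2 and cos Y is odd, so the product is odd there, as
    antisymmetrization needs. On the strip the cutoff equals 1 as soon as cos Y >= 1/m, hence
    differs from 1 only in a boundary layer; without it an [f] nonzero at the boundary would have a
    discontinuous odd extension. *)
Definition oddext m f (z : R * R) : R := f (z.1, fold z.2) * clamp (m%:R * cos z.2).

Lemma oddext_cont m f : continuous f -> continuous (oddext m f).
Proof.
move=> cf; apply: cont_mul => z.
  have c2 : {for z, continuous (fun z : R * R => (z.1, fold z.2))}.
    apply: continuous_pairf; first exact: cvg_fst.
    by apply: (@continuous_comp _ _ _ snd fold); [exact: cvg_snd|exact: continuous_fold].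
  exact: (continuous_comp c2 (cf _)).
apply: (@continuous_comp _ _ _ snd (fun y => clamp (m%:R * cos y))); first exact: cvg_snd.
apply: (@continuous_comp _ _ _ (fun y => m%:R * cos y) clamp); last exact: cont_clamp.
by apply: cont_scale; exact: continuous_cos.
Qed.

Lemma oddext_refl m f x y : oddext m f (x, pi - y) = - oddext m f (x, y).
Proof. by rewrite /oddext /= /fold sin_refl cos_refl mulrN clampN mulrN. Qed.

Lemma oddext_per1 m f : periodic f (2 * pi, 0) -> periodic (oddext m f) (2 * pi, 0).
Proof.
move=> pf z; rewrite /oddext /= addr0; congr (_ * _).
by rewrite -[RHS]pf; congr f; congr (_, _); rewrite /= addr0.
Qed.

Lemma oddext_per2 m f : periodic (oddext m f) (0, 2 * pi).
Proof.
by move=> z; rewrite /oddext /= addr0 [2 * pi]mulr_natl /fold sinD2pi cosD2pi.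
Qed.

Lemma half_strip y : - pi <= y <= pi -> 0 <= cos (y / 2) :> R.
Proof. by move=> /andP[h1 h2]; apply: cos_ge0_pihalf; apply/andP; split; lra. Qed.

(* Bernoulli: 1 - m c <= (1 - c^2)^m, where 1 - cos(y/2)^2 = bell (pi - y). *)
Lemma oddext_error m y : - pi <= y <= pi ->
  0 <= 1 - clamp (m%:R * cos (y / 2)) /\ (1 - clamp (m%:R * cos (y / 2))) ^+ 2 <= bell (pi - y) ^+ m.
Proof.
move=> hy; have c0 := half_strip hy; have c1 := cos_le1 (y / 2).
have mc0 : 0 <= m%:R * cos (y / 2) by rewrite mulr_ge0.
have [/andP[k1 k2] [k3 k4]] := clamp_ge0 mc0; split=> //.
have B0 : 0 <= bell (pi - y) ^+ m by rewrite exprn_ge0// bell_ge0.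
apply: (@le_trans _ _ (1 - clamp (m%:R * cos (y / 2)))).
  by rewrite expr2 ler_piMr.
have [h|h] := leP 1 (m%:R * cos (y / 2)); first by rewrite k3// subrr.
rewrite k4 ?(ltW h)//.
have -> : bell (pi - y) = 1 - cos (y / 2) ^+ 2.
  rewrite /bell cos_refl (_ : cos y = cos (y / 2 + y / 2)); last by congr cos; field.
  by rewrite cosD -!expr2; have := cos2Dsin2 (y / 2); lra.
move: c0 c1; move: (cos (y / 2)) => c c0 c1.
have {h k1 k2 k3 k4 B0 mc0 hy} bern k : 1 - k%:R * c ^+ 2 <= (1 - c ^+ 2) ^+ k.
  elim: k => [|k IH]; first by rewrite mul0r subr0 expr0.
  have q1 : 0 <= 1 - c ^+ 2 by rewrite subr_ge0 expr_le1.
  rewrite [leRHS]exprS; apply: le_trans _ (ler_wpM2l q1 IH).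
  rewrite -subr_ge0 -[k.+1]addn1 natrD (_ : _ - _ = k%:R * (c ^+ 2) ^+ 2); last by ring.
  by rewrite mulr_ge0 ?sqr_ge0.
apply: le_trans _ (bern m); rewrite lerD2l lerN2 ler_wpM2l// expr2 ler_piMr//.
Qed.

End Fold.

Lemma ler_sum_sub {R : numDomainType} (J : eqType) (s t : seq J) (F : J -> R) :
  uniq s -> uniq t -> {subset s <= t} -> (forall j, 0 <= F j) ->
  \sum_(j <- s) F j <= \sum_(j <- t) F j.
Proof.
move=> us ut st F0.
have p : perm_eq s [seq j <- t | j \in s].
  apply: uniq_perm => //; first exact: filter_uniq.
  by move=> j; rewrite mem_filter andbC; have [/st ->|] := boolP (j \in s); rewrite ?andbF.
rewrite (perm_big _ p) big_filter big_mkcond; apply: ler_sum => j _.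
by case: ifP.
Qed.

Section Parseval.
Context {R : realType}.
Implicit Types (f g : R * R -> R).

Lemma smear_approx_all (phi : R * R -> R) e : continuous phi -> periodic phi (2 * pi, 0) ->
  periodic phi (0, 2 * pi) -> 0 < e ->
  exists n, forall z, `|smear phi n z / bellJ n 0 ^+ 2 - phi z| <= e.
Proof.
move=> cphi p1 p2 e0; have [n hn] := smear_approx cphi p1 p2 e0; exists n => -[x y].
have [k hk] := angle_reduce x; have [l hl] := angle_reduce y.
have -> : phi (x, y) = phi (x + (2 * pi) *~ k, y + (2 * pi) *~ l) by rewrite phi_int.
have -> : smear phi n (x, y) = smear phi n (x + (2 * pi) *~ k, y + (2 * pi) *~ l).
  apply: eq_cint => w _ /=.
  by rewrite (addrAC x) (addrAC y) !bell_int.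
apply: hn; split; rewrite /= in_itv /= -ler_norml//.
Qed.

Lemma bellJ_small e : 0 < e -> exists m, bellJ m 0 <= e :> R.
Proof.
move=> e0; pose m := Num.bound (((2 * pi) / e) ^+ 2 : R); exists m.
have hb : ((2 * pi) / e) ^+ 2 < m%:R by apply: archi_boundP; rewrite sqr_ge0.
have := bellJ_le m (0 : R); have J0 := bellJ_gt0 m (0 : R).
rewrite expr_div_n ltr_pdivrMr ?exprn_gt0// in hb.
move=> hle; rewrite leNgt; apply/negP => he.
have h2 : e ^+ 2 < bellJ m 0 ^+ 2 by rewrite ltr_pXn2r// ?nnegrE ltW.
have : bellJ m 0 ^+ 2 * (2 * m + 1)%:R < m%:R * e ^+ 2 by exact: le_lt_trans hle hb.
have m0 : 0 <= m%:R :> R by [].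
rewrite natrD natrM; move: h2 m0; move: (m%:R) (bellJ m 0 ^+ 2) (e ^+ 2) (exprn_gt0 2 e0).
by move=> M B E E0 EB M0; nra.
Qed.

Lemma cint_sin_pow m : cint (fun z : R * R => bell (pi - z.2) ^+ m) = 2 * pi * bellJ m 0.
Proof.
transitivity (cint (fun z : R * R => (fun=> 1) z.1 * bell (pi - z.2) ^+ m)).
  by apply: eq_cint => z _; rewrite mul1r.
rewrite (cint_tensor (u := fun=> 1) (v := fun y => bell (pi - y) ^+ m)); last 2 first.
- exact: cont_cst.
- by apply: cont_exp; exact: cont_bellB.
by rewrite sint_1; congr (_ * _); exact: bellJ_indep.
Qed.

Lemma cint_cst (c : R) : cint (fun=> c) = c * (2 * pi) ^+ 2.
Proof.
transitivity (cint (fun z : R * R => (fun=> c) z.1 * (fun=> 1) z.2)).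
  by apply: eq_cint => z _; rewrite mulr1.
rewrite (cint_tensor (u := fun=> c) (v := fun=> 1)); [|exact: cont_cst|exact: cont_cst].
by rewrite sint_1 sint_cst expr2 -mulrA.
Qed.

(** Approximation holds in L2 only, since [f] may be nonzero at x2 = -pi, pi where all modes vanish.
    The cutoff costs a multiple of [bellJ m 0]; the continuous, periodic, odd extension is then
    approximated uniformly by [smear], whose antisymmetric part lies in the span. *)
Lemma span_dense f e : continuous f -> periodic f (2 * pi, 0) -> 0 < e ->
  exists g, [/\ in_span (@mode R) posmode (real_part g), continuous g &
    cint (fun z => (f z - g z) ^+ 2) <= e].
Proof.
move=> cf pf e0; have pp := @pi_gt0 R.
have [M M0 hM] := clcell_bounded cf.
(* [A] and [D] are the factors of [bellJ m 0] and of d^2 in the final bound, which comes from (F -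
   G)^2 <= 2 F^2 (1 - c)^2 + 2 (F c - G)^2 with c the cutoff; each contribution is made at most
   e/2. *)
pose A : R := 2 * M ^+ 2 * (2 * pi); have A0 : 0 <= A by rewrite !mulr_ge0 ?sqr_ge0 ?(ltW pp).
have [m hm] : exists m, bellJ m 0 <= e / (2 * (A + 1)) :> R.
  by apply: bellJ_small; rewrite divr_gt0// mulr_gt0// ltr_wpDl.
pose D : R := 2 * (2 * pi) ^+ 2; have D0 : 0 < D by rewrite mulr_gt0 ?exprn_gt0 ?mulr_gt0.
pose d := Num.min 1 (e / (2 * D)).
have d0 : 0 < d by rewrite lt_min ltr01/= divr_gt0// mulr_gt0.
have d1 : d <= 1 by rewrite ge_min lexx.
have cphi := @oddext_cont _ m f cf; have p1 := @oddext_per1 _ m f pf; have p2 := @oddext_per2 _ m f.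
have [n hn] := smear_approx_all cphi p1 p2 d0.
pose L z := (bellJ n 0 ^+ 2)^-1 * smear (oddext m f) n z.
have SL : trigspan L := trigspan_scale _ (trigspan_smear n n cphi).
have Sg := asym_span SL; exists (asym L).
(* [asym] fixes the already odd extension and averages two errors of size at most d, so the uniform
   error is preserved. *)
have hg x y : - pi <= y <= pi -> `|oddext m f (x, y / 2) - asym L (x, y)| <= d.
  move=> hy; have -> : oddext m f (x, y / 2) = asym (oddext m f) (x, y).
    by rewrite /asym /= oddext_refl; field.
  have h1 := hn (x, y / 2); have h2 := hn (x, pi - y / 2).
  rewrite /asym /L /=.
  move: h1 h2; rewrite ![_ / bellJ n 0 ^+ 2]mulrC !ler_norml => /andP[h1 h1'] /andP[h2 h2'].
  by apply/andP; split; lra.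
have cg : continuous (asym L).
  have [s [c [_ _ E]]] := Sg.
  have -> : asym L = fun z => lincomb (@mode R) s c (false, z).
    by apply/funext => z; rewrite -E.
  exact: (lincomb_C (@CnT0 R 0) (@CnT_lin R 0) (@CnT_mode R 0) s c false).
split=> //.
have cb : continuous (fun z : R * R => bell (pi - z.2) ^+ m).
  apply: cont_exp => z.
  by apply: (@continuous_comp _ _ _ snd (fun y => bell (pi - y))); [exact: cvg_snd|exact: cont_bellB].
apply: (@le_trans _ _ (cint (fun z => 2 * M ^+ 2 * bell (pi - z.2) ^+ m + 2 * d ^+ 2))).
  apply: le_cint.
  - by apply: cont_exp; exact: cont_sub.
  - by apply: cont_add; [exact: cont_scale|exact: cont_cst].
  - move=> [x y] /cell_clcell hz; have hy : - pi <= y <= pi by case: hz => _; rewrite /= in_itv.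
    have [k1 k2] := oddext_error m hy.
    have h1 := hg x y hy; have h2 := hM _ hz.
    have E : oddext m f (x, y / 2) = f (x, y) * clamp (m%:R * cos (y / 2)).
      by rewrite /oddext /= fold_half.
    rewrite E in h1; move: h1 h2 k1 k2 => /=.
    move: (clamp _) (f (x, y)) (asym L (x, y)) (bell _ ^+ m) => c F G B h1 h2 k1 k2.
    have F2 : F ^+ 2 <= M ^+ 2 by rewrite -[F ^+ 2]real_normK ?num_real// ler_pXn2r ?nnegrE.
    have H2 : (F * c - G) ^+ 2 <= d ^+ 2.
      by rewrite -[_ ^+ 2]real_normK ?num_real// ler_pXn2r ?nnegrE// ltW.
    have H1 : F ^+ 2 * (1 - c) ^+ 2 <= M ^+ 2 * B by rewrite ler_pM ?sqr_ge0.
    have : (F - G) ^+ 2 <= 2 * (F ^+ 2 * (1 - c) ^+ 2) + 2 * (F * c - G) ^+ 2.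
      rewrite -subr_ge0 (_ : _ - _ = (F * (1 - c) - (F * c - G)) ^+ 2); last by ring.
      exact: sqr_ge0.
    by lra.
rewrite (cintD (@cont_scale _ _ _ _ cb) (@cont_cst _ _ (2 * d ^+ 2))).
rewrite (cintZ _ cb) cint_sin_pow cint_cst.
have -> : 2 * M ^+ 2 * (2 * pi * bellJ m 0) + 2 * d ^+ 2 * (2 * pi) ^+ 2 =
  A * bellJ m 0 + d ^+ 2 * D by rewrite /A /D; ring.
have t1 : A * bellJ m 0 <= e / 2.
  apply: (@le_trans _ _ (A * (e / (2 * (A + 1))))); first by rewrite ler_wpM2l.
  rewrite mulrA ler_pdivrMr ?mulr_gt0 ?ltr_wpDl//.
  by nra.
have t2 : d ^+ 2 * D <= e / 2.
  apply: (@le_trans _ _ (d * D)).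
    by rewrite ler_wpM2r ?(ltW D0)// expr2 ler_piMl ?(ltW d0).
  have : d <= e / (2 * D) by rewrite ge_min lexx orbT.
  rewrite ler_pdivlMr ?mulr_gt0//; lra.
by rewrite [leRHS](splitr e) lerD.
Qed.

(** This is the completeness half of Parseval, the converse of [l2_bessel] up to e: the Fourier sum
    over the modes of a good approximant does at least as well as the approximant itself. *)
Theorem parseval_le f e : continuous f -> periodic f (2 * pi, 0) -> 0 < e ->
  exists s : seq (int * nat), [/\ uniq s, all (fun k => 0 < k.2)%N s &
   cint (fun z => f z ^+ 2) <= \sum_(k <- s) coef_normsq f k.1 k.2 / omega_normsq k.1 k.2 + e].
Proof.
move=> cf pf e0; have [g [[s [c [us ps E]]] cg hg]] := span_dense cf pf e0.
(* The approximant may use only one of the two real modes of a frequency. [s'] keeps the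
   frequencies, and restoring both real modes only adds nonnegative terms. *)
pose s' := undup (map snd s).
have ps' : all (fun k => 0 < k.2)%N s'.
  by apply/allP => k; rewrite mem_undup => /mapP[j js ->]; exact: (allP ps).
exists s'; split=> //; first exact: undup_uniq.
have := best_approx (@CnT0 R 0) (@CnT_lin R 0) (@l2formL R) (@l2formS R)
  (@CnT_mode R 0) (fun _ _ => @pi2_gt0 R) (@mode_orth R) c (@CnT_real R 0 f cf) us ps.
have hl : l2form (fun t => real_part f t - real_part g t) (fun t => real_part f t - real_part g t)
    = cint (fun z => (f z - g z) ^+ 2).
  by apply: eq_cint => z _; rewrite /real_part /=; ring.
rewrite (l2form_real cf) -E hl => /le_trans/(_ hg).
rewrite lerBlDr => /le_trans; apply; rewrite addrC lerD2r.
have sub : {subset s <= modes s'}.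
  move=> -[a k] js; rewrite /modes mem_cat.
  have ks : k \in s' by rewrite mem_undup; apply/mapP; exists (a, k).
  by case: a js => _; rewrite ?(map_f (pair false) ks) ?(map_f (pair true) ks) ?orbT.
have F0 (j : bool * (int * nat)) : 0 <= l2form (real_part f) (@mode R j) ^+ 2 / (2 * pi * pi).
  by rewrite divr_ge0 ?sqr_ge0// ltW// pi2_gt0.
apply: le_trans (ler_sum_sub us (modes_uniq (undup_uniq _)) sub F0) _.
rewrite big_cat !big_map /= -big_split /= big_seq [leRHS]big_seq; apply: ler_sum => k ks.
by rewrite -mulrDl (l2form_mode k cf) omega_normsqE//; exact: (allP ps').
Qed.

End Parseval.

(** * Maximum principle and velocity bounds *)

Section SecondDerivativeTest.
Context {R : realType}.
Implicit Types (g dg ddg : R -> R) (c d r : R).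

Lemma is_derive_cont g dg : (forall r : R, is_derive r (1 : R) g (dg r)) -> continuous g.
Proof.
by move=> h r; apply/differentiable_continuous/derivable1_diffP; have [] := h r.
Qed.

Lemma mvt_derive g dg (a b : R) : (forall r : R, is_derive r (1 : R) g (dg r)) -> a < b ->
  exists2 c, a < c < b & g b - g a = dg c * (b - a).
Proof.
move=> h ab; have [|c] := @MVT R g dg a b ab (fun r _ => h r).
  exact: continuous_subspaceT (is_derive_cont h).
by rewrite in_itv => ? ?; exists c.
Qed.

(** If [ddg c] were positive, two mean value steps to the right of the critical point [c] would give
    a point with a larger value of [g]. *)
Lemma second_derivative_le0 g dg ddg c d : 0 < d ->
  (forall r : R, is_derive r (1 : R) g (dg r)) ->
  (forall r : R, is_derive r (1 : R) dg (ddg r)) -> continuous ddg ->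
  (forall r, `|r - c| < d -> g r <= g c) -> ddg c <= 0.
Proof.
move=> d0 h1 h2 cdd hmax.
have dg0 : dg c = 0.
  have := @derive1_at_max R g (c - d) (c + d) c.
  have hlt : c - d < c + d by lra.
  move=> /(_ (ltW hlt)) H.
  have [|||_] := H _ _ _.
  - by move=> r _; have [] := h1 r.
  - by rewrite in_itv/=; apply/andP; split; lra.
  - move=> r; rewrite in_itv/= => /andP[r1 r2]; apply: hmax.
    by rewrite ltr_norml; apply/andP; split; lra.
  - by have [_ ->] := h1 c.
rewrite leNgt; apply/negP => pos.
have /cvgrPdist_lt/(_ _ pos) /nbhs_normP[e /= e0 he] := cdd c.
have m0 : 0 < Num.min d e by rewrite lt_min d0 e0.
have md : Num.min d e <= d by rewrite ge_min lexx.
have me : Num.min d e <= e by rewrite ge_min lexx orbT.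
pose r := c + Num.min d e / 2.
have cr : c < r by rewrite /r ltrDl divr_gt0.
have [xi /andP[xi1 xi2] E1] := mvt_derive h1 cr.
have [eta /andP[et1 et2] E2] := mvt_derive h2 xi1.
have : g r <= g c by apply: hmax; rewrite /r addrAC subrr add0r gtr0_norm ?divr_gt0//; lra.
have ddpos : 0 < ddg eta.
  have /he : ball_ Num.norm c e eta.
    rewrite /ball_ /= distrC gtr0_norm ?subr_gt0//.
    by move: et2 xi2; rewrite /r; lra.
  by rewrite /= ltr_norml => /andP[_]; lra.
have : 0 < dg xi.
  by move: E2; rewrite dg0 subr0 => ->; rewrite mulr_gt0// subr_gt0.
move=> p; rewrite -subr_le0 E1 leNgt mulr_gt0// subr_gt0//.
Qed.

End SecondDerivativeTest.

Section MaximumPrinciple.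
Context {R : realType}.
Implicit Types (v f P : R * R -> R) (x : R * R).

Lemma periodic_shift (f : R * R -> R) x (k : int) : periodic f (2 * pi, 0) ->
  f (x.1 + (2 * pi) *~ k, x.2) = f x.
Proof.
case: x => x y pf; rewrite (@periodic_int _ _ (fun r : R => f (r, y)) (2 * pi))//.
by move=> u; rewrite -[RHS]pf; congr f; congr (_, _); rewrite /= ?addr0.
Qed.

(** Comparison with the barrier C (pi^2 - x2^2)/2, which vanishes on the boundary and has -
    laplacian equal to C. Its linear vanishing at the boundary is what later confines the Euler
    steps to the strip. *)
Lemma max_principle v C : Cn 2 v -> periodic v (2 * pi, 0) -> vanish v ->
  (forall x, strip_interior x -> - laplacian v x <= C) ->
  forall x, strip x -> v x <= C * ((pi ^+ 2 - x.2 ^+ 2) / 2).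
Proof.
move=> Cv pv vv hC x sx.
have pp := @pi_gt0 R.
have p2 : 0 < pi ^+ 2 / 2 :> R by rewrite divr_gt0// exprn_gt0.
apply/ler_addgt0Pr => e e0.
(* [K] exceeds [C] so that an interior maximum is strictly contradictory; the surplus barrier is at
   most e, since (pi^2 - x2^2)/2 <= pi^2/2. *)
pose K := C + e / (pi ^+ 2 / 2).
have CK : C < K by rewrite ltrDl divr_gt0.
pose w z := v z - K * ((pi ^+ 2 - z.2 ^+ 2) / 2).
have cw : continuous w.
  apply: cont_sub; first exact: Cn_cont Cv.
  apply: cont_scale; apply: (cont_mul (f := fun z : R * R => pi ^+ 2 - z.2 ^+ 2) (g := fun _ : R * R => 2^-1)); last exact: cont_cst.
  apply: cont_sub; first exact: cont_cst.
  by apply: cont_exp => z; exact: cvg_snd.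
have [||c cin cmax] := @compact_EVT_max _ R w clcell _ (@compact_clcell R).
- by exists (0, 0); split => /=; rewrite in_itv /= oppr_le0 pi_ge0.
- exact: continuous_subspaceT.
have {}cmax z : strip z -> w z <= w c.
  move=> sz; have [k hk] := angle_reduce z.1.
  have := cmax (z.1 + (2 * pi) *~ k, z.2); rewrite inE.
  rewrite /w periodic_shift//; apply; split; rewrite /= in_itv /=.
    by rewrite -ler_norml.
  exact: sz.
have sc : strip c by move: cin; rewrite inE => -[_]; rewrite /= in_itv.
have wc : w c <= 0.
  case/andP: (sc) => c1 c2.
  have [e1|n1] := eqVneq c.2 pi.
    have -> : c = (c.1, pi) by rewrite -e1; case: (c).
    by rewrite /w /= (vv c.1).2 subrr mul0r mulr0 subrr.
  have [e2|n2] := eqVneq c.2 (- pi).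
    have -> : c = (c.1, - pi) by rewrite -e2; case: (c).
    by rewrite /w /= (vv c.1).1 sqrrN subrr mul0r mulr0 subrr.
  have c1' : - pi < c.2 by rewrite lt_neqAle eq_sym n2.
  have c2' : c.2 < pi by rewrite lt_neqAle n1.
  have ic : strip_interior c by rewrite /strip_interior /= c1' c2'.
  have Ec : c = (c.1, c.2) by case: (c).
  have D1 r : is_derive r (1 : R) (fun r => v (r, c.2)) (dx1 v (r, c.2)).
    by apply: is_derive_x; exact: Cn_diff Cv.
  have D11 r : is_derive r (1 : R) (fun r => dx1 v (r, c.2)) (dx1 (dx1 v) (r, c.2)).
    by apply: is_derive_x; exact: Cn_diff (Cn_partial1 Cv).
  have D2 r : is_derive r (1 : R) (fun r => v (c.1, r)) (dx2 v (c.1, r)).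
    by apply: is_derive_y; exact: Cn_diff Cv.
  have D22 r : is_derive r (1 : R) (fun r => dx2 v (c.1, r)) (dx2 (dx2 v) (c.1, r)).
    by apply: is_derive_y; exact: Cn_diff (Cn_partial2 Cv).
  have c11 : continuous (dx1 (dx1 v)) := Cn_cont (Cn_partial1 (Cn_partial1 Cv)).
  have c22 : continuous (dx2 (dx2 v)) := Cn_cont (Cn_partial2 (Cn_partial2 Cv)).
  have L1 : dx1 (dx1 v) (c.1, c.2) <= 0.
    apply: (second_derivative_le0 (d := 1) _ D1 D11) => //.
      exact: (@continuous_fix2 _ _ c.2 c11).
    move=> r _; have := cmax (r, c.2); rewrite /w /= -Ec => /(_ sc).
    by rewrite lerD2r.
  pose dq r := dx2 v (c.1, r) + K * r.
  have Dq r : is_derive r (1 : R) (fun r => v (c.1, r) - K * ((pi ^+ 2 - r ^+ 2) / 2)) (dq r).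
    have E1 := is_derive_pow 2 (is_derive_id r (1 : R)).
    have E2 := @is_deriveB _ _ _ _ _ _ _ _ _ (is_derive_cst (pi ^+ 2 : R) r 1) E1.
    have E3 := @is_deriveM _ _ _ _ _ _ _ _ E2 (is_derive_cst (2^-1 : R) r 1).
    have E4 := @is_deriveB _ _ _ _ _ _ _ _ _ (D2 r) (@is_deriveZ _ _ _ _ K _ _ _ E3).
    by apply: (is_derive_eq E4); rewrite /dq /GRing.scale /cst /=; field.
  have Dqq r : is_derive r (1 : R) dq (dx2 (dx2 v) (c.1, r) + K).
    have E := @is_deriveD _ _ _ _ _ _ _ _ _ (D22 r) (is_derive_lin K r).
    exact: E.
  pose m := Num.min (c.2 + pi) (pi - c.2).
  have m0 : 0 < m by rewrite lt_min; apply/andP; split; lra.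
  have L2 : dx2 (dx2 v) (c.1, c.2) + K <= 0.
    apply: (second_derivative_le0 m0 Dq Dqq).
      by apply: cont_add; [exact: (@continuous_fix1 _ _ c.1 c22)|exact: cont_cst].
    move=> r; rewrite /m lt_min !ltr_norml => /andP[/andP[r1 r2] /andP[r3 r4]].
    have := cmax (c.1, r); rewrite /w /= -Ec; apply.
    by rewrite /strip /=; apply/andP; split; lra.
  (* [L1] and [L2] add up to - laplacian v c >= K > C, against [hC]. *)
  have := hC c ic; rewrite laplacianE Ec; move: L1 L2; lra.
have := le_trans (cmax x sx) wc; rewrite subr_le0 => /le_trans; apply.
have x2 : 0 <= (pi ^+ 2 - x.2 ^+ 2) / 2 <= pi ^+ 2 / 2.
  have : x.2 ^+ 2 <= pi ^+ 2.
    rewrite -[x.2 ^+ 2]real_normK ?num_real// ler_pXn2r ?nnegrE ?pi_ge0//.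
    by rewrite ler_norml; exact: sx.
  by have := sqr_ge0 x.2 => ? ?; apply/andP; split; lra.
rewrite /K mulrDl lerD2l; case/andP: x2 => q1 q2.
rewrite mulrAC ler_pdivrMr// ler_wpM2l// ltW//.
Qed.

Lemma max_principle_abs v B : Cn 2 v -> periodic v (2 * pi, 0) -> vanish v ->
  (forall x, strip_interior x -> `|laplacian v x| <= B) ->
  forall x, strip x -> `|v x| <= B * ((pi ^+ 2 - x.2 ^+ 2) / 2).
Proof.
move=> Cv pv vv hB x sx; rewrite ler_norml; apply/andP; split; last first.
  apply: (max_principle Cv pv vv _ sx) => z iz; have := hB z iz; rewrite ler_norml => /andP[]; lra.
have COv := Cn_opp Cv.
rewrite lerNl; apply: (max_principle COv); last exact: sx.
- by move=> z; rewrite pv.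
- by move=> z; have [-> ->] := vv z; rewrite oppr0.
- move=> z iz; have /andP[h1 h2] : - B <= laplacian v z <= B by rewrite -ler_norml; exact: hB.
  have Cv1 := Cn_partial1 Cv; have Cv2 := Cn_partial2 Cv.
  rewrite laplacianE.
  have -> : dx1 (fun x => - v x) = fun x => - dx1 v x.
    by apply/funext => y; rewrite (partial1_opp (Cn_diff y Cv)).
  have -> : dx2 (fun x => - v x) = fun x => - dx2 v x.
    by apply/funext => y; rewrite (partial2_opp (Cn_diff y Cv)).
  rewrite (partial1_opp (Cn_diff z Cv1)) (partial2_opp (Cn_diff z Cv2)).
  by move: h1 h2; rewrite laplacianE; lra.
Qed.

Lemma near_interior x : strip_interior x -> \forall z \near x, strip_interior z.
Proof.
move=> /andP[x1 x2].
have H1 := @cvgr_gt R (R * R)%type (nbhs x) _ snd x.2 (@cvg_snd _ _ _ _ _) (- pi) x1.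
have H2 := @cvgr_lt R (R * R)%type (nbhs x) _ snd x.2 (@cvg_snd _ _ _ _ _) pi x2.
near=> z; apply/andP; split; near: z; [exact: H1|exact: H2].
Unshelve. all: by end_near. Qed.

Lemma eq_dx1 f g x : (forall z, strip_interior z -> f z = g z) -> strip_interior x ->
  dx1 f x = dx1 g x.
Proof.
move=> fg ix; rewrite dx1E; apply: near_eq_derive.
have H := near_interior ix; near=> z; apply: fg; near: z; exact: H.
Unshelve. all: by end_near. Qed.

Lemma eq_dx2 f g x : (forall z, strip_interior z -> f z = g z) -> strip_interior x ->
  dx2 f x = dx2 g x.
Proof.
move=> fg ix; rewrite dx2E; apply: near_eq_derive.
have H := near_interior ix; near=> z; apply: fg; near: z; exact: H.
Unshelve. all: by end_near. Qed.

Definition poisson P f := [/\ forall n, Cn n P, forall n, Cn n f, periodic P (2 * pi, 0), vanish P &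
  forall x, strip_interior x -> - laplacian P x = f x].

Lemma vanish_dx1 P : Cn 1 P -> vanish P -> vanish (dx1 P).
Proof.
move=> CP vP x.
have D y r := is_derive_x (Cn_diff (r, y) CP).
split.
  have [_ <-] := D (- pi) x; rewrite (_ : (fun r => _) = fun=> 0); first exact: derive_cst.
  by apply/funext => r; rewrite (vP r).1.
have [_ <-] := D pi x; rewrite (_ : (fun r => _) = fun=> 0); first exact: derive_cst.
by apply/funext => r; rewrite (vP r).2.
Qed.

(** The tangential derivative commutes with the laplacian and preserves the Dirichlet condition, so
    the maximum principle also bounds x1-derivatives of [P]. *)
Lemma poisson_dx1 P f : poisson P f -> poisson (dx1 P) (dx1 f).
Proof.
move=> [CP Cf pP vP eq]; split.
- by move=> n; exact: Cn_partial1.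
- by move=> n; exact: Cn_partial1.
- exact: (periodic_partial1 (fun y => Cn_diff y (CP 1%N)) pP).
- exact: vanish_dx1 (CP 1%N) vP.
- move=> x ix; rewrite -(eq_dx1 (f := fun z => - laplacian P z) eq ix).
  have CL : Cn 1 (laplacian P) := Cn_lap (CP 3%N).
  rewrite (partial1_opp (Cn_diff x CL)); congr (- _).
  rewrite laplacianE.
  have -> : laplacian P = fun z => dx1 (dx1 P) z + dx2 (dx2 P) z.
    by apply/funext => z; rewrite laplacianE.
  have C1 : Cn 1 (dx1 (dx1 P)) := Cn_partial1 (Cn_partial1 (CP 3%N)).
  have C2 : Cn 1 (dx2 (dx2 P)) := Cn_partial2 (Cn_partial2 (CP 3%N)).
  rewrite (partial1_add (Cn_diff x C1) (Cn_diff x C2)); congr (_ + _).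
  by rewrite (partial_swap (Cn_partial2 (CP 3%N))) (partial_swap (CP 2%N)).
Qed.

Lemma poisson_bound P f B : poisson P f -> (forall x, strip x -> `|f x| <= B) ->
  forall x, strip x -> `|P x| <= B * ((pi ^+ 2 - x.2 ^+ 2) / 2).
Proof.
move=> [CP Cf pP vP eq] hB; apply: (max_principle_abs (CP 2%N) pP vP) => x ix.
by rewrite -normrN eq//; apply: hB; case/andP: ix => h1 h2; apply/andP; split; exact: ltW.
Qed.

Lemma interior_strip x : strip_interior x -> strip x.
Proof. by case/andP => h1 h2; apply/andP; split; exact: ltW. Qed.

(** The maximum principle bounds d1 P and d1 d1 P, and the equation then bounds d2 d2 P by B + B
    pi^2/2. On each vertical segment [P] vanishes at both ends, so d2 P has a zero (Rolle) and is at
    most the length 2 pi times that bound. *)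
Lemma velocity_bound P f B : poisson P f ->
  (forall x, strip x -> [/\ `|f x| <= B, `|dx1 f x| <= B & `|dx1 (dx1 f) x| <= B]) ->
  forall x, strip x -> `|dx1 P x| <= B * ((pi ^+ 2 - x.2 ^+ 2) / 2) /\ `|dx2 P x| <= 2 * pi * (B + B * (pi ^+ 2 / 2)).
Proof.
move=> hP hB x sx; have pp := @pi_gt0 R.
have B0 : 0 <= B by have [h _ _] := hB x sx; exact: (le_trans (normr_ge0 _) h).
have hP1 := poisson_dx1 hP; have hP2 := poisson_dx1 hP1.
split; first by apply: (poisson_bound hP1) => // z /hB[].
have [CP Cf pP vP eq] := hP.
have b11 z : strip z -> `|dx1 (dx1 P) z| <= B * (pi ^+ 2 / 2).
  move=> sz; have := poisson_bound hP2 (fun z sz => let: And3 _ _ h := hB z sz in h) sz.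
  move=> /le_trans; apply; rewrite ler_wpM2l// ler_wpM2r// ?invr_ge0//.
  by rewrite gerDl oppr_le0 sqr_ge0.
have b22 z : strip_interior z -> `|dx2 (dx2 P) z| <= B + B * (pi ^+ 2 / 2).
  move=> iz; have sz := interior_strip iz.
  have -> : dx2 (dx2 P) z = - f z - dx1 (dx1 P) z by rewrite -(eq z iz) laplacianE opprK; ring.
  apply: le_trans (ler_normB _ _) _; rewrite normrN lerD ?b11//; by have [] := hB z sz.
have D2 r : is_derive r (1 : R) (fun r => P (x.1, r)) (dx2 P (x.1, r)).
  by apply: is_derive_y; exact: Cn_diff (CP 1%N).
have D22 r : is_derive r (1 : R) (fun r => dx2 P (x.1, r)) (dx2 (dx2 P) (x.1, r)).
  by apply: is_derive_y; exact: Cn_diff (Cn_partial2 (CP 2%N)).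
have npp : - pi < pi :> R by lra.
have [xi /andP[xi1 xi2]] := mvt_derive D2 npp.
rewrite (vP x.1).1 (vP x.1).2 subrr => /esym/eqP; rewrite mulf_eq0 => /orP[/eqP xi0|]; last first.
  by rewrite opprK -mulr2n mulrn_eq0 /= gt_eqF.
have Ex : x = (x.1, x.2) by case: (x).
case/andP: (sx) => x1 x2; have C0 : 0 <= B + B * (pi ^+ 2 / 2).
  by rewrite addr_ge0// mulr_ge0// divr_ge0// sqr_ge0.
have step (a b : R) : - pi <= a -> b <= pi -> a < b -> `|dx2 P (x.1, b) - dx2 P (x.1, a)| <= 2 * pi * (B + B * (pi ^+ 2 / 2)).
  move=> ha hb ab; have [e /andP[e1 e2] ->] := mvt_derive D22 ab.
  rewrite normrM mulrC (@ler_pM _ `|b - a|)//.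
    by rewrite gtr0_norm ?subr_gt0//; lra.
  by apply: b22; apply/andP; split => /=; lra.
rewrite Ex; have [h|h|<-] := ltgtP xi x.2.
- by have := step xi x.2 (ltW xi1) x2 h; rewrite xi0 subr0.
- by have := step x.2 xi x1 (ltW xi2) h; rewrite xi0 sub0r normrN.
- by rewrite xi0 normr0 mulr_ge0// mulr_ge0// ltW.
Qed.

End MaximumPrinciple.

(** * Backward Euler characteristics *)

Section Euler.
Context {R : realType}.
Local Notation ST := (R * (R * R))%type.
(** [F] is the extended density with its time and space derivatives, [U] the velocity. [U t] is only
    continuous in x for each t, with bounds uniform in t and no regularity in time: Euler polygons
    are enough, and no differential equation is solved. *)
Variables (F Ft F1 F2 : ST -> R) (U : R -> R * R -> R * R) (T C : R).
Hypothesis cF : continuous F.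
Hypothesis cFt : continuous Ft.
Hypothesis cF1 : continuous F1.
Hypothesis cF2 : continuous F2.
Hypothesis dF : forall (z v : ST) (r : R), is_derive r (1 : R) (fun r => F (z + r *: v))
  (v.1 * Ft (z + r *: v) + v.2.1 * F1 (z + r *: v) + v.2.2 * F2 (z + r *: v)).
Hypothesis pF : periodic F (0, (2 * pi, 0)).
Hypothesis pFt : periodic Ft (0, (2 * pi, 0)).
Hypothesis pF1 : periodic F1 (0, (2 * pi, 0)).
Hypothesis pF2 : periodic F2 (0, (2 * pi, 0)).
Hypothesis C0 : 0 <= C.
Hypothesis cU : forall t, 0 < t -> continuous (U t).
Hypothesis pU : forall t, 0 < t -> periodic (U t) (2 * pi, 0).
Hypothesis U1_le : forall t x, 0 < t <= T -> strip x -> `|(U t x).1| <= C.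
Hypothesis U2_le : forall t x, 0 < t <= T -> strip x ->
  `|(U t x).2| <= C * ((pi ^+ 2 - x.2 ^+ 2) / 2).
Hypothesis transport : forall t x, 0 < t <= T -> strip x ->
  Ft (t, x) + ((U t x).1 * F1 (t, x) + (U t x).2 * F2 (t, x)) = 0.
Hypothesis T0 : 0 < T.

Lemma spacetime_int (G : ST -> R) (t x y : R) (k : int) : periodic G (0, (2 * pi, 0)) ->
  G (t, (x + (2 * pi) *~ k, y)) = G (t, (x, y)).
Proof.
move=> pG; rewrite (@periodic_int _ _ (fun r : R => G (t, (r, y))) (2 * pi))//.
by move=> u; rewrite -[RHS]pG; congr G; congr (_, (_, _)); rewrite /= addr0.
Qed.

(** Uniform continuity on the compact product of [0, T] and the closed cell, spread along the strip
    by periodicity. The displaced point may leave the strip, since [G] lives on the whole space. *)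
Lemma near_modulus (G : ST -> R) (e : R) : continuous G -> periodic G (0, (2 * pi, 0)) -> 0 < e ->
  exists2 d, 0 < d & forall t x (h : ST), 0 <= t <= T -> strip x -> `|h| < d ->
    `|G ((t, x) + h) - G (t, x)| < e.
Proof.
move=> cG pG e0.
have cs : continuous (fun p : ST * ST => p.2 + p.1).
  by move=> p; apply: cvgD; [exact: cvg_snd|exact: cvg_fst].
have cH : continuous (fun p : ST * ST => G (p.2 + p.1)).
  by move=> p; exact: (cvg_comp _ _ (cs p) (@cG (p.2 + p.1))).
pose K : set ST := `[0, T] `*` clcell.
have cK : compact K by apply: compact_setX; [exact: segment_compact|exact: (@compact_clcell R)].
have /nbhs_normP[d /= d0 dE] := near_compact_dist (0 : ST) cK cH e0.
exists d => // t [x y] h ht sx hd.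
have [k hk] := angle_reduce x.
have Kz : K (t, (x + (2 * pi) *~ k, y)).
  split; rewrite /= ?in_itv//=; split; rewrite /= in_itv /=; last exact: sx.
  by rewrite -ler_norml.
have /dE/(_ _ Kz)/= : ball_ Num.norm (0 : ST) d h by rewrite /ball_ /= sub0r normrN.
rewrite addr0 distrC spacetime_int//.
case: h {hd} => h1 [h2 h3].
have -> : (t, (x + (2 * pi) *~ k, y)) + (h1, (h2, h3)) = (t + h1, (x + h2 + (2 * pi) *~ k, y + h3)) :> ST.
  by congr (_, (_, _)); rewrite /= addrAC.
by rewrite spacetime_int.
Qed.

Lemma strip_sqr (x : R * R) : strip x -> 0 <= pi ^+ 2 - x.2 ^+ 2.
Proof.
move=> sx; rewrite subr_ge0 -[x.2 ^+ 2]real_normK ?num_real// ler_pXn2r ?nnegrE ?pi_ge0//.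
by rewrite ler_norml; exact: sx.
Qed.

(** The mean value theorem along the backward step expresses the change of [F] by derivatives at an
    intermediate point. Moving them to (t, x), where the transport equation cancels them, costs an
    arbitrarily small multiple of [tau], uniformly in t and x. *)
Lemma euler_step (e : R) : 0 < e -> exists2 d, 0 < d & forall tau t x, 0 < tau < d -> 0 < t <= T -> strip x ->
  `|F (t - tau, x - tau *: U t x) - F (t, x)| <= tau * e.
Proof.
move=> e0; have pp := @pi_gt0 R.
(* [C'] bounds both components of the velocity, because (pi^2 - x2^2)/2 <= pi^2/2. *)
pose C' := C * (1 + pi ^+ 2 / 2).
have C'0 : 0 <= C' by rewrite mulr_ge0// addr_ge0// divr_ge0// sqr_ge0.
have CC' : C <= C' by rewrite /C' mulrDr mulr1 lerDl mulr_ge0// divr_ge0// sqr_ge0.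
(* The three derivatives enter with factors at most 1, C' and C', hence the division by 1 + 2 C'. *)
pose e1 := e / (1 + 2 * C'); have e10 : 0 < e1 by rewrite divr_gt0// ltr_pwDl// mulr_ge0.
have [d1 d10 h1] := near_modulus cFt pFt e10.
have [d2 d20 h2] := near_modulus cF1 pF1 e10.
have [d3 d30 h3] := near_modulus cF2 pF2 e10.
pose d := Num.min d1 (Num.min d2 d3).
have d0 : 0 < d by rewrite !lt_min d10 d20.
exists (d / (1 + C')); first by rewrite divr_gt0// ltr_pwDl.
move=> tau t x /andP[tau0 taud] ht sx.
have tT : 0 <= t <= T by case/andP: ht => /ltW -> ->.
pose v : ST := (-1, - U t x).
have D := dF (t, x) v.
have [xi /andP[xi0 xi1] E] := mvt_derive D tau0.
have -> : (t - tau, x - tau *: U t x) = (t, x) + tau *: v.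
  congr (_, _); last by rewrite /= scalerN.
  by rewrite /= /GRing.scale /= mulrN1.
rewrite scale0r addr0 subr0 in E.
rewrite E normrM (gtr0_norm tau0) mulrC ler_pM2l//.
have hU1 := U1_le ht sx; have hU2 : `|(U t x).2| <= C'.
  apply: (le_trans (U2_le ht sx)); rewrite ler_wpM2l//.
  have := sqr_ge0 x.2; lra.
have nv : `|v| <= 1 + C'.
  rewrite prod_normE /= normrN normr1 normrN prod_normE /=.
  rewrite ge_max lerDl C'0/= ge_max; apply/andP; split.
    by apply: (le_trans hU1); rewrite (le_trans CC')// lerDr.
  by apply: (le_trans hU2); rewrite lerDr.
have nh : `|xi *: v| < d.
  rewrite normrZ (gtr0_norm xi0).
  apply: (@le_lt_trans _ _ (xi * (1 + C'))); first by rewrite ler_wpM2l ?(ltW xi0).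
  rewrite -ltr_pdivlMr ?ltr_pwDl//; exact: lt_trans xi1 taud.
have nd : d <= d1 /\ d <= d2 /\ d <= d3 by rewrite /d !ge_min !lexx !orbT.
have k1 := h1 t x _ tT sx (lt_le_trans nh nd.1).
have k2 := h2 t x _ tT sx (lt_le_trans nh nd.2.1).
have k3 := h3 t x _ tT sx (lt_le_trans nh nd.2.2).
have tr := transport ht sx.
move: k1 k2 k3 tr hU1 hU2; rewrite /v /=.
move: (Ft (_ + _)) (F1 (_ + _)) (F2 (_ + _)) (Ft (t, x)) (F1 (t, x)) (F2 (t, x)) => a b c a' b' c'.
move: (U t x).1 (U t x).2 => p q k1 k2 k3 tr hp hq.
(* Subtracting the transport equation at (t, x) leaves only increments of the derivatives. *)
have -> : -1 * a + - p * b + - q * c = - (a - a') - p * (b - b') - q * (c - c').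
  have -> : a' = - (p * b' + q * c') by apply/eqP; rewrite -addr_eq0 tr.
  by ring.
apply: le_trans (ler_normB _ _) _.
have E1 : e = e1 + C' * e1 + C' * e1.
  rewrite /e1; have : 1 + 2 * C' != 0 by rewrite gt_eqF// ltr_pwDl// mulr_ge0.
  by move: C' {CC' nv nh hq taud e1 e10 h1 h2 h3 k1 k2 k3 C'0} => c0 hc; field.
rewrite E1 lerD//.
  apply: le_trans (ler_normB _ _) _; rewrite normrN lerD// ?(ltW k1)//.
  by rewrite normrM ler_pM// ?(ltW k2)// (le_trans hp).
by rewrite normrM ler_pM// ltW.
Qed.

(** [Psi] is the composition of j backward steps. Continuity and commutation with the 2 pi
    translation record that the image of a horizontal circle still winds once around the strip. *)
Lemma euler_chain (e : R) n : 0 < e -> (0 < n)%N ->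
  (forall t x, 0 < t <= T -> strip x ->
    `|F (t - T / n%:R, x - (T / n%:R) *: U t x) - F (t, x)| <= T / n%:R * e) ->
  T / n%:R * (C * pi) <= 1 ->
  forall j, (j <= n)%N -> exists Psi : R * R -> R * R,
   [/\ continuous Psi, forall x, Psi (x + (2 * pi, 0)) = Psi x + (2 * pi, 0),
      forall x, strip x -> strip (Psi x) &
      forall x, strip x -> `|F (T / n%:R * (n - j)%:R, Psi x) - F (T, x)| <= j%:R * (T / n%:R * e)].
Proof.
move=> e0 n0 hstep hC; set tau := T / n%:R.
have nR : (0 : R) < n%:R by rewrite ltr0n.
have tau0 : 0 < tau by rewrite divr_gt0.
elim=> [|j IH] jn.
  exists id; split=> //; first by move=> x; exact: cvg_id.
  by move=> x sx; rewrite subn0 /tau divfK ?gt_eqF// subrr normr0 mul0r.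
have [Psi [c1 c2 c3 c4]] := IH (ltnW jn).
pose t := tau * (n - j)%:R.
have t0 : 0 < t by rewrite mulr_gt0// ltr0n subn_gt0.
have tT : 0 < t <= T.
  rewrite t0 /t /tau mulrAC ler_pdivrMr// ler_wpM2l ?(ltW T0)// ler_nat leq_subr//.
exists (fun x => Psi x - tau *: U t (Psi x)); split.
- have cUP : continuous (fun x => U t (Psi x)).
    by move=> x; exact: (cvg_comp _ _ (c1 x) (cU t0 (x := Psi x))).
  by move=> x; apply: cvgB; [exact: c1|apply: cvgZr; exact: cUP].
- by move=> x; rewrite c2 (pU t0) addrAC.
- move=> x sx; have sP := c3 x sx; have hU := U2_le tT sP.
  have pp := @pi_gt0 R; have q0 := strip_sqr sP.
  case/andP: (sP) => p1 p2.
  (* As (pi^2 - x2^2)/2 <= pi (pi - |x2|) and tau C pi <= 1, a step moves x2 by no more than its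
     distance to the boundary. *)
  have h : `|tau * (U t (Psi x)).2| <= pi - `|(Psi x).2|.
    rewrite normrM (gtr0_norm tau0).
    apply: (@le_trans _ _ (tau * (C * ((pi ^+ 2 - (Psi x).2 ^+ 2) / 2)))); first by rewrite ler_wpM2l ?(ltW tau0).
    have an : `|(Psi x).2| <= pi by rewrite ler_norml p1 p2.
    have -> : pi ^+ 2 - (Psi x).2 ^+ 2 = (pi - `|(Psi x).2|) * (pi + `|(Psi x).2|).
      by rewrite -[(Psi x).2 ^+ 2]real_normK ?num_real//; ring.
    apply: (@le_trans _ _ ((tau * (C * pi)) * (pi - `|(Psi x).2|))).
      rewrite -subr_ge0 (_ : _ - _ = tau * C * (pi - `|(Psi x).2|) ^+ 2 / 2).
        by rewrite divr_ge0// mulr_ge0 ?sqr_ge0// mulr_ge0// ltW.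
      by move: (pi : R) (`|_|) => p a; field.
    by rewrite ler_piMl ?subr_ge0.
  rewrite ler_norml in h; case/andP: h => h1 h2.
  have a1 : `|(Psi x).2| >= (Psi x).2 := ler_norm _.
  have a2 : `|(Psi x).2| >= - (Psi x).2 by rewrite -normrN ler_norm.
  by rewrite /strip /= /GRing.scale /=; apply/andP; split; lra.
- move=> x sx; have := hstep t (Psi x) tT (c3 x sx); have := c4 x sx.
  have -> : t - T / n%:R = tau * (n - j.+1)%:R.
    have e1 : (n - j.+1)%:R = (n - j)%:R - 1 :> R by rewrite subnS -subn1 natrB// subn_gt0.
    by rewrite e1 mulrBr mulr1.
  rewrite -/tau -/t => k1 k2.
  have -> : j.+1%:R * (tau * e) = j%:R * (tau * e) + tau * e by rewrite -addn1 natrD mulrDl mul1r.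
  by rewrite [leRHS]addrC; apply: le_trans (lerD k2 k1); exact: ler_distD.
Qed.

(** If [F] exceeded [M] on the whole circle at time T, the image of the circle at time 0, which
    winds once, would by the intermediate value theorem meet {x1 = pi}; the density there is at most
    M, yet almost equal to a value at time T. *)
Lemma circle_trapped (M : R) : (forall y, - pi <= y <= pi -> F (0, (pi, y)) <= M) ->
  forall c, - pi <= c <= pi -> exists x, F (T, (x, c)) <= M.
Proof.
move=> hM c hc; apply: contrapT => /forallNP noex.
have pp := @pi_gt0 R.
have cline : continuous (fun r : R => (r, c)).
  by move=> r; apply: continuous_pairf; [exact: cvg_id|exact: cst_continuous].
have cFc : continuous (fun r : R => F (T, (r, c))).
  move=> r; have c0 : {for r, continuous (fun r : R => (T, (r, c)))}.
    by apply: continuous_pairf; [exact: cst_continuous|exact: cline].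
  exact: (cvg_comp _ _ c0 (@cF (T, (r, c)))).
(* The minimum over the circle turns the pointwise strict inequality into a uniform gap above
   [M]. *)
have [|a _ amin] := @EVT_min R (fun r => F (T, (r, c))) (- pi) pi _ (continuous_subspaceT cFc).
  by lra.
have low r : F (T, (a, c)) <= F (T, (r, c)).
  have [k hk] := angle_reduce r; rewrite -(spacetime_int T r c k pF).
  by apply: amin; rewrite in_itv /= -ler_norml.
have Ma : M < F (T, (a, c)) by rewrite ltNge; apply/negP; exact: noex.
(* Over total time T the accumulated error T e is half of the gap. *)
pose e := (F (T, (a, c)) - M) / (2 * T).
have e0 : 0 < e by rewrite divr_gt0 ?subr_gt0 ?mulr_gt0.
have [d d0 hd] := euler_step e0.
(* Enough steps for T/n to be below the threshold [d] and for T C pi / n <= 1, which keeps the chain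
   in the strip. *)
pose n := (Num.bound (T / d) + Num.bound (T * (C * pi))).+1.
have nR : (0 : R) < n%:R by rewrite ltr0n.
have b1 : T / d < n%:R.
  apply: (lt_le_trans (archi_boundP (divr_ge0 (ltW T0) (ltW d0)))).
  by rewrite ler_nat /n -addnS leq_addr.
have b2 : T * (C * pi) < n%:R.
  apply: (lt_le_trans (archi_boundP (mulr_ge0 (ltW T0) (mulr_ge0 C0 (ltW pp))))).
  by rewrite ler_nat /n -addSn leq_addl.
have [] := euler_chain (n := n) e0 _ _ _ (leqnn n) => //.
- move=> t x ht sx; apply: hd => //; rewrite divr_gt0//=.
  by rewrite ltr_pdivrMr// mulrC -ltr_pdivrMr.
- by rewrite mulrAC ler_pdivrMr// mul1r ltW.
move=> Psi [c1 c2 c3 c4].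
pose phi (s : R) := (Psi (s, c)).1.
have cphi : continuous phi.
  move=> s; have cP : {for s, continuous (fun s : R => Psi (s, c))}.
    exact: (cvg_comp _ _ (cline s) (c1 (s, c))).
  exact: (cvg_comp _ _ cP (@cvg_fst _ _ _ _ _)).
have phi2 : phi (2 * pi) = phi 0 + 2 * pi.
  rewrite /phi (_ : (2 * pi, c) = (0, c) + (2 * pi, 0)) ?c2//.
  by congr (_, _); rewrite /= ?add0r ?addr0.
(* The lift [phi] increases by exactly 2 pi, so its range contains the representative pi - 2 pi k of
   the angle pi. *)
have [k hk] := angle_reduce (phi 0).
rewrite ler_norml in hk; case/andP: hk => k1 k2.
have [||s _ hs] := @IVT R phi 0 (2 * pi) (pi - (2 * pi) *~ k) _ (continuous_subspaceT cphi).
- by rewrite mulr_ge0// ltW.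
- rewrite phi2 min_l ?max_r; by lra.
have sc : strip (s, c) by [].
have := c4 _ sc; rewrite subnn mulr0.
have -> : Psi (s, c) = (pi + (2 * pi) *~ (- k), (Psi (s, c)).2).
  by rewrite mulrNz -hs /phi; case: (Psi (s, c)).
rewrite spacetime_int//.
have := hM _ (c3 _ sc).
have := low s.
have -> : n%:R * (T / n%:R * e) = (F (T, (a, c)) - M) / 2.
  by rewrite /e; field; rewrite !gt_eqF.
move: (F (0, _)) (F (T, (a, c))) (F (T, (s, c))) Ma => A B D Ma.
by rewrite ler_norml => h1 h2 /andP[h3 h4]; lra.
Qed.

End Euler.

(** * Transport, conserved quantities and dissipation *)

Section Spacetime.
Context {R : realType}.
Local Notation ST := (R * (R * R))%type.
Implicit Types (G : ST -> R).

Lemma derive_sealed : {D : ST -> (ST -> R) -> ST -> R | forall v G, D v G = 'D_v G}.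
Proof. by exists (fun v G => 'D_v G). Qed.

Definition dst : ST -> (ST -> R) -> ST -> R := sval derive_sealed.
Lemma dstE v G : dst v G = 'D_v G. Proof. exact: (svalP derive_sealed). Qed.

Definition et : ST := (1, (0, 0)).
Definition e1 : ST := (0, (1, 0)).
Definition e2 : ST := (0, (0, 1)).

Definition slice G (t : R) : R * R -> R := fun x => G (t, x).

Lemma is_diff_slice (t : R) (x : R * R) : is_diff x (fun x : R * R => (t, x)) (fun v => (0, v)).
Proof.
have d1 : is_diff x (cst t : R * R -> R) 0 := is_diff_cst t x.
have d2 : is_diff x (id : R * R -> R * R) id := is_diff_id x.
exact: (is_diff_pair d1 d2).
Qed.

Lemma Cn_slice n G t : Cn n G -> Cn n (slice G t).
Proof. by apply: Cn_comp => x; exact: is_diff_slice. Qed.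

Lemma Cn_dst n v G : Cn n.+1 G -> Cn n (dst v G).
Proof. by rewrite dstE; exact: Cn_D. Qed.

Lemma slice_dx1 G t x : Cn 1 G -> dx1 (slice G t) x = dst e1 G (t, x).
Proof.
move=> CG; rewrite dx1E dstE /partial1.
have D := @comp_derive R _ _ G (fun y : R * R => (t, y)) (fun v => (0, v)) x ((1, 0) : R * R) (is_diff_slice t x) (Cn_diff (t, x) CG).
exact: D.
Qed.

Lemma slice_dx2 G t x : Cn 1 G -> dx2 (slice G t) x = dst e2 G (t, x).
Proof.
move=> CG; rewrite dx2E dstE /partial2.
have D := @comp_derive R _ _ G (fun y : R * R => (t, y)) (fun v => (0, v)) x ((0, 1) : R * R) (is_diff_slice t x) (Cn_diff (t, x) CG).
exact: D.
Qed.

Lemma is_derive_time G t x : Cn 1 G -> is_derive t (1 : R) (fun t => G (t, x)) (dst et G (t, x)).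
Proof.
move=> CG; rewrite dstE.
have E r : ((0, x) : ST) + r *: et = (r, x).
  case: x => x y; rewrite /et.
  by congr (_, (_, _)); rewrite /= /GRing.scale /= ?mulr1 ?mulr0 ?add0r ?addr0.
have -> : (fun t => G (t, x)) = (fun r => G (((0, x) : ST) + r *: et)).
  by apply/funext => r; rewrite E.
by have := @is_derive_line _ _ G (0, x) et t; rewrite E; apply; exact: Cn_diff CG.
Qed.

Lemma is_derive_spacetime G (z v : ST) (r : R) : Cn 1 G ->
  is_derive r (1 : R) (fun r => G (z + r *: v))
  (v.1 * dst et G (z + r *: v) + v.2.1 * dst e1 G (z + r *: v) + v.2.2 * dst e2 G (z + r *: v)).
Proof.
move=> CG; have dG := Cn_diff (z + r *: v) CG.
have D := is_derive_line dG; apply: (is_derive_eq D); rewrite !dstE.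
have Ev : v = v.1 *: et + (v.2.1 *: e1 + v.2.2 *: e2).
  case: v {D dG} => a [b c]; rewrite /et /e1 /e2.
  by congr (_, (_, _)); rewrite /= /GRing.scale /= ?mulr1 ?mulr0 ?add0r ?addr0.
move: dG; move: (z + r *: v) => w dG.
by rewrite [in LHS]Ev (deriveDl _ _ dG) (deriveDl _ _ dG) !(deriveZl _ _ dG) addrA.
Qed.

Lemma periodic_dst G v (a : ST) : Cn 1 G -> periodic G a -> periodic (dst v G) a.
Proof. by move=> CG; rewrite dstE; apply: periodic_derive => x; exact: Cn_diff CG. Qed.

Lemma continuous_slice G t : continuous G -> continuous (slice G t).
Proof. by move=> cG; exact: (@Cn_slice 0 G t cG). Qed.

(** Differentiation under the integral, dominated by the maximum of |Gt| over [t - 1, t + 1] times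
    the closed cell. *)
Lemma is_derive_cint (G Gt : ST -> R) (t : R) : continuous G -> continuous Gt ->
  (forall t x, is_derive t (1 : R) (fun t => G (t, x)) (Gt (t, x))) ->
  is_derive t (1 : R) (fun t => cint (slice G t)) (cint (slice Gt t)).
Proof.
move=> cG cGt dG.
pose K : set ST := `[t - 1, t + 1] `*` clcell.
have cK : compact K by apply: compact_setX; [exact: segment_compact|exact: (@compact_clcell R)].
have [||c _ cmax] := @compact_EVT_max _ R (fun z => `|Gt z|) K _ cK.
- exists (t, (0, 0)); split => /=; first by rewrite in_itv/=; apply/andP; split; lra.
  by split; rewrite /= in_itv /= oppr_le0 pi_ge0.
- by apply: continuous_subspaceT; exact: cont_norm.
have ti : [set` `]t - 1, t + 1[] t by rewrite /= in_itv/=; apply/andP; split; lra.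
have E y s : partial1of2 (fun s x => G (s, x)) s y = Gt (s, y).
  by rewrite partial1of2E; have [_ ->] := dG s y.
have A1 (s : R) : [set` `]t - 1, t + 1[] s ->
    (@lebesgue_measure R \x @lebesgue_measure R)%E.-integrable cell (EFin \o (fun x => G (s, x))).
  by move=> _; apply: cell_integrable; exact: continuous_slice.
have A2 (s : R) (y : R * R) : [set` `]t - 1, t + 1[] s -> cell y -> derivable (fun s => G (s, y)) s 1.
  by move=> _ _; have [] := dG s y.
have A3 : (@lebesgue_measure R \x @lebesgue_measure R)%E.-integrable cell (EFin \o (fun _ : R * R => `|Gt c|)).
  by apply: cell_integrable; exact: cont_cst.
have A4 (s : R) (y : R * R) : [set` `]t - 1, t + 1[] s -> cell y ->
    `|partial1of2 (fun s x => G (s, x)) s y| <= `|Gt c|.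
  move=> hs /cell_clcell hy; rewrite E; apply: cmax; rewrite inE; split => //=.
  by move: hs; rewrite /= !in_itv /= => /andP[h1 h2]; rewrite !ltW.
have D1 := @derivable_under_integral R _ _ (@lebesgue_measure R \x @lebesgue_measure R)%E
  (fun s x => G (s, x)) cell (@measurable_cell R) t (t - 1) (t + 1) ti A1 A2 (fun=> `|Gt c|)
  (fun _ => normr_ge0 _) A3 A4.
have D2 := @differentiation_under_integral R _ _ (@lebesgue_measure R \x @lebesgue_measure R)%E
  (fun s x => G (s, x)) cell (@measurable_cell R) t (t - 1) (t + 1) ti A1 A2 (fun=> `|Gt c|)
  (fun _ => normr_ge0 _) A3 A4.
apply: DeriveDef; first exact: D1.
rewrite -derive1E; apply: etrans D2 _.
by apply: eq_Rintegral => x _; rewrite E.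
Qed.

(** Multiplying x2 by r < 1 moves any point of the strip into the interior; let r tend to 1. *)
Lemma eq_on_strip (f g : R * R -> R) : continuous f -> continuous g ->
  (forall x, strip_interior x -> f x = g x) -> forall x, strip x -> f x = g x.
Proof.
move=> cf cg fg x sx; apply/eqP; rewrite -subr_eq0; apply: contraT => ne.
have pp := @pi_gt0 R.
have cd : continuous (fun r : R => f (x.1, r * x.2) - g (x.1, r * x.2)).
  have cm : continuous (fun r : R => r * x.2).
    by apply: (cont_mul (f := id) (g := fun=> x.2)); [move=> s; exact: cvg_id|exact: cont_cst].
  have cr r : {for r, continuous (fun r : R => (x.1, r * x.2))}.
    by apply: continuous_pairf; [exact: cst_continuous|exact: cm].
  by apply: cont_sub => r; [exact: (cvg_comp _ _ (cr r) (@cf (x.1, r * x.2)))|exact: (cvg_comp _ _ (cr r) (@cg (x.1, r * x.2)))].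
have n0 : 0 < `|f x - g x| by rewrite normr_gt0.
have /cvgrPdist_lt/(_ _ n0) /nbhs_normP[d /= d0 dE] := cd 1.
pose r := 1 - Num.min (d / 2) (1 / 2).
have m0 : 0 < Num.min (d / 2) (1 / 2) by rewrite lt_min !divr_gt0.
have m1 : Num.min (d / 2) (1 / 2) <= d / 2 by rewrite ge_min lexx.
have m2 : Num.min (d / 2) (1 / 2) <= 1 / 2 by rewrite ge_min lexx orbT.
have /dE : ball_ Num.norm 1 d r.
  by rewrite /ball_ /= /r opprB addrCA subrr addr0 gtr0_norm//; lra.
rewrite /= !mul1r; have -> : (x.1, x.2) = x by case: (x).
rewrite (fg (x.1, r * x.2)) ?subrr ?subr0 ?ltxx//.
rewrite /strip_interior /= -ltr_norml normrM.
have xn : `|x.2| <= pi by rewrite ler_norml; exact: sx.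
apply: (@le_lt_trans _ _ (`|r| * pi)); first by rewrite ler_wpM2l.
by rewrite -[ltRHS]mul1r ltr_pM2r// /r ger0_norm; lra.
Qed.

End Spacetime.

Section Transport.
Context {R : realType}.
Local Notation ST := (R * (R * R))%type.
Implicit Types (F : ST -> R) (P : R -> R * R -> R).

(* Smooth extensions F of rho and P t of psi t to the whole plane. *)
Definition ipm_ext F P := [/\ forall n, Cn n F, periodic F (0, (2 * pi, 0)),
  forall t, 0 <= t -> poisson (P t) (dx1 (slice F t)) &
  forall t x, 0 < t -> strip x ->
    dst et F (t, x) = dx2 (P t) x * dx1 (slice F t) x - dx1 (P t) x * dx2 (slice F t) x].

(* u . grad (h rho) integrated against phi(x2) only sees the derivative of phi,
   since u = (- d2 P, d1 P) is divergence free and tangent to the boundary. *)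
Lemma transport_moment (P H : R * R -> R) (phi dphi : R -> R) :
  (forall n, Cn n P) -> periodic P (2 * pi, 0) -> vanish P ->
  Cn 1 H -> periodic H (2 * pi, 0) ->
  Cn 1 phi -> (forall y : R, is_derive y (1 : R) phi (dphi y)) -> continuous dphi ->
  cint (fun x => phi x.2 * (dx2 P x * dx1 H x - dx1 P x * dx2 H x)) =
  cint (fun x => dphi x.2 * (dx1 P x * H x)).
Proof.
move=> CP pP vP CH pH Cphi dph cdphi.
have CP1 : Cn 1 (dx1 P) := Cn_partial1 (CP 2%N).
have CP2 : Cn 1 (dx2 P) := Cn_partial2 (CP 2%N).
have Cf : Cn 1 (fun x : R * R => phi x.2) := Cn_snd Cphi.
have C1 : Cn 1 (fun x => phi x.2 * (dx2 P x * H x)) := Cn_mul Cf (Cn_mul CP2 CH).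
have C2 : Cn 1 (fun x => phi x.2 * (dx1 P x * H x)) := Cn_mul Cf (Cn_mul CP1 CH).
have I1 : cint (dx1 (fun x => phi x.2 * (dx2 P x * H x))) = 0.
  apply: (cint_D1 C1) => x; rewrite /= addr0 pH.
  by rewrite (periodic_partial2 (fun y => Cn_diff y (CP 1%N)) pP).
have I2 : cint (dx2 (fun x => phi x.2 * (dx1 P x * H x))) = 0.
  apply: (cint_D2 C2) => x; have [-> ->] := vanish_dx1 (CP 1%N) vP x.
  by rewrite !mul0r !mulr0.
have c1 : continuous (dx1 (fun x => phi x.2 * (dx2 P x * H x))) := Cn_cont (Cn_partial1 C1).
have c2 : continuous (dx2 (fun x => phi x.2 * (dx1 P x * H x))) := Cn_cont (Cn_partial2 C2).
have c3 : continuous (fun x : R * R => dphi x.2 * (dx1 P x * H x)).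
  apply: cont_mul; last by apply: cont_mul; [exact: Cn_cont CP1|exact: Cn_cont CH].
  by move=> x; exact: (cvg_comp snd dphi (@cvg_snd _ _ _ _ _) (@cdphi x.2)).
pose A1 := fun x => phi x.2 * (dx2 P x * H x).
pose A2 := fun x => phi x.2 * (dx1 P x * H x).
have E : cint (fun x => phi x.2 * (dx2 P x * dx1 H x - dx1 P x * dx2 H x)) =
  cint (fun x => dx1 A1 x - dx2 A2 x + dphi x.2 * (dx1 P x * H x)); last first.
  by rewrite E (cintD (cont_sub c1 c2) c3) (cintB c1 c2) I1 I2 subrr add0r.
apply: eq_cint => x _.
rewrite (partial1_mul (Cn_diff x Cf) (Cn_diff x (Cn_mul CP2 CH))).
rewrite (partial2_mul (Cn_diff x Cf) (Cn_diff x (Cn_mul CP1 CH))).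
rewrite (partial1_mul (Cn_diff x CP2) (Cn_diff x CH)) (partial2_mul (Cn_diff x CP1) (Cn_diff x CH)).
have -> : dx1 (fun x : R * R => phi x.2) x = 0.
  by rewrite dx1E /partial1 derive_snd ?mul0r//; exact: is_derive_differentiable (dph _).
have -> : dx2 (fun x : R * R => phi x.2) x = dphi x.2.
  rewrite dx2E /partial2 derive_snd ?mul1r//; last exact: is_derive_differentiable (dph _).
  by rewrite derive1E; have [_ ->] := dph x.2.
rewrite (partial_swap (CP 2%N)); ring.
Qed.

End Transport.

Section Moments.
Context {R : realType}.
Local Notation ST := (R * (R * R))%type.
Implicit Types (F : ST -> R) (P : R -> R * R -> R) (h dh phi dphi : R -> R).

Lemma periodic_slice F t : periodic F (0, (2 * pi, 0)) -> periodic (slice F t) (2 * pi, 0).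
Proof.
by move=> pF x; rewrite /slice -(pF (t, x)); congr F; congr (_, _); rewrite /= addr0.
Qed.

(** The extension of the stream function is chosen at each time independently. Its derivatives agree
    with those of [psi] in the open strip, where they depend only on values in the strip; the
    equations then pass to the boundary by continuity. *)
Lemma ipm_ext_of (rho : R -> R * R -> R) : IPM_solution rho ->
  exists F P, ipm_ext F P /\ forall t x, 0 <= t -> strip x -> rho t x = F (t, x).
Proof.
move=> [[F [CF pF hF]] [psi [hpsi htr]]].
have H t : exists Q : R * R -> R, 0 <= t ->
    [/\ smooth Q, periodic Q (2 * pi, 0) & forall x, strip x -> psi t x = Q x].
  have [t0|t0] := lerP 0 t; last by exists (fun=> 0).
  by have [[Q hQ] _ _] := hpsi t t0; exists Q.
have [P hP] := choice H.
have FE t : 0 <= t -> forall z, strip_interior z -> rho t z = slice F t z.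
  by move=> t0 z iz; apply: hF => //; exact: interior_strip.
have PE t : 0 <= t -> forall z, strip_interior z -> psi t z = P t z.
  by move=> t0 z iz; have [_ _] := hP t t0; apply; exact: interior_strip.
have po t : 0 <= t -> poisson (P t) (dx1 (slice F t)).
  move=> t0; have [CP pP EP] := hP t t0; have [_ lapE bd] := hpsi t t0.
  have pp := @pi_ge0 R.
  split; [exact: CP| |exact: pP| |].
  - by move=> n; exact: Cn_partial1 (Cn_slice t (CF n.+1)).
  - move=> x; have [b1 b2] := bd x.
    by rewrite -(EP (x, - pi)) -?(EP (x, pi)) ?b1 ?b2// /strip /=; apply/andP; split; lra.
  - move=> x ix.
    have e1 : dx1 (rho t) x = dx1 (slice F t) x := eq_dx1 (FE t t0) ix.
    have e2 : dx1 (dx1 (psi t)) x = dx1 (dx1 (P t)) x.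
      by apply: eq_dx1 ix => z; exact: eq_dx1 (PE t t0).
    have e3 : dx2 (dx2 (psi t)) x = dx2 (dx2 (P t)) x.
      by apply: eq_dx2 ix => z; exact: eq_dx2 (PE t t0).
    have := lapE x ix; rewrite (laplacianE (psi t)) e2 e3 -(laplacianE (P t)) => ->.
    by rewrite -e1 dx1E.
exists F, P; split; last exact: hF.
split; [exact: CF|exact: pF|exact: po|move=> t x t0 sx].
have t0' := ltW t0.
have [CP pP EP] := hP t t0'.
have cP1 : continuous (dx1 (P t)) := Cn_cont (Cn_partial1 (CP 1%N)).
have cP2 : continuous (dx2 (P t)) := Cn_cont (Cn_partial2 (CP 1%N)).
have cS1 : continuous (dx1 (slice F t)) := Cn_cont (Cn_partial1 (Cn_slice t (CF 1%N))).
have cS2 : continuous (dx2 (slice F t)) := Cn_cont (Cn_partial2 (Cn_slice t (CF 1%N))).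
have cT : continuous (slice (dst et F) t) := continuous_slice (Cn_cont (Cn_dst et (CF 1%N))).
apply: (eq_on_strip (f := slice (dst et F) t)
  (g := fun x => dx2 (P t) x * dx1 (slice F t) x - dx1 (P t) x * dx2 (slice F t) x) cT _ _ sx).
  by apply: cont_sub; exact: cont_mul.
move=> z iz; have := htr t z t0 iz; rewrite /velocity /= -dx1E -dx2E.
rewrite (eq_dx1 (FE t t0') iz) (eq_dx2 (FE t t0') iz) (eq_dx1 (PE t t0') iz) (eq_dx2 (PE t t0') iz).
have -> : derive1 (fun tau => rho tau z) t = dst et F (t, z).
  have [_ <-] := is_derive_time t z (CF 1%N).
  (* [rho] and [F] agree for nonnegative times only, so the time derivatives are compared on a
     neighbourhood of t > 0. *)
  rewrite derive1E; apply: near_eq_derive.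
  have Hn := @lt_nbhsr R 0 t t0.
  near=> tau; apply: hF; last exact: interior_strip.
  by apply: ltW; near: tau; exact: Hn.
rewrite /slice; move: (dst _ _ _) (dx1 _ _) (dx2 _ _) (dx1 _ _) (dx2 _ _) => a b c d e E.
by rewrite -[LHS]subr0 -E; ring.
Unshelve. all: by end_near. Qed.

Lemma Cn1_comp (V : normedModType R) h dh (f : V -> R) :
  (forall r : R, is_derive r (1 : R) h (dh r)) -> continuous dh -> Cn 1 f ->
  Cn 1 (fun x => h (f x)) /\ forall v x, 'D_v (fun x => h (f x)) x = dh (f x) * 'D_v f x.
Proof.
move=> Dh cdh Cf.
have E v x : 'D_v (fun x => h (f x)) x = dh (f x) * 'D_v f x.
  rewrite derive_comp1; [|exact: Cn_diff Cf|by have [] := Dh (f x)].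
  by rewrite derive1E; have [_ ->] := Dh (f x).
split => //; split.
  move=> x; apply: (differentiable_comp (f := f) (g := h)); first exact: Cn_diff Cf.
  by apply/derivable1_diffP; have [] := Dh (f x).
move=> v; rewrite (_ : 'D_v _ = fun x => dh (f x) * 'D_v f x); last exact/funext/E.
apply: cont_mul; last exact: Cn_cont (Cn_D v Cf).
by move=> x; exact: (cvg_comp f dh (@Cn_cont _ _ _ f Cf x) (@cdh (f x))).
Qed.

(* I(phi(x2) h(rho)) for the pairs (phi, h) = (1, h), a conserved quantity,
   and (x2, id), the potential energy. *)
Definition moment phi h F t := cint (fun x => phi x.2 * h (F (t, x))).

(** In mean value form, the transport equation is needed only at one interior time c > 0, and no
    continuity of [P] in time is required. *)
Lemma moment_mvt F P phi dphi h dh (a b : R) : ipm_ext F P ->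
  Cn 1 phi -> (forall y : R, is_derive y (1 : R) phi (dphi y)) -> continuous dphi ->
  (forall y : R, is_derive y (1 : R) h (dh y)) -> continuous dh -> 0 <= a -> a < b ->
  exists2 c, a < c < b & moment phi h F b - moment phi h F a =
    cint (fun x => dphi x.2 * (dx1 (P c) x * h (F (c, x)))) * (b - a).
Proof.
move=> [CF pF hP htr] Cphi Dphi cdphi Dh cdh a0 ab.
have cF : continuous F := Cn_cont (CF 0%N).
have ch : continuous h := is_derive_cont Dh.
have cs2 : continuous (fun z : ST => z.2.2).
  by move=> z; exact: (cvg_comp snd snd (@cvg_snd _ _ _ _ _) (@cvg_snd _ _ _ _ _)).
have cphi : continuous (fun z : ST => phi z.2.2).
  by move=> z; exact: (cvg_comp _ phi (@cs2 z) (@Cn_cont _ _ _ _ Cphi z.2.2)).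
have chF : continuous (fun z : ST => h (F z)).
  by move=> z; exact: (cvg_comp F h (@cF z) (@ch (F z))).
have cdhF : continuous (fun z : ST => dh (F z)).
  by move=> z; exact: (cvg_comp F dh (@cF z) (@cdh (F z))).
pose G (z : ST) := phi z.2.2 * h (F z).
pose Gt (z : ST) := phi z.2.2 * (dh (F z) * dst et F z).
have cG : continuous G := cont_mul cphi chF.
have cGt : continuous Gt.
  by apply: (cont_mul cphi); apply: (cont_mul cdhF); exact: Cn_cont (Cn_dst et (CF 1%N)).
have DG t x : is_derive t (1 : R) (fun t => G (t, x)) (Gt (t, x)).
  have D1 := is_derive_time t x (CF 1%N).
  have D2 := @is_derive1_comp _ h (fun t => F (t, x)) t _ _ (Dh (F (t, x))) D1.
  have D3 := @is_deriveZ _ _ _ _ (phi x.2) _ _ _ D2.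
  by apply: (is_derive_eq D3); rewrite /Gt /GRing.scale /=; ring.
have [c cab E] := mvt_derive (fun t => is_derive_cint t cG cGt DG) ab.
have c0 : 0 < c by case/andP: cab => h1 _; exact: le_lt_trans a0 h1.
exists c => //; rewrite [LHS]E; congr (_ * _).
have [CP _ pP vP _] := hP c (ltW c0).
have [CH DH] := @Cn1_comp _ h dh (slice F c) Dh cdh (Cn_slice c (CF 1%N)).
have pH : periodic (fun x => h (slice F c x)) (2 * pi, 0).
  by move=> x; rewrite periodic_slice.
rewrite -(transport_moment CP pP vP CH pH Cphi Dphi cdphi).
apply: eq_cint => x /cell_clcell[_ /= sx]; rewrite /slice /Gt /=; congr (_ * _).
have sx' : strip x by move: sx; rewrite /= in_itv.
have e1 : dx1 (fun x => h (slice F c x)) x = dh (F (c, x)) * dx1 (slice F c) x.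
  by rewrite dx1E; exact: DH.
have e2 : dx2 (fun x => h (slice F c x)) x = dh (F (c, x)) * dx2 (slice F c) x.
  by rewrite dx2E; exact: DH.
rewrite (htr c x c0 sx') [in RHS]e1 [in RHS]e2; ring.
Qed.

Lemma conserved F P h dh (t : R) : ipm_ext F P ->
  (forall y : R, is_derive y (1 : R) h (dh y)) -> continuous dh -> 0 <= t ->
  cint (fun x => h (F (t, x))) = cint (fun x => h (F (0, x))).
Proof.
move=> hF Dh cdh; rewrite le_eqVlt => /orP[/eqP <-//|t0].
have [c _] := moment_mvt hF (Cn_cst 1 (1 : R)) (fun y => is_derive_cst (1 : R) y 1)
  (@cst_continuous _ _ _) Dh cdh (lexx 0) t0.
rewrite (_ : cint _ = 0) ?mul0r; last first.
  rewrite -[RHS](mul0r (cint (fun=> 1))) -cintZ; last exact: cont_cst.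
  by apply: eq_cint => x _; rewrite /= !mul0r.
move/eqP; rewrite subr_eq0 => /eqP; rewrite /moment.
by under eq_cint do rewrite mul1r; under [in RHS]eq_cint do rewrite mul1r.
Qed.

End Moments.

(** * Potential energy, its dissipation, and stationary solutions *)

Section Dissipation.
Context {R : realType}.
Local Notation ST := (R * (R * R))%type.
Implicit Types (F : ST -> R) (P : R -> R * R -> R).

Lemma poisson_strip (Q f : R * R -> R) x : poisson Q f -> strip x -> - laplacian Q x = f x.
Proof.
move=> [CQ Cf _ _ eq].
have c1 : continuous (fun x => - laplacian Q x) := cont_opp (@Cn_cont _ _ 0 _ (Cn_lap (CQ 2%N))).
exact: (eq_on_strip c1 (Cn_cont (Cf 0%N)) eq).
Qed.

Lemma cell_strip (x : R * R) : cell x -> strip x.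
Proof. by move=> /cell_clcell[_] /=; rewrite in_itv. Qed.

Lemma poisson_coef (Q f : R * R -> R) p q : poisson Q f ->
  coef_normsq f p q = lam (p, q) ^+ 2 * coef_normsq Q p q.
Proof.
move=> hQ; have [CQ _ pQ vQ _] := hQ; rewrite -(coef_laplacian p q (CQ 2%N) pQ vQ).
have E w : Cn 0 w -> cint (fun x => f x * w x) = - cint (fun x => laplacian Q x * w x).
  move=> cw; rewrite -cintN; last exact: (cont_mul (@Cn_cont _ _ 0 _ (Cn_lap (CQ 2%N))) cw).
  by apply: eq_cint => x /cell_strip sx; rewrite -(poisson_strip hQ sx) mulNr.
have [Cr Ci] := @omega_smooth R 0 p q.
by rewrite /coef_normsq -!/(cint _) (E _ Cr) (E _ Ci) !sqrrN.
Qed.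

(** Two integrations by parts: int d1 Q H = - int Q d1 H = int Q laplacian Q = - int |grad Q|^2.
    With H the density, the left side is the derivative of the potential energy. *)
Lemma poisson_flux (Q H : R * R -> R) : poisson Q (dx1 H) -> Cn 1 H -> periodic H (2 * pi, 0) ->
  cint (fun x => dx1 Q x * H x) = - cint (grad_dot Q Q).
Proof.
move=> hQ CH pH; have [CQ _ pQ vQ _] := hQ.
have C1 : Cn 1 (fun x => Q x * H x) := Cn_mul (CQ 1%N) CH.
have I : cint (dx1 (fun x => Q x * H x)) = 0.
  by apply: (cint_D1 C1) => x; rewrite /= pH pQ.
rewrite (green (CQ 1%N) pQ vQ (CQ 2%N) pQ) opprK.
have cQ : continuous Q := Cn_cont (CQ 0%N).
have c1 : continuous (fun x => Q x * dx1 H x) := cont_mul cQ (Cn_cont (Cn_partial1 CH)).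
have c2 : continuous (fun x => dx1 Q x * H x).
  by apply: cont_mul; [exact: Cn_cont (Cn_partial1 (CQ 1%N))|exact: Cn_cont CH].
have E1 : cint (dx1 (fun x => Q x * H x)) = cint (fun x => Q x * dx1 H x + dx1 Q x * H x).
  apply: eq_cint => x _; rewrite (partial1_mul (Cn_diff x (CQ 1%N)) (Cn_diff x CH)).
  by rewrite [H x * _]mulrC.
have E2 : cint (fun x => Q x * laplacian Q x) = - cint (fun x => Q x * dx1 H x).
  rewrite -(cintN c1); apply: eq_cint => x /cell_strip sx.
  by rewrite -(poisson_strip hQ sx) mulrN opprK.
move: I; rewrite E1 (cintD c1 c2) E2; move: (cint _) (cint _) => a b /eqP.
by rewrite addrC addr_eq0 => /eqP.
Qed.

Definition dissipation P t := cint (grad_dot (P t) (P t)).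

Definition energy F t := moment id id F t.

Lemma energy_mvt F P (a b : R) : ipm_ext F P -> 0 <= a -> a < b ->
  exists2 c, a < c < b & energy F b - energy F a = - dissipation P c * (b - a).
Proof.
move=> hF a0 ab.
have D (y : R) : is_derive y (1 : R) (@id R) 1 := is_derive_id y 1.
have cc : continuous (fun _ : R => (1 : R)) := @cst_continuous _ _ _.
have [c cab E] := moment_mvt hF (Cn_id 1) D cc D cc a0 ab.
exists c => //; rewrite [LHS]E; congr (_ * _).
have c0 : 0 <= c by case/andP: cab => /ltW h _; exact: le_trans h.
have [CF pF /(_ c c0) hP _] := hF.
rewrite -(poisson_flux hP (Cn_slice c (CF 1%N)) (periodic_slice c pF)).
by apply: eq_cint => x _; rewrite mul1r.
Qed.

Lemma dissipation_ge0 P t : 0 <= dissipation P t.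
Proof. by apply: cint_ge0 => x _; rewrite /grad_dot addr_ge0// -expr2 sqr_ge0. Qed.

Lemma conserved_sqr F P (t : R) : ipm_ext F P -> 0 <= t ->
  cint (fun x => F (t, x) ^+ 2) = cint (fun x => F (0, x) ^+ 2).
Proof.
move=> hF t0; apply: (@conserved _ F P (fun r => r ^+ 2) (fun r => 2 * r)) => //.
- move=> r; apply: (is_derive_eq (is_derive_pow 2 (is_derive_id r (1 : R)))).
  by rewrite /GRing.scale /=; ring.
- by apply: cont_scale => r; exact: cvg_id.
Qed.

(** Pointwise x2 rho >= - (x2^2 + rho^2), and the integral of rho^2 is conserved. *)
Lemma energy_lower F P : ipm_ext F P -> exists K, forall t, 0 <= t -> - K <= energy F t.
Proof.
move=> hF; have [CF _ _ _] := hF.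
have cF t : continuous (slice F t) := continuous_slice (Cn_cont (CF 0%N)).
exists (cint (fun x : R * R => x.2 ^+ 2) + cint (fun x => F (0, x) ^+ 2)) => t t0.
have cy : continuous (fun x : R * R => x.2) by move=> x; exact: cvg_snd.
have cy2 : continuous (fun x : R * R => x.2 ^+ 2) := @cont_exp _ _ 2 _ cy.
have cF2 : continuous (fun x : R * R => F (t, x) ^+ 2) := @cont_exp _ _ 2 _ (cF t).
rewrite -(conserved_sqr hF t0) -(cintD cy2 cF2) -(cintN (cont_add cy2 cF2)).
apply: le_cint.
- exact: cont_opp (cont_add cy2 cF2).
- exact: (cont_mul cy (cF t)).
- move=> x _ /=; move: (F _) => r; have := sqr_ge0 (x.2 + r); have := sqr_ge0 x.2; have := sqr_ge0 r.
  rewrite sqrrD; nra.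
Qed.

(** Otherwise each dyadic interval [2^k T0, 2^(k+1) T0] would lower the energy by at least eta/2: at
    its mean value time c, the length 2^k T0 is at least c/2 and c times the dissipation exceeds
    eta. Infinitely many such losses contradict the lower bound. *)
Lemma dissipation_small F P (T0 eta : R) : ipm_ext F P -> 0 < T0 -> 0 < eta ->
  exists2 t, T0 <= t & t * dissipation P t <= eta.
Proof.
move=> hF T00 eta0; apply: contrapT => H.
have {}H t : T0 <= t -> eta < t * dissipation P t.
  by move=> ht; rewrite ltNge; apply/negP => h; apply: H; exists t.
have [K hK] := energy_lower hF.
have pow0 k : 0 < 2 ^+ k * T0 by rewrite mulr_gt0// exprn_gt0.
have step k : energy F (2 ^+ k * T0) <= energy F T0 - k%:R * (eta / 2).
  elim: k => [|k IH]; first by rewrite expr0 mul1r mul0r subr0.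
  have lt : 2 ^+ k * T0 < 2 ^+ k.+1 * T0.
    by rewrite exprS -mulrA mulr_natl mulr2n ltrDl.
  have [c /andP[c1 c2] E] := energy_mvt hF (ltW (pow0 k)) lt.
  have hc : T0 <= c.
    by apply: (le_trans _ (ltW c1)); rewrite ler_peMl ?(ltW T00)// exprn_ege1// ler1n.
  have := H c hc; move: E; rewrite exprS -mulrA => E h.
  have c0 : 0 < c := lt_le_trans T00 hc.
  have d0 := dissipation_ge0 P c.
  have : eta / 2 <= dissipation P c * (2 ^+ k * T0).
    rewrite exprS -mulrA in c2; move: c2 h d0; move: (2 ^+ k * T0) (dissipation P c) => u d c2 h d0.
    have : c * d <= 2 * u * d by rewrite ler_wpM2r// ltW.
    lra.
  have -> : k.+1%:R = k%:R + 1 :> R by rewrite -[k.+1]addn1 natrD.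
  lra.
have := archi_boundP (divr_ge0 (addr_ge0 (normr_ge0 (K + energy F T0)) ler01) (divr_ge0 (ltW eta0) (ler0n _ 2))).
move: (Num.bound _) => n; rewrite ltr_pdivrMr ?divr_gt0// => hn.
have := step n; have := hK _ (ltW (pow0 n)); have := ler_norm (K + energy F T0); lra.
Qed.

(** Zero Dirichlet energy kills every coefficient of [Q] by Bessel, hence every coefficient of [f]
    by the Poisson equation; completeness then leaves an L2 norm of [f] below any e. *)
Lemma poisson_no_dissipation (Q f : R * R -> R) : poisson Q f -> periodic f (2 * pi, 0) ->
  cint (grad_dot Q Q) <= 0 -> cint (fun x => f x ^+ 2) <= 0.
Proof.
move=> hQ pf d0; have [CQ Cf pQ vQ _] := hQ.
apply/ler_addgt0Pr => e e0; rewrite add0r.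
have [s [us ps E]] := parseval_le (Cn_cont (Cf 0%N)) pf e0.
apply: le_trans E _; rewrite gerDr.
have B := le_trans (h1_bessel (CQ 1%N) pQ vQ us ps) d0.
pose a k := lam k * (coef_normsq Q k.1 k.2 / omega_normsq k.1 k.2) : R.
have a0 k : k \in s -> 0 <= a k.
  move=> ks; have k0 := allP ps _ ks; apply: mulr_ge0; first exact: ltW (lam_gt0 k0).
  by rewrite omega_normsqE// divr_ge0 ?(ltW pi2_gt0)// addr_ge0// sqr_ge0.
rewrite big_seq big1// => k ks; have k0 := allP ps _ ks.
have a_eq0 : a k = 0.
  apply/eqP; rewrite eq_le a0// andbT; apply: le_trans B.
  rewrite (bigD1_seq k)//= lerDl big_seq_cond sumr_ge0// => j /andP[js _]; exact: a0.
rewrite (poisson_coef k.1 k.2 hQ) -[(k.1, k.2)]surjective_pairing.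
by rewrite expr2 -!mulrA -/(a k) a_eq0 mulr0.
Qed.

(** The energy takes equal values at times 0 and 1, so the dissipation vanishes at some time c
    between them. Then the integral of |d1 F(c)|^2 is zero, and [F] at time c, which is [rho] on the
    strip, is independent of x1. *)
Lemma stationary_shear (rho : R * R -> R) : IPM_stationary rho ->
  exists G : R * R -> R, [/\ smooth G, periodic G (2 * pi, 0),
    forall x, strip x -> rho x = G x & forall x, strip x -> G x = G (0, x.2)].
Proof.
move=> /ipm_ext_of[F [P [hF EF]]]; have [CF pF hP _] := hF.
exists (slice F 0); split.
- by move=> n; exact: Cn_slice (CF n).
- exact: periodic_slice.
- by move=> x; exact: EF.
have [c /andP[c0 c1]] := energy_mvt hF (lexx 0) ltr01.
have -> : energy F 1 = energy F 0.
  by apply: eq_cint => x /cell_strip sx; rewrite -!EF.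
rewrite subrr => /esym/eqP; rewrite subr0 mulr1 oppr_eq0 => /eqP d0.
have hc := hP c (ltW c0).
pose f := dx1 (slice F c).
have pS : periodic (slice F c) (2 * pi, 0) := periodic_slice c pF.
have CS : Cn 1 (slice F c) := Cn_slice c (CF 1%N).
have pf : periodic f (2 * pi, 0) := periodic_partial1 (fun y => Cn_diff y CS) pS.
have cf : continuous f := Cn_cont (Cn_partial1 CS).
have I0 : cint (fun x => f x ^+ 2) <= 0.
  by apply: (poisson_no_dissipation hc pf); rewrite -/(dissipation P c) d0.
have f0 (x y : R) : - pi < x < pi -> - pi < y < pi -> f (x, y) = 0.
  move=> hx hy; apply/eqP; apply: contraT => ne; move: I0; rewrite leNgt => /negP[].
  apply: (cint_gt0 (x0 := (x, y))) => //.
  - exact: (@cont_exp _ _ 2 _ cf).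
  - by move=> z _; rewrite sqr_ge0.
  - by rewrite exprn_even_gt0.
have pp := @pi_gt0 R.
have S0 (x y : R) : - pi <= x <= pi -> - pi < y < pi -> slice F c (x, y) = slice F c (0, y).
  move=> /andP[x1 x2] hy.
  have D r : is_derive r (1 : R) (fun r => slice F c (r, y)) (f (r, y)).
    by apply: is_derive_x; exact: Cn_diff CS.
  have [h|h|->//] := ltgtP 0 x.
    have [d /andP[d1 d2]] := mvt_derive D h; rewrite f0 ?mul0r//; last by apply/andP; split; lra.
    by move/eqP; rewrite subr_eq0 => /eqP.
  have [d /andP[d1 d2]] := mvt_derive D h; rewrite f0 ?mul0r//; last by apply/andP; split; lra.
  by move/eqP; rewrite subr_eq0 => /eqP.
have E0 x : strip x -> slice F 0 x = slice F c x.
  by move=> sx; rewrite /slice -(EF 0)// -(EF c)// ltW.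
move=> x sx; rewrite !E0//; apply: (eq_on_strip (g := fun x => slice F c (0, x.2))) sx.
- exact: Cn_cont CS.
- move=> z; have cz : {for z, continuous (fun z : R * R => (0 : R, z.2))}.
    by apply: continuous_pairf; [exact: cst_continuous|exact: cvg_snd].
  exact: (cvg_comp _ _ cz (@Cn_cont _ _ _ _ CS (0, z.2))).
- move=> z iz; have [k hk] := angle_reduce z.1.
  rewrite -(periodic_shift z k pS); apply: S0 => //.
  by rewrite -ler_norml.
Qed.

End Dissipation.

(** * Trapping and growth *)

Section Trapping.
Context {R : realType}.
Local Notation ST := (R * (R * R))%type.
Implicit Types (F : ST -> R) (P : R -> R * R -> R).

Lemma spacetime_bound (G : ST -> R) (T : R) : continuous G -> periodic G (0, (2 * pi, 0)) -> 0 <= T ->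
  exists B, forall t x, 0 <= t <= T -> strip x -> `|G (t, x)| <= B.
Proof.
move=> cG pG T0.
pose K : set ST := `[0, T] `*` clcell.
have cK : compact K by apply: compact_setX; [exact: segment_compact|exact: (@compact_clcell R)].
have [||c _ cmax] := @compact_EVT_max _ R (fun z => `|G z|) K _ cK.
- exists (0, (0, 0)); split => /=; first by rewrite in_itv/= lexx T0.
  by split; rewrite /= in_itv /= oppr_le0 pi_ge0.
- by apply: continuous_subspaceT; exact: cont_norm.
exists `|G c| => t [x y] ht sx; have [k hk] := angle_reduce x.
rewrite -(spacetime_int t x y k pG); apply: cmax; rewrite inE; split; first by rewrite /= in_itv.
by split; rewrite /= in_itv /=; [rewrite -ler_norml|exact: sx].
Qed.

(** On [0, T] the first three x1-derivatives of the density are bounded by compactness. The elliptic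
    bounds turn this into velocity bounds uniform in t, although the stream functions were chosen
    time by time, and [circle_trapped] applies. *)
Lemma trapped F P (M : R) : ipm_ext F P ->
  (forall y, - pi <= y <= pi -> F (0, (pi, y)) <= M) ->
  forall t y, 0 <= t -> - pi <= y <= pi -> exists x, F (t, (x, y)) <= M.
Proof.
move=> [CF pF hP htr] hM T y; rewrite le_eqVlt => /orP[/eqP <-|T0] hy.
  by exists pi; exact: hM.
have pp := @pi_gt0 R.
pose F1 := dst e1 F; pose F11 := dst e1 F1; pose F111 := dst e1 F11.
have C1 n : Cn n F1 := Cn_dst e1 (CF n.+1).
have C11 n : Cn n F11 := Cn_dst e1 (C1 n.+1).
have C111 : Cn 0 F111 := Cn_dst e1 (C11 1%N).
have p1 : periodic F1 (0, (2 * pi, 0)) := periodic_dst e1 (CF 1%N) pF.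
have p11 : periodic F11 (0, (2 * pi, 0)) := periodic_dst e1 (C1 1%N) p1.
have p111 : periodic F111 (0, (2 * pi, 0)) := periodic_dst e1 (C11 1%N) p11.
have [B1 hB1] := spacetime_bound (Cn_cont (C1 0%N)) p1 (ltW T0).
have [B2 hB2] := spacetime_bound (Cn_cont (C11 0%N)) p11 (ltW T0).
have [B3 hB3] := spacetime_bound C111 p111 (ltW T0).
pose B := Num.max 0 (Num.max B1 (Num.max B2 B3)).
have [b0 b1 b2 b3] : [/\ 0 <= B, B1 <= B, B2 <= B & B3 <= B].
  by rewrite /B !le_max !lexx !orbT.
have S1 t : dx1 (slice F t) = slice F1 t.
  by apply/funext => x; exact: slice_dx1 (CF 1%N).
have S11 t : dx1 (slice F1 t) = slice F11 t.
  by apply/funext => x; exact: slice_dx1 (C1 1%N).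
have S111 t : dx1 (slice F11 t) = slice F111 t.
  by apply/funext => x; exact: slice_dx1 (C11 1%N).
pose C := B + 2 * pi * (B + B * (pi ^+ 2 / 2)).
have c2 : 0 <= 2 * pi * (B + B * (pi ^+ 2 / 2)).
  have pp2 : 0 <= 2 * pi :> R by rewrite mulr_ge0// ltW.
  by rewrite mulr_ge0// addr_ge0// mulr_ge0// divr_ge0// sqr_ge0.
have C0 : 0 <= C by rewrite addr_ge0.
have V t x : 0 < t <= T -> strip x ->
    `|dx1 (P t) x| <= B * ((pi ^+ 2 - x.2 ^+ 2) / 2) /\ `|dx2 (P t) x| <= 2 * pi * (B + B * (pi ^+ 2 / 2)).
  move=> /andP[t0 tT] sx; have ht : 0 <= t <= T by rewrite ltW.
  apply: (velocity_bound (hP t (ltW t0))) => // z sz.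
  rewrite S1 S11 S111; split; [exact: le_trans (hB1 t z ht sz) _|exact: le_trans (hB2 t z ht sz) _|].
  exact: le_trans (hB3 t z ht sz) _.
pose U t x := (- dx2 (P t) x, dx1 (P t) x).
apply: (@circle_trapped R F (dst et F) F1 (dst e2 F) U T C) => //.
- exact: Cn_cont (CF 0%N).
- exact: Cn_cont (Cn_dst et (CF 1%N)).
- exact: Cn_cont (C1 0%N).
- exact: Cn_cont (Cn_dst e2 (CF 1%N)).
- by move=> z v r; exact: is_derive_spacetime (CF 1%N).
- exact: (periodic_dst et (CF 1%N) pF).
- exact: (periodic_dst e2 (CF 1%N) pF).
- move=> t t0 x; have [CP _ _ _ _] := hP t (ltW t0).
  have k1 : continuous (dx1 (P t)) := Cn_cont (Cn_partial1 (CP 1%N)).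
  have k2 : continuous (fun x => - dx2 (P t) x) := cont_opp (Cn_cont (Cn_partial2 (CP 1%N))).
  exact: (continuous_pairf (@k2 x) (@k1 x)).
- move=> t t0 x; have [CP _ pP _ _] := hP t (ltW t0).
  rewrite /U (periodic_partial1 (fun y => Cn_diff y (CP 1%N)) pP).
  by rewrite (periodic_partial2 (fun y => Cn_diff y (CP 1%N)) pP).
- by move=> t x ht sx; rewrite /U /= normrN (le_trans (V t x ht sx).2)// lerDr.
- move=> t x ht sx; rewrite /U /= (le_trans (V t x ht sx).1)// ler_wpM2r//.
    by rewrite divr_ge0// strip_sqr.
  by rewrite lerDl.
- move=> t x /andP[t0 _] sx.
  rewrite (htr t x t0 sx) (slice_dx1 t x (CF 1%N)) (slice_dx2 t x (CF 1%N)) /U /= -/F1.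
  by move: (dx1 _ _) (dx2 _ _) (F1 _) (dst _ _ _) => a b c d; ring.
Qed.

Lemma quadratic_derive (q : R -> R) (u d : R) : (forall h, `|q (u + h) - q u - h * d| <= h ^+ 2) ->
  is_derive u (1 : R) q d.
Proof.
move=> hq.
have cv : (fun h : R => h^-1 *: (q (h *: (1 : R) + u) - q u)) @ 0^' --> d.
  apply/cvgrPdist_lt => e e0; near=> h.
  have h0 : h != 0 by near: h; exact: nbhs_dnbhs_neq.
  have he : `|h| < e by near: h; exact: dnbhs0_lt.
  rewrite /GRing.scale /= mulr1 distrC [h + u]addrC.
  have -> : h^-1 * (q (u + h) - q u) - d = h^-1 * (q (u + h) - q u - h * d) by field.
  rewrite normrM normfV; apply: le_lt_trans he.
  rewrite ler_pdivrMl ?normr_gt0//; apply: le_trans (hq h) _.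
  by rewrite -expr2 real_normK ?num_real.
apply: DeriveDef; first by apply/cvg_ex; exists d.
exact: cvg_lim cv.
Unshelve. all: by end_near. Qed.

(** The squared positive part has first-order remainder at most h^2. It is therefore C^1, regular
    enough to be a conserved density. *)
Lemma is_derive_excess (M r : R) :
  is_derive r (1 : R) (fun r => Num.max (r - M) 0 ^+ 2) (2 * Num.max (r - M) 0).
Proof.
apply: quadratic_derive => h.
have -> : r + h - M = (r - M) + h by ring.
move: (r - M) => u; rewrite ler_norml.
have := sqr_ge0 h; have := sqr_ge0 (u + h); have := sqr_ge0 u.
by case: (lerP u 0) => h1; case: (lerP (u + h) 0) => h2 k1 k2 k3; apply/andP; split; nra.
Qed.

Lemma oscillation (u du : R -> R) (a b : R) : (forall x : R, is_derive x (1 : R) u (du x)) ->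
  continuous du -> - pi <= a -> a < b -> b <= pi -> `|u b - u a| <= sint (fun x => `|du x|).
Proof.
move=> hu cdu pa ab bp; have cu := is_derive_cont hu.
have cn : continuous (fun x => `|du x|) := cont_norm cdu.
have sub : `[a, b] `<=` (seg : set R).
  move=> x /=; rewrite /seg /= !in_itv /= => /andP[x1 x2].
  by rewrite (le_trans pa x1) (le_trans x2 bp).
have int := seg_integrable cn.
have E := @continuous_FTC2 R du u a b ab (continuous_subspaceT cdu).
have {}E : (\int[lebesgue_measure]_(x in `[a, b]) (du x)%:E)%E = (u b - u a)%:E.
  apply: E.
  - split=> [x _||]; first by have [] := hu x.
      exact/cvg_at_right_filter/cu.
    exact/cvg_at_left_filter/cu.
  - by move=> x _; rewrite derive1E; have [_] := hu x.
rewrite -lee_fin -abse_EFin -E.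
have mdu : measurable_fun setT du by exact: continuous_measurable_fun.
apply: le_trans (le_abse_integral _ _ _) _ => //.
  by apply: measurable_funTS; exact/measurable_EFinP.
rewrite /sint /Rintegral fineK; last by apply: integrable_fin_num int; exact: measurable_itv.
apply: ge0_subset_integral => //.
  exact: measurable_itv.
exact: (measurable_int _ int).
Qed.

Lemma sint_cauchy_schwarz (v : R -> R) : continuous v ->
  sint (fun x => `|v x|) ^+ 2 <= 2 * pi * sint (fun x => v x ^+ 2).
Proof.
move=> cv; have pp := @pi_gt0 R; set a := sint _.
have p2 : 0 < 2 * pi :> R by rewrite mulr_gt0.
have cn : continuous (fun x => `|v x|) := cont_norm cv.
have c2 : continuous (fun x => v x ^+ 2) := @cont_exp _ _ 2 _ cv.
(* [m] is the mean of |v|; Cauchy-Schwarz follows by expanding int (|v| - m)^2 >= 0. *)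
pose m := a / (2 * pi).
have : 0 <= sint (fun x => v x ^+ 2 + ((- (2 * m)) * `|v x| + m ^+ 2)).
  apply: sint_ge0 => x _; rewrite -[v x ^+ 2]real_normK ?num_real//.
  by have := sqr_ge0 (`|v x| - m); rewrite sqrrB; lra.
have c3 : continuous (fun x => (- (2 * m)) * `|v x|) := @cont_scale _ _ (- (2 * m)) _ cn.
have c4 : continuous (fun _ : R => m ^+ 2) := @cst_continuous _ _ _.
rewrite (sintD c2 (cont_add c3 c4)) (sintD c3 c4).
rewrite (sintZ _ cn) sint_cst -/a.
have -> : - (2 * m) * a + m ^+ 2 * (2 * pi) = - (a ^+ 2 / (2 * pi)).
  rewrite /m; move: p2; generalize (2 * pi : R) => w w0; field; lra.
by rewrite subr_ge0 ler_pdivrMr// mulrC.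
Qed.

(** On each circle some x0 has G <= M, so the excess at any other point is at most int |d1 G| along
    the circle. One factor 2 pi comes from Cauchy-Schwarz, the other from integrating this constant
    over the circle. *)
Lemma poincare_excess (G : R * R -> R) (M : R) : Cn 1 G -> periodic G (2 * pi, 0) ->
  (forall y, - pi <= y <= pi -> exists x, G (x, y) <= M) ->
  cint (fun x => Num.max (G x - M) 0 ^+ 2) <= (2 * pi) ^+ 2 * cint (fun x => dx1 G x ^+ 2).
Proof.
move=> CG pG hM; have pp := @pi_gt0 R.
have cG : continuous G := Cn_cont CG.
have c1 : continuous (dx1 G) := Cn_cont (Cn_partial1 CG).
have cex : continuous (fun x => Num.max (G x - M) 0 ^+ 2).
  move=> x; have := is_derive_cont (is_derive_excess M) => ce.
  exact: (cvg_comp G _ (@cG x) (ce (G x))).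
have c1s : continuous (fun x => dx1 G x ^+ 2) := @cont_exp _ _ 2 _ c1.
rewrite (cint_iter2 cex) (cint_iter2 c1s).
have cS : continuous (fun y => sint (fun x => dx1 G (x, y) ^+ 2)).
  exact: (sint_continuous (swap_continuous c1s)).
have cL : continuous (fun y => sint (fun x => Num.max (G (x, y) - M) 0 ^+ 2)).
  exact: (sint_continuous (swap_continuous cex)).
rewrite -(sintZ _ cS); apply: le_sint => //; first exact: (@cont_scale _ _ _ _ cS).
move=> y hy; have [x0 hx0] := hM y hy.
have [k hk] := angle_reduce x0.
rewrite -(periodic_shift (x0, y) k pG) /= in hx0.
move: hk hx0; move: (x0 + _) => {x0 k} x0; rewrite ler_norml => /andP[x01 x02] hx0.
have cfix : continuous (fun x => dx1 G (x, y)) := @continuous_fix2 _ _ y c1.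
have cfix2 : continuous (fun x => dx1 G (x, y) ^+ 2) := @cont_exp _ _ 2 _ cfix.
have D r : is_derive r (1 : R) (fun r => G (r, y)) (dx1 G (r, y)).
  by apply: is_derive_x; exact: Cn_diff CG.
have CS := sint_cauchy_schwarz cfix.
set a := sint (fun x => `|dx1 G (x, y)|) in CS.
have a0 : 0 <= a by apply: sint_ge0 => x _.
have -> : (2 * pi) ^+ 2 * sint (fun x => dx1 G (x, y) ^+ 2) = (2 * pi * sint (fun x => dx1 G (x, y) ^+ 2)) * (2 * pi) by ring.
apply: (@le_trans _ _ (a ^+ 2 * (2 * pi))); last by rewrite ler_wpM2r// mulr_ge0// ltW.
rewrite -sint_cst; apply: le_sint.
- exact: (@continuous_fix2 _ _ y cex).
- exact: cont_cst.
move=> x /andP[x1 x2].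
rewrite ler_pXn2r ?nnegrE ?le_max ?lexx ?orbT// ge_max a0 andbT.
have [h|h|<-] := ltgtP x0 x.
- have := oscillation D cfix x01 h x2; have := ler_norm (G (x, y) - G (x0, y)); rewrite -/a; lra.
- have := oscillation D cfix x1 h x02; have := ler_norm (- (G (x0, y) - G (x, y))).
  by rewrite normrN -/a; lra.
- lra.
Qed.

Lemma gradient_lower F P (M : R) : ipm_ext F P ->
  (forall y, - pi <= y <= pi -> F (0, (pi, y)) <= M) -> forall t, 0 <= t ->
  cint (fun x => Num.max (F (0, x) - M) 0 ^+ 2) <= (2 * pi) ^+ 2 * cint (fun x => dx1 (slice F t) x ^+ 2).
Proof.
move=> hF hM t t0.
have c2 : continuous (fun r => 2 * Num.max (r - M) 0).
  apply: cont_scale => r; have cM : continuous (fun r : R => r - M).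
    by move=> s; apply: cvgB; [exact: cvg_id|exact: cvg_cst].
  exact: (@continuous_max R R (fun r => r - M) (fun=> 0) r (@cM r) (@cst_continuous _ _ _ r)).
have [CF pF _ _] := hF.
rewrite -(@conserved _ F P (fun r => Num.max (r - M) 0 ^+ 2) _ t hF (is_derive_excess M) c2 t0).
apply: poincare_excess; first exact: Cn_slice (CF 1%N).
  exact: periodic_slice.
by move=> y hy; exact: (trapped hF hM).
Qed.

End Trapping.

(** * From small dissipation to growth of Sobolev norms *)

Section Growth.
Context {R : realType}.
Local Notation ST := (R * (R * R))%type.
Implicit Types (F : ST -> R) (P : R -> R * R -> R).

Lemma coef_normsq_ge0 (f : R * R -> R) p q : 0 <= coef_normsq f p q.
Proof. by rewrite addr_ge0// sqr_ge0. Qed.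

Lemma spectral_ge0 (f : R * R -> R) p q : (0 < q)%N -> 0 <= coef_normsq f p q / omega_normsq p q.
Proof. by move=> q0; rewrite omega_normsqE// divr_ge0 ?coef_normsq_ge0// ltW// pi2_gt0. Qed.

Lemma Hdot_lower (s : R) (D : R * R -> R) (ks : seq (int * nat)) : uniq ks ->
  all (fun k => 0 < k.2)%N ks ->
  ((\sum_(k <- ks) lam k `^ s * (coef_normsq D k.1 k.2 / omega_normsq k.1 k.2))%:E <= Hdot_normsq s D)%E.
Proof.
move=> us ps; apply: esum_ge; exists [set` ks].
  split; first exact: finite_seq.
  by move=> k /= kks; exact: (allP ps).
by rewrite -fsbig_seq// -sumEFin lexx.
Qed.

(** Mode by mode, |(d1 H)_k|^2 <= K lam |Q_k|^2 + K^(-s) lam^(s+1) |D_k|^2. If lam <= K the first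
    term suffices, because (d1 H)_k has size lam |Q_k|; if lam > K the second does, because p^2 <=
    lam and (lam/K)^s >= 1. Summing, Parseval loses c/4 and the dissipation at most c/2, which
    leaves c/4. *)
Lemma spectral_growth (H Q D : R * R -> R) (K s c : R) :
  poisson Q (dx1 H) -> Cn 1 H -> periodic H (2 * pi, 0) ->
  (forall p q, p != 0 -> coef_normsq D p q = coef_normsq H p q) ->
  0 < K -> 0 < s -> 0 < c -> c <= cint (fun x => dx1 H x ^+ 2) ->
  K * cint (grad_dot Q Q) <= c / 2 ->
  ((K `^ s * (c / 4))%:E <= Hdot_normsq (s + 1) D)%E.
Proof.
move=> hQ CH pH hD K0 s0 c0 hc hK; have [CQ Cf pQ vQ _] := hQ.
have p1 : periodic (dx1 H) (2 * pi, 0) := periodic_partial1 (fun y => Cn_diff y CH) pH.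
have c4 : 0 < c / 4 by rewrite divr_gt0.
have [ks [us ps E]] := parseval_le (Cn_cont (Cf 0%N)) p1 c4.
apply: le_trans (Hdot_lower (s + 1) D us ps); rewrite lee_fin.
have B := h1_bessel (CQ 1%N) pQ vQ us ps.
have Ks := powR_gt0 s K0.
have term k : k \in ks -> coef_normsq (dx1 H) k.1 k.2 / omega_normsq k.1 k.2 <=
    K * (lam k * (coef_normsq Q k.1 k.2 / omega_normsq k.1 k.2)) +
    (K `^ s)^-1 * (lam k `^ (s + 1) * (coef_normsq D k.1 k.2 / omega_normsq k.1 k.2)).
  move=> kk; have k0 := allP ps _ kk; have l0 := @lam_gt0 R k k0.
  have q0 := spectral_ge0 Q k.1 k0; have d0 := spectral_ge0 D k.1 k0.
  have x0 : 0 <= K * (lam k * (coef_normsq Q k.1 k.2 / omega_normsq k.1 k.2)).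
    by rewrite mulr_ge0 ?(ltW K0)// mulr_ge0// ltW.
  have y0 : 0 <= (K `^ s)^-1 * (lam k `^ (s + 1) * (coef_normsq D k.1 k.2 / omega_normsq k.1 k.2)).
    by rewrite mulr_ge0 ?invr_ge0 ?(ltW Ks)// mulr_ge0// powR_ge0.
  have [h|h] := lerP (lam k) K.
    apply: (@le_trans _ _ (K * (lam k * (coef_normsq Q k.1 k.2 / omega_normsq k.1 k.2)))); last by rewrite lerDl.
    rewrite (poisson_coef k.1 k.2 hQ) -[(k.1, k.2)]surjective_pairing expr2 -!mulrA.
    by rewrite ler_wpM2r// mulr_ge0// ltW.
  apply: le_trans (_ : _ <= (K `^ s)^-1 * (lam k `^ (s + 1) * (coef_normsq D k.1 k.2 / omega_normsq k.1 k.2))) _; last by rewrite lerDr.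
  rewrite (coef_D1 k.1 k.2 CH pH).
  (* Modes with p = 0 are killed by d1, and these are the only ones where [D] and [H] may differ. *)
  have [z|nz] := eqVneq k.1 0; first by rewrite z expr0n /= !mul0r -z.
  rewrite -(hD _ _ nz) -mulrA powRD ?(gt_eqF l0) ?implybT// powRr1 ?(ltW l0)//.
  set d := _ / _ in d0 *.
  have -> : (K `^ s)^-1 * (lam k `^ s * lam k * d) = (K `^ s)^-1 * lam k `^ s * (lam k * d) by ring.
  apply: (@le_trans _ _ (lam k * d)).
    by rewrite ler_wpM2r// /lam lerDl divr_ge0// sqr_ge0.
  rewrite ler_peMl//; first by rewrite mulr_ge0// ltW.
  rewrite mulrC ler_pdivlMr// mul1r ge0_ler_powR ?nnegrE ?(ltW s0) ?(ltW K0) ?(ltW l0)//; exact: ltW.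
have S : \sum_(k <- ks) coef_normsq (dx1 H) k.1 k.2 / omega_normsq k.1 k.2 <=
    K * cint (grad_dot Q Q) +
    (K `^ s)^-1 * \sum_(k <- ks) lam k `^ (s + 1) * (coef_normsq D k.1 k.2 / omega_normsq k.1 k.2).
  apply: (@le_trans _ _ (K * \sum_(k <- ks) lam k * (coef_normsq Q k.1 k.2 / omega_normsq k.1 k.2) +
    (K `^ s)^-1 * \sum_(k <- ks) lam k `^ (s + 1) * (coef_normsq D k.1 k.2 / omega_normsq k.1 k.2))).
    rewrite !mulr_sumr -big_split /= big_seq [leRHS]big_seq; apply: ler_sum => k; exact: term.
  by rewrite lerD2r ler_wpM2l// ltW.
rewrite -ler_pdivlMl//; move: E S hK hc; set x := (K `^ s)^-1 * _; lra.
Qed.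

(** A function of x2 alone is orthogonal to every mode with p <> 0, as cos(p x1) and sin(p x1) have
    mean zero. Subtracting the stationary solution thus leaves the relevant coefficients
    unchanged. *)
Lemma coef_shear (D H G : R * R -> R) p q : continuous H -> continuous G ->
  (forall x, strip x -> D x = H x - G x) -> (forall x, strip x -> G x = G (0, x.2)) ->
  p != 0 -> coef_normsq D p q = coef_normsq H p q.
Proof.
move=> cH cG hD hG p0.
have c0 : continuous (fun y : R => G (0, y)) := @continuous_fix1 _ G 0 cG.
have E (w v : R -> R) : continuous w -> continuous v -> sint w = 0 ->
    cint (fun x => D x * (w x.1 * v x.2)) = cint (fun x => H x * (w x.1 * v x.2)).
  move=> cw cv w0.
  have cw1 : continuous (fun x : R * R => w x.1).
    by move=> x; exact: (cvg_comp fst w (@cvg_fst _ _ _ _ _) (@cw x.1)).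
  have cv2 : continuous (fun x : R * R => v x.2).
    by move=> x; exact: (cvg_comp snd v (@cvg_snd _ _ _ _ _) (@cv x.2)).
  have cwv := cont_mul cw1 cv2.
  transitivity (cint (fun x => H x * (w x.1 * v x.2) - G x * (w x.1 * v x.2))).
    by apply: eq_cint => x /cell_strip sx; rewrite hD// mulrBl.
  rewrite (cintB (cont_mul cH cwv) (cont_mul cG cwv)).
  have -> : cint (fun x => G x * (w x.1 * v x.2)) = 0; last by rewrite subr0.
  transitivity (sint w * sint (fun y => G (0, y) * v y)); last by rewrite w0 mul0r.
  rewrite -(cint_tensor cw (cont_mul c0 cv)).
  by apply: eq_cint => x /cell_strip sx; rewrite hG//= mulrCA.
have cb : continuous (b_ q : R -> R) := @cont_b R q.
have [cc cs] : continuous (fun x : R => cos (p%:~R * x)) /\ continuous (fun x : R => sin (p%:~R * x)).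
  by split; [exact: (is_derive_cont (is_derive_cosM _))|exact: (is_derive_cont (is_derive_sinM _))].
rewrite /coef_normsq -!/(cint _) (E _ _ cc cb) ?(E _ _ cs cb)//.
  by rewrite sint_sin.
by rewrite sint_cos (negbTE p0).
Qed.

Lemma limf_esup_pinfty (f : R -> \bar R) :
  (forall N T0, 0 < N -> 0 < T0 -> exists2 t, T0 <= t & (N%:E <= f t)%E) ->
  limf_esup f (+oo%R : set_system R) = +oo%E.
Proof.
move=> H; apply: eq_infty => r; apply: le_ereal_inf_tmp => _ [V [M [_ hV]] <-].
have n0 : 0 < `|r| + 1 by rewrite ltr_wpDl.
have t0 : 0 < `|M| + 1 by rewrite ltr_wpDl.
have [t ht hN] := H _ _ n0 t0.
apply: (@le_trans _ _ (f t)).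
  by apply: le_trans hN; rewrite lee_fin (le_trans (ler_norm r))// lerDl.
apply: ereal_sup_ubound; exists t => //; apply: hV.
apply: lt_le_trans ht; apply: (le_lt_trans (ler_norm M)); by rewrite ltrDl.
Qed.

Lemma norm_growth F P (M : R) (D : R -> R * R -> R) : ipm_ext F P ->
  (forall y, - pi <= y <= pi -> F (0, (pi, y)) <= M) ->
  0 < cint (fun x => Num.max (F (0, x) - M) 0 ^+ 2) ->
  (forall t, 0 <= t -> forall p q, p != 0 -> coef_normsq (D t) p q = coef_normsq (slice F t) p q) ->
  forall s, 0 < s ->
  limf_esup (fun t : R => ((t `^ (- (s / 2)))%:E * Hdot_norm (s + 1)%R (D t))%E)
    (+oo%R : set_system R) = +oo%E.
Proof.
move=> hF hM k0 hD s s0; have [CF pF hP _] := hF.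
have p20 : 0 < (2 * pi) ^+ 2 :> R by rewrite exprn_gt0// mulr_gt0// pi_gt0.
pose c : R := cint (fun x => Num.max (F (0, x) - M) 0 ^+ 2) / (2 * pi) ^+ 2.
have c0 : 0 < c by rewrite divr_gt0.
apply: limf_esup_pinfty => N T0 N0 T00.
(* With K = k t, the bound K^s c/4 equals N^2 t^s, the square of N t^(s/2). The threshold c/(2k) for
   t times the dissipation is what gives K times the dissipation at most c/2. *)
pose a := N ^+ 2 * 4 / c; have a0 : 0 < a by rewrite divr_gt0// mulr_gt0// exprn_gt0.
pose k := a `^ s^-1; have kk : 0 < k := powR_gt0 _ a0.
have eta0 : 0 < c / (2 * k) by rewrite divr_gt0// mulr_gt0.
have [t ht hd] := dissipation_small hF T00 eta0.
have t0 : 0 < t := lt_le_trans T00 ht.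
exists t => //.
have low : c <= cint (fun x => dx1 (slice F t) x ^+ 2).
  by rewrite ler_pdivrMr// mulrC; exact: (gradient_lower hF hM (ltW t0)).
have kt0 : 0 < k * t by rewrite mulr_gt0.
have hK : k * t * cint (grad_dot (P t) (P t)) <= c / 2.
  rewrite -mulrA -ler_pdivlMl//; apply: le_trans hd _.
  by rewrite invfM mulrA mulrC.
have G := spectral_growth (hP t (ltW t0)) (Cn_slice t (CF 1%N)) (periodic_slice t pF)
  (hD t (ltW t0)) kt0 s0 c0 low hK.
have E : (k * t) `^ s * (c / 4) = (N * t `^ (s / 2)) ^+ 2.
  rewrite powRM ?(ltW kk) ?(ltW t0)// /k -powRrM mulVf ?(gt_eqF s0)// powRr1 ?(ltW a0)//.
  have -> : t `^ s = t `^ (s / 2) ^+ 2.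
    by rewrite expr2 -powRD ?(gt_eqF t0) ?implybT// -splitr.
  by rewrite exprMn /a; field; rewrite gt_eqF.
rewrite E EFin_expe in G.
have ts := powR_gt0 (s / 2) t0.
have {}G : ((N * t `^ (s / 2))%:E <= Hdot_norm (s + 1) (D t))%E.
  have := sqrte_sqr (N * t `^ (s / 2))%:E; rewrite gee0_abs ?lee_fin ?mulr_ge0 ?(ltW N0) ?(ltW ts)// => <-.
  by rewrite lee_sqrt//; apply: le_trans G; rewrite sqre_ge0.
apply: le_trans (lee_wpmul2l _ G); last by rewrite lee_fin powR_ge0.
rewrite -EFinM lee_fin powRN [leRHS]mulrC mulfK ?gt_eqF//.
Qed.

End Growth.

(** * The perturbation *)

Section Interpolation.
Context {R : realType}.
Implicit Types (f : R * R -> R).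

Lemma lam_ge (k : int * nat) : (0 < k.2)%N -> 1 / 4 <= lam k :> R.
Proof.
move=> k0; have : 1 <= k.2%:R ^+ 2 :> R by rewrite exprn_ege1// ler1n.
by have := sqr_ge0 (k.1%:~R : R); rewrite /lam; lra.
Qed.

(** Below K the power is at most K^|2 - gamma|; when 2 - gamma is negative this uses 1/l <= 4 <= K.
    Above K, l^(- gamma) <= K^(- gamma). *)
Lemma lam_powR (K gamma l : R) : 4 <= K -> 0 < gamma -> 1 / 4 <= l ->
  l `^ (2 - gamma) <= K `^ `|2 - gamma| + (K `^ gamma)^-1 * l ^+ 2.
Proof.
move=> K4 g0 l4; have l0 : 0 < l by lra.
have K0 : 0 < K by lra.
have Kg := powR_gt0 gamma K0.
have [h|h] := lerP l K.
  apply: (@le_trans _ _ (K `^ `|2 - gamma|)); last by rewrite lerDl mulr_ge0 ?sqr_ge0// invr_ge0 ltW.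
  have [s0|s0] := lerP 0 (2 - gamma).
    by rewrite ger0_norm// ge0_ler_powR// nnegrE ltW.
  rewrite ltr0_norm// (_ : l `^ (2 - gamma) = (l^-1) `^ (- (2 - gamma))); last first.
    by rewrite -(powR_inv1 (ltW l0)) -powRrM mulN1r opprK.
  rewrite ge0_ler_powR ?nnegrE ?invr_ge0 ?(ltW l0) ?(ltW K0)//; first by rewrite oppr_ge0 ltW.
  by apply: le_trans K4; rewrite invf_ple ?posrE// -div1r.
apply: (@le_trans _ _ ((K `^ gamma)^-1 * l ^+ 2)); last by rewrite lerDr powR_ge0.
rewrite powRD ?(gt_eqF l0) ?implybT// powR_mulrn ?(ltW l0)// mulrC ler_wpM2r ?sqr_ge0//.
rewrite powRN lef_pV2 ?posrE ?powR_gt0// ge0_ler_powR ?nnegrE ?(ltW g0) ?(ltW K0) ?(ltW l0)//; exact: ltW.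
Qed.

Lemma L2_normsqE f : continuous f -> L2_normsq f = (cint (fun x => f x ^+ 2))%:E.
Proof.
move=> cf; have c2 : continuous (fun x => f x ^+ 2) := @cont_exp _ _ 2 _ cf.
rewrite /cint /Rintegral fineK//; apply: integrable_fin_num (cell_integrable c2); exact: measurable_cell.
Qed.

(** Bessel is applied to [f] and to its laplacian, whose squared coefficients are lam^2 times those
    of [f]. *)
Lemma Hdot_upper (K gamma : R) f : 4 <= K -> 0 < gamma -> Cn 2 f -> periodic f (2 * pi, 0) -> vanish f ->
  (Hdot_normsq (2 - gamma) f <= (K `^ `|2 - gamma| * cint (fun x => f x ^+ 2)
     + (K `^ gamma)^-1 * cint (fun x => laplacian f x ^+ 2))%:E)%E.
Proof.
move=> K4 g0 Cf pf vf; apply: ge_ereal_sup => _ [A [fA sA] <-].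
rewrite fsbig_finite//= sumEFin lee_fin.
set ks : seq (int * nat) := finmap.enum_fset _.
have us : uniq ks := finmap.fset_uniq _.
have ps : all (fun k => 0 < k.2)%N ks.
  by apply/allP => k; rewrite in_fset_set// inE => /sA.
have B1 := l2_bessel (Cn_cont Cf) us ps.
have B2 := l2_bessel (@Cn_cont _ _ 0 _ (Cn_lap Cf)) us ps.
have Kg : 0 <= (K `^ gamma)^-1 by rewrite invr_ge0 powR_ge0.
apply: le_trans (lerD (ler_wpM2l (powR_ge0 K `|2 - gamma|) B1) (ler_wpM2l Kg B2)).
rewrite !mulr_sumr -big_split /= big_seq [leRHS]big_seq; apply: ler_sum => k kk.
have k0 := allP ps _ kk.
rewrite (coef_laplacian k.1 k.2 Cf pf vf) -[(k.1, k.2)]surjective_pairing -/(lam k).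
set c := coef_normsq f k.1 k.2; set n := omega_normsq _ _.
have -> : K `^ `|2 - gamma| * (c / n) + (K `^ gamma)^-1 * (lam k ^+ 2 * c / n) =
  (K `^ `|2 - gamma| + (K `^ gamma)^-1 * lam k ^+ 2) * (c / n) by ring.
rewrite ler_wpM2r ?spectral_ge0//; exact: lam_powR (lam_ge k0).
Qed.

(** Interpolation: with a bounded laplacian, a small L2 norm makes every norm of order 2 - gamma
    small. First K is taken large to absorb [A], then d small depending on K. *)
Lemma H_norm_small (eps gamma A : R) : 0 < eps -> 0 < gamma -> 0 <= A ->
  exists2 d, 0 < d & forall f, Cn 2 f -> periodic f (2 * pi, 0) -> vanish f ->
    cint (fun x => f x ^+ 2) <= d -> cint (fun x => laplacian f x ^+ 2) <= A ->
    (H_norm (2 - gamma) f <= eps%:E)%E.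
Proof.
move=> e0 g0 A0.
have e2 : 0 < eps ^+ 2 / 2 by rewrite divr_gt0// exprn_gt0.
pose a := (A + 1) / (eps ^+ 2 / 2); have a0 : 0 < a by rewrite divr_gt0// ltr_wpDl.
pose K := Num.max 4 (a `^ gamma^-1).
have K4 : 4 <= K by rewrite le_max lexx.
have K0 : 0 < K by lra.
have Ka : a <= K `^ gamma.
  have -> : a = (a `^ gamma^-1) `^ gamma.
    by rewrite -powRrM mulVf ?gt_eqF// powRr1// ltW.
  by rewrite ge0_ler_powR ?nnegrE ?powR_ge0 ?(ltW K0) ?(ltW g0)// le_max lexx orbT.
have q0 := powR_ge0 K `|2 - gamma|.
(* The extra 1 in the denominator pays for the L2 term that [H_norm] adds when the exponent is
   nonnegative. *)
exists (eps ^+ 2 / 2 / (K `^ `|2 - gamma| + 1)); first by rewrite divr_gt0// ltr_wpDl.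
move=> f Cf pf vf h1 h2.
have i0 : 0 <= cint (fun x => f x ^+ 2) by apply: cint_ge0 => x _; exact: sqr_ge0.
have H := Hdot_upper K4 g0 Cf pf vf.
have {}h1 : K `^ `|2 - gamma| * cint (fun x => f x ^+ 2) + cint (fun x => f x ^+ 2) <= eps ^+ 2 / 2.
  by move: h1; rewrite ler_pdivlMr ?ltr_wpDl// mulrDr mulr1 mulrC.
have {}h2 : (K `^ gamma)^-1 * cint (fun x => laplacian f x ^+ 2) <= eps ^+ 2 / 2.
  have Kg := powR_gt0 gamma K0.
  rewrite ler_pdivrMl//; apply: (le_trans h2); apply: (@le_trans _ _ (a * (eps ^+ 2 / 2))).
    by rewrite /a divfK ?gt_eqF// lerDl.
  by rewrite ler_wpM2r// ltW.
have fin : forall x, (x <= (eps ^+ 2)%:E)%E -> (sqrte x <= eps%:E)%E.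
  move=> x hx; have := sqrte_sqr eps%:E; rewrite gee0_abs ?lee_fin ?(ltW e0)// => <-.
  by rewrite lee_sqrt -?EFin_expe// lee_fin sqr_ge0.
rewrite /H_norm; case: ifP => _; apply: fin.
  rewrite (L2_normsqE (Cn_cont Cf)); apply: le_trans (leeD H (lexx _)) _.
  rewrite -EFinD lee_fin; lra.
by apply: le_trans H _; rewrite lee_fin; lra.
Qed.

End Interpolation.

(** * One-dimensional profiles of the bump *)

Section Bump.
Context {R : realType}.
Implicit Types (d x y : R) (m : nat).

Lemma Cn_bell n : Cn n (bell : R -> R).
Proof.
have C : Cn n (fun x : R => cos x) := (@Cn_cos_sin _ _ n _ (@Cn_id R n)).1.
exact: (Cn_mul (Cn_add (Cn_cst n (1 : R)) C) (Cn_cst n (2^-1 : R))).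
Qed.

Lemma is_derive_bell x : is_derive x (1 : R) bell (- sin x / 2).
Proof.
have D := @is_deriveM _ _ _ _ _ _ _ _ (@is_deriveD _ _ _ _ _ _ _ _ _ (is_derive_cst (1 : R) x 1)
  (is_derive_cos x)) (is_derive_cst (2^-1 : R) x 1).
by apply: (is_derive_eq D); rewrite /GRing.scale /cst /=; ring.
Qed.

(** The exponent is positive even for m = 0, so the profile always vanishes at x1 = pi.
    Differentiation leaves bell^(2m), which splits into two equal powers in [ddxprof_le]. *)
Definition xprof m x : R := bell x ^+ (2 * m + 1).
Definition dxprof m x : R := (2 * m + 1)%:R * bell x ^+ (2 * m) * (- sin x / 2).
Definition ddxprof m x : R :=
  (2 * m + 1)%:R * ((2 * m)%:R * (bell x ^+ (2 * m) * (1 - bell x)) - bell x ^+ (2 * m) * cos x / 2).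

Lemma is_derive_xprof m x : is_derive x (1 : R) (xprof m) (dxprof m x).
Proof.
have D := is_derive_pow (2 * m + 1) (is_derive_bell x).
by apply: (is_derive_eq D); rewrite /dxprof addn1.
Qed.

Lemma is_derive_dxprof m x : is_derive x (1 : R) (dxprof m) (ddxprof m x).
Proof.
have D1 := @is_deriveZ _ _ _ _ ((2 * m + 1)%:R : R) _ _ _ (is_derive_pow (2 * m) (is_derive_bell x)).
have D2 := @is_deriveZ _ _ _ _ (- 2^-1 : R) _ _ _ (is_derive_sin x).
have D3 := @is_deriveM _ _ _ _ _ _ _ _ D1 D2.
rewrite (_ : dxprof m = (fun x => (2 * m + 1)%:R * bell x ^+ (2 * m)) * (fun x => - 2^-1 * sin x)); last first.
  by apply/funext => z; rewrite /dxprof fctE; field.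
apply: (is_derive_eq D3); rewrite /= /GRing.scale /= /GRing.scale /= /ddxprof.
have E : sin x ^+ 2 = 4 * (bell x * (1 - bell x)).
  rewrite /bell; have := cos2Dsin2 x; move: (cos x) (sin x) => c s h.
  have -> : s ^+ 2 = 1 - c ^+ 2 by lra.
  by field.
case: m {D1 D3} => [|m]; first by rewrite !muln0 !mul0r !expr0; field.
have -> : (2 * m.+1).-1 = (2 * m).+1 by rewrite mulnS.
have -> : (2 * m.+1 = (2 * m).+2)%N by rewrite mulnS.
rewrite /= !natrD; move: ((2 * m).+2)%:R => N.
have -> : bell x ^+ (2 * m).+2 * (1 - bell x) = bell x ^+ (2 * m).+1 * (sin x ^+ 2) / 4.
  by rewrite E [in LHS]exprS; field.
by field.
Qed.

(** With t = bell x, 1 - t^(m+1) is (1 - t) times a sum of m+1 powers of t, each at least t^m. *)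
Lemma bell_pow_le m x : m.+1%:R * (bell x ^+ m * (1 - bell x)) <= 1.
Proof.
have b0 := bell_ge0 x; have b1 := bell_le1 x; move: (bell x) b0 b1 => t t0 t1.
suff : m.+1%:R * (t ^+ m * (1 - t)) <= 1 - t ^+ m.+1.
  by move=> /le_trans; apply; rewrite gerBl exprn_ge0.
elim: m => [|m IH]; first by rewrite expr0 expr1 !mul1r.
have h : m.+1%:R * (t ^+ m.+1 * (1 - t)) <= m.+1%:R * (t ^+ m * (1 - t)).
  rewrite ler_wpM2l// ler_wpM2r ?subr_ge0// exprS ler_piMl// exprn_ge0//.
have -> : m.+2%:R = m.+1%:R + 1 :> R by rewrite -[m.+2]addn1 natrD.
rewrite mulrDl mul1r; apply: le_trans (lerD (le_trans h IH) (lexx _)) _.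
by rewrite [t ^+ m.+2]exprS; lra.
Qed.

(** One of the two factors bell^m absorbs the large coefficient 2m (1 - bell) by [bell_pow_le]; the
    other survives as decay. *)
Lemma ddxprof_le m x : `|ddxprof m x| <= 3 * (2 * m + 1)%:R * bell x ^+ m.
Proof.
have b0 := bell_ge0 x; have b1 := bell_le1 x; have P := bell_pow_le m x.
have bm : 0 <= bell x ^+ m by rewrite exprn_ge0.
have bm1 : bell x ^+ m <= 1 by rewrite exprn_ile1.
have c1 : `|cos x| <= 1 by rewrite ler_norml cos_geN1 cos_le1.
have -> : 3 * (2 * m + 1)%:R * bell x ^+ m = (2 * m + 1)%:R * (3 * bell x ^+ m) by ring.
rewrite /ddxprof normrM [X in X * _]ger0_norm// ler_wpM2l//.
have -> : bell x ^+ (2 * m) = bell x ^+ m * bell x ^+ m by rewrite mul2n -addnn exprD.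
set b := bell x ^+ m in P bm bm1 *.
have q : 0 <= b * (1 - bell x) by rewrite mulr_ge0// subr_ge0.
have P2 : (2 * m)%:R * (b * (1 - bell x)) <= 2.
  apply: (@le_trans _ _ (2 * (m.+1%:R * (b * (1 - bell x))))); last by lra.
  by rewrite [leRHS]mulrA ler_wpM2r// natrM ler_wpM2l// ler_nat.
apply: le_trans (ler_normB _ _) _.
have -> : (2 * m)%:R * (b * b * (1 - bell x)) = b * ((2 * m)%:R * (b * (1 - bell x))) by ring.
rewrite [X in X + _]ger0_norm; last by rewrite mulr_ge0// mulr_ge0.
have -> : b * b * cos x / 2 = b * (b * cos x / 2) by ring.
rewrite [X in _ + X]normrM (ger0_norm bm) -mulrDr [leRHS]mulrC ler_wpM2l//.
have : `|b * cos x / 2| <= 1 / 2.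
  rewrite !normrM (ger0_norm bm) normfV (ger0_norm (ler0n _ 2)) ler_wpM2r ?invr_ge0//.
  by rewrite mulr_ile1.
lra.
Qed.

Definition yw y : R := pi ^+ 2 - y ^+ 2.
(** With w = pi^2 - y^2, the profile w exp(-w/d) vanishes at the boundary with slope of modulus 2 pi
    whatever d, and is concentrated in layers of width of order d. *)
Definition yprof d y : R := yw y * expR (- yw y / d).
Definition dyprof d y : R := - (2 * y) * (1 - yw y / d) * expR (- yw y / d).
Definition ddyprof d y : R :=
  (- 2 * (1 - yw y / d) - 4 * y ^+ 2 / d * (2 - yw y / d)) * expR (- yw y / d).

Lemma is_derive_yw y : is_derive y (1 : R) yw (- (2 * y)).
Proof.
have D := @is_deriveB _ _ _ _ _ _ _ _ _ (is_derive_cst (pi ^+ 2 : R) y 1) (is_derive_pow 2 (is_derive_id y (1 : R))).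
by apply: (is_derive_eq D); rewrite /GRing.scale /=; ring.
Qed.

Lemma is_derive_yexp d y : is_derive y (1 : R) (fun y => expR (- yw y / d)) (2 * y / d * expR (- yw y / d)).
Proof.
have D1 := @is_deriveZ _ _ _ _ (- d^-1) _ _ _ (is_derive_yw y).
have D2 := @is_derive1_comp R expR _ y _ _ (is_derive_expR _) D1.
rewrite (_ : (fun y => expR (- yw y / d)) = expR \o (- d^-1 *: yw)); last first.
  by apply/funext => z /=; congr expR; rewrite fctE /GRing.scale /=; ring.
apply: (is_derive_eq D2); rewrite /= /GRing.scale /=.
have -> : - d^-1 * yw y = - yw y / d by ring.
by ring.
Qed.

Lemma is_derive_yprof d y : is_derive y (1 : R) (yprof d) (dyprof d y).
Proof.
have D := @is_deriveM _ _ _ _ _ _ _ _ (is_derive_yw y) (is_derive_yexp d y).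
by apply: (is_derive_eq D); rewrite /GRing.scale /= /dyprof; ring.
Qed.

Lemma is_derive_dyprof d y : is_derive y (1 : R) (dyprof d) (ddyprof d y).
Proof.
have D1 := @is_deriveB _ _ _ _ _ _ _ _ _ (is_derive_cst (1 : R) y 1)
  (@is_deriveZ _ _ _ _ (d^-1) _ _ _ (is_derive_yw y)).
have D2 := @is_deriveM _ _ _ _ _ _ _ _ (is_derive_lin (-2) y) D1.
have D3 := @is_deriveM _ _ _ _ _ _ _ _ D2 (is_derive_yexp d y).
rewrite (_ : dyprof d = (fun y => -2 * y) * (cst 1 - d^-1 *: yw) * (fun y => expR (- yw y / d))); last first.
  by apply/funext => z; rewrite /dyprof !fctE /GRing.scale /=; ring.
apply: (is_derive_eq D3); rewrite /= /GRing.scale /= /ddyprof.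
have -> : ([eta *%R (-2)] * (cst 1 - d^-1 \*: yw)) y = -2 * y * (1 - d^-1 * yw y) by [].
have -> : (cst 1 - d^-1 \*: yw) y = 1 - d^-1 * yw y by [].
by ring.
Qed.

Lemma Cn_yprof n d : Cn n (yprof d).
Proof.
have Cw : Cn n yw := Cn_sub (Cn_cst n (pi ^+ 2 : R)) (Cn_exp 2 (@Cn_id R n)).
exact: (Cn_mul Cw (Cn_expR (Cn_mul (Cn_opp Cw) (Cn_cst n (d^-1))))).
Qed.

Lemma yw_ge0 y : - pi <= y <= pi -> 0 <= yw y.
Proof.
move=> hy; have pp := @pi_ge0 R.
rewrite subr_ge0 -[y ^+ 2]real_normK ?num_real// ler_pXn2r ?nnegrE//.
by rewrite ler_norml.
Qed.

Lemma expR_sqr_le (z : R) : 0 <= z -> (1 + z / 2) ^+ 2 <= expR z.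
Proof.
move=> z0; have := expR_ge1Dx (z / 2) => h.
have -> : expR z = expR (z / 2) ^+ 2 by rewrite expr2 -expRD -splitr.
by rewrite ler_pXn2r// nnegrE ?expR_ge0//; lra.
Qed.

(** With z = w/d the square is d^2 z^2 exp(-2z). One exponential absorbs the polynomial, as z^2 <= 4
    (1 + z/2)^2 <= 4 exp z; the other remains to be integrated. *)
Lemma yprof_sqr_le d y : 0 < d -> - pi <= y <= pi -> yprof d y ^+ 2 <= 4 * d ^+ 2 * expR (- yw y / d).
Proof.
move=> d0 hy; have w0 := yw_ge0 hy.
pose z := yw y / d; have z0 : 0 <= z by rewrite divr_ge0// ltW.
rewrite /yprof (_ : - yw y / d = - z); last by rewrite /z mulNr.
have -> : yw y = d * z by rewrite /z mulrC divfK// gt_eqF.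
have e0 := expR_gt0 (- z).
rewrite exprMn [expR (- z) ^+ 2]expr2 mulrA ler_wpM2r ?(ltW e0)//.
rewrite exprMn [4 * _]mulrC -mulrA ler_wpM2l ?sqr_ge0//.
rewrite expRN ler_pdivrMr ?expR_gt0//.
by have := expR_sqr_le z0; rewrite sqrrD expr1n; nra.
Qed.

(** The square of 2 (2 + 4 pi^2), the factor left when the polynomial part of [ddyprof] is bounded
    by a multiple of (1 + z/2)/d. *)
Definition yconst : R := 4 * (2 + 4 * pi ^+ 2) ^+ 2.

Lemma ddyprof_sqr_le d y : 0 < d <= 1 -> - pi <= y <= pi ->
  ddyprof d y ^+ 2 <= yconst / d ^+ 2 * expR (- yw y / d).
Proof.
move=> /andP[d0 d1] hy; have w0 := yw_ge0 hy.
pose z := yw y / d; have z0 : 0 <= z by rewrite divr_ge0// ltW.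
rewrite /ddyprof (_ : - yw y / d = - z); last by rewrite /z mulNr.
rewrite -/z; have e0 := expR_gt0 (- z).
rewrite exprMn [expR (- z) ^+ 2]expr2 mulrA ler_wpM2r ?(ltW e0)//.
rewrite expRN ler_pdivrMr ?expR_gt0//.
have y2 : y ^+ 2 <= pi ^+ 2 by move: w0; rewrite subr_ge0.
have y0 := sqr_ge0 y.
have i1 : 1 <= d^-1 by rewrite invf_ge1.
have N : `|- 2 * (1 - z) - 4 * y ^+ 2 / d * (2 - z)| <= (2 + 4 * pi ^+ 2) * d^-1 * (2 * (1 + z / 2)).
  have a1 : `|- 2 * (1 - z)| <= 2 * d^-1 * (2 * (1 + z / 2)).
    rewrite normrM normrN (ger0_norm (ler0n _ 2)) -mulrA ler_wpM2l//.
    apply: (@le_trans _ _ (1 + z)); first by rewrite ler_norml; lra.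
    by apply: (@le_trans _ _ (1 * (2 * (1 + z / 2)))); [lra|rewrite ler_wpM2r//; lra].
  have a2 : `|4 * y ^+ 2 / d * (2 - z)| <= 4 * pi ^+ 2 * d^-1 * (2 * (1 + z / 2)).
    rewrite normrM ger0_norm; last by rewrite divr_ge0 ?(ltW d0)// mulr_ge0.
    apply: ler_pM => //; first by rewrite divr_ge0 ?(ltW d0)// mulr_ge0.
      by rewrite ler_wpM2r ?invr_ge0 ?(ltW d0)//; lra.
    by rewrite ler_norml; lra.
  apply: le_trans (ler_normB _ _) _; apply: le_trans (lerD a1 a2) _.
  by rewrite -!mulrDl.
rewrite -[leLHS]real_normK ?num_real//.
apply: (@le_trans _ _ (((2 + 4 * pi ^+ 2) * d^-1 * (2 * (1 + z / 2))) ^+ 2)).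
  by rewrite ler_pXn2r// nnegrE (le_trans (normr_ge0 _) N).
have -> : ((2 + 4 * pi ^+ 2) * d^-1 * (2 * (1 + z / 2))) ^+ 2 = yconst / d ^+ 2 * (1 + z / 2) ^+ 2.
  by rewrite /yconst; move: (pi ^+ 2) (z) => p u; field; rewrite gt_eqF.
apply: ler_wpM2l; last exact: expR_sqr_le.
by rewrite divr_ge0 ?sqr_ge0// mulr_ge0// sqr_ge0.
Qed.

(** Since pi^2 - y^2 >= pi (pi - |y|), the integrand is dominated by two exponentials, one per
    boundary layer, each of integral at most d/pi; and pi >= 2. *)
Lemma sint_yexp_le d : 0 < d -> sint (fun y => expR (- yw y / d)) <= d.
Proof.
move=> d0; have pp := @pi_gt0 R.
have pn : pi != 0 :> R by rewrite gt_eqF.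
have dn : d != 0 by rewrite gt_eqF.
have ha y : is_derive y (1 : R) (fun y => d / pi * expR (pi / d * (y - pi))) (expR (pi / d * (y - pi))).
  have D1 := @is_deriveZ _ _ _ _ (pi / d) _ _ _ (@is_deriveB _ _ _ _ _ _ _ _ _ (is_derive_id y (1 : R)) (is_derive_cst (pi : R) y 1)).
  have D2 := @is_derive1_comp R expR _ y _ _ (is_derive_expR _) D1.
  apply: (is_derive_eq (@is_deriveZ _ _ _ _ (d / pi) _ _ _ D2)); rewrite /= /GRing.scale /=.
  have -> : (id - cst pi) y = y - pi :> R by [].
  by move: (pi : R) pn {D1 D2} => p pn; field; rewrite pn dn.
have hb y : is_derive y (1 : R) (fun y => - (d / pi) * expR (- (pi / d) * (y + pi))) (expR (- (pi / d) * (y + pi))).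
  have D1 := @is_deriveZ _ _ _ _ (- (pi / d)) _ _ _ (@is_deriveD _ _ _ _ _ _ _ _ _ (is_derive_id y (1 : R)) (is_derive_cst (pi : R) y 1)).
  have D2 := @is_derive1_comp R expR _ y _ _ (is_derive_expR _) D1.
  apply: (is_derive_eq (@is_deriveZ _ _ _ _ (- (d / pi)) _ _ _ D2)); rewrite /= /GRing.scale /=.
  have -> : (id + cst pi) y = y + pi :> R by [].
  by move: (pi : R) pn {D1 D2} => p pn; field; rewrite pn dn.
have Ca : Cn 0 (fun y : R => expR (pi / d * (y - pi))).
  exact: (Cn_expR (Cn_scale _ (Cn_sub (@Cn_id R 0) (Cn_cst 0 (pi : R))))).
have Cb : Cn 0 (fun y : R => expR (- (pi / d) * (y + pi))).
  exact: (Cn_expR (Cn_scale _ (Cn_add (@Cn_id R 0) (Cn_cst 0 (pi : R))))).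
have cy : continuous (fun y : R => expR (- yw y / d)) := is_derive_cont (is_derive_yexp d).
apply: (@le_trans _ _ (sint (fun y => expR (pi / d * (y - pi)) + expR (- (pi / d) * (y + pi))))).
  apply: le_sint => //; first exact: cont_add.
  move=> y /andP[y1 y2]; have [h|h] := lerP 0 y.
    apply: (@le_trans _ _ (expR (pi / d * (y - pi)))); last by rewrite lerDl expR_ge0.
    rewrite ler_expR (_ : pi / d * (y - pi) = (pi * (y - pi)) / d); last by ring.
    rewrite ler_wpM2r ?invr_ge0 ?(ltW d0)//.
    by rewrite /yw; nra.
  apply: (@le_trans _ _ (expR (- (pi / d) * (y + pi)))); last by rewrite lerDr expR_ge0.
  rewrite ler_expR (_ : - (pi / d) * (y + pi) = (- pi * (y + pi)) / d); last by ring.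
  rewrite ler_wpM2r ?invr_ge0 ?(ltW d0)//.
  by rewrite /yw; nra.
rewrite (sintD Ca Cb) (sint_FTC ha Ca) (sint_FTC hb Cb).
rewrite subrr mulr0 expR0 addNr mulr0 expR0.
have e1 := expR_gt0 (pi / d * (- pi - pi)).
have e2 := expR_gt0 (- (pi / d) * (pi + pi)).
have dp : 0 < d / pi by rewrite divr_gt0.
apply: (@le_trans _ _ (d / pi + d / pi)).
  by have := mulr_gt0 dp e1; have := mulr_gt0 dp e2; lra.
have : d / pi <= d / 2 by rewrite ler_wpM2l ?(ltW d0)// lef_pV2 ?posrE// pi_ge2.
lra.
Qed.

(** The width of bell^(2m) as measured by [bellJ_le]: its integral is at most 2 pi / sqrt(4m+1). The
    layers in x2 get the same width. *)
Definition bscale m : R := (Num.sqrt (4 * m + 1)%:R)^-1.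

Lemma bscale_gt0 m : 0 < bscale m.
Proof. by rewrite invr_gt0 sqrtr_gt0 ltr0n addn1. Qed.

Lemma bscale_sqr m : bscale m ^+ 2 = (4 * m + 1)%:R^-1.
Proof. by rewrite exprVn sqr_sqrtr. Qed.

Lemma bscale_le1 m : bscale m <= 1.
Proof.
rewrite -(@ler_pXn2r _ 2) ?nnegrE ?(ltW (bscale_gt0 m))// expr1n bscale_sqr.
by rewrite invf_le1 ?ltr0n ?addn1// ler1n.
Qed.

Lemma bell_even_integral m : sint (fun x => bell x ^+ (2 * m)) <= 2 * pi * bscale m.
Proof.
have pp := @pi_gt0 R.
have E : sint (fun x => bell x ^+ (2 * m)) = bellJ (2 * m) 0.
  by apply: eq_sint => x _; rewrite sub0r /bell cosN.
rewrite E -(@ler_pXn2r _ 2) ?nnegrE ?(ltW (bellJ_gt0 _ _))//; last first.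
  by rewrite !mulr_ge0 ?(ltW pp) ?(ltW (bscale_gt0 m)).
rewrite exprMn bscale_sqr ler_pdivlMr ?ltr0n ?addn1//.
by have := @bellJ_le R (2 * m) 0; rewrite [(2 * (2 * m))%N]mulnA [in X in X -> _]addn1.
Qed.

End Bump.

(** * Norms of the bump, and its excess over the stationary maximum *)

Section BumpNorms.
Context {R : realType}.
Implicit Types (al d y : R) (m : nat).

Lemma Cn_xprof n m : Cn n (xprof m : R -> R).
Proof. exact: Cn_exp (Cn_bell n). Qed.

Lemma cont_ddxprof m : continuous (ddxprof m : R -> R).
Proof.
have cb k : continuous (fun x : R => bell x ^+ k) := @cont_exp _ _ k _ cont_bell.
have c1 : continuous (fun x : R => 1 - bell x) := cont_sub (@cst_continuous _ _ _) cont_bell.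
have c2 : continuous (fun x : R => bell x ^+ (2 * m) * cos x) := cont_mul (cb _) (@continuous_cos R).
have c3 : continuous (fun x : R => bell x ^+ (2 * m) * cos x / 2) := cont_mul c2 (@cst_continuous _ _ _).
exact: (@cont_scale _ _ _ _ (cont_sub (@cont_scale _ _ _ _ (cont_mul (cb (2 * m)%N) c1)) c3)).
Qed.

Lemma cont_ddyprof d : continuous (ddyprof d : R -> R).
Proof.
have Cw : Cn 0 (yw : R -> R) := Cn_sub (Cn_cst 0 (pi ^+ 2 : R)) (Cn_exp 2 (@Cn_id R 0)).
have Cz : Cn 0 (fun y : R => yw y / d) := Cn_mul Cw (Cn_cst 0 d^-1).
have C2 : Cn 0 (fun y : R => 4 * y ^+ 2 / d) := Cn_mul (Cn_scale 4 (Cn_exp 2 (@Cn_id R 0))) (Cn_cst 0 d^-1).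
exact: (Cn_mul (Cn_sub (Cn_scale (-2) (Cn_sub (Cn_cst 0 (1 : R)) Cz)) (Cn_mul C2 (Cn_sub (Cn_cst 0 (2 : R)) Cz)))
  (Cn_expR (Cn_mul (Cn_opp Cw) (Cn_cst 0 d^-1)))).
Qed.

Lemma sint_xprof_sqr m : sint (fun x : R => xprof m x ^+ 2) <= 2 * pi * bscale m.
Proof.
apply: le_trans (bell_even_integral m); apply: le_sint.
- exact: (@cont_exp _ _ 2 _ (Cn_cont (Cn_xprof 0 m))).
- exact: (@cont_exp _ _ _ _ cont_bell).
- move=> x _; rewrite /xprof -exprM mulnC; apply: ler_wiXn2l; [exact: bell_ge0|exact: bell_le1|].
  by rewrite (leq_trans (leq_addr 1 _))// leq_pmull.
Qed.

Lemma sint_ddxprof_sqr m : sint (fun x : R => ddxprof m x ^+ 2) <= 18 * pi / bscale m ^+ 3.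
Proof.
have d0 := @bscale_gt0 R m; have pp := @pi_gt0 R.
have cb : continuous (fun x : R => bell x ^+ (2 * m)) := @cont_exp _ _ _ _ cont_bell.
(* From 9 (2m+1)^2 <= 9 (4m+1)^2, where 4m+1 is [bscale m] to the power -2. *)
pose K : R := 9 / bscale m ^+ 4.
apply: (@le_trans _ _ (sint (fun x => K * bell x ^+ (2 * m)))).
  apply: le_sint; [exact: (@cont_exp _ _ 2 _ (@cont_ddxprof m))|exact: (@cont_scale _ _ _ _ cb)|].
  move=> x _; rewrite -[leLHS]real_normK ?num_real//.
  have h := ddxprof_le m x.
  apply: (@le_trans _ _ ((3 * (2 * m + 1)%:R * bell x ^+ m) ^+ 2)).
    by rewrite ler_pXn2r// nnegrE// (le_trans (normr_ge0 _) h).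
  rewrite exprMn -exprM [(m * 2)%N]mulnC ler_wpM2r ?exprn_ge0 ?bell_ge0//.
  rewrite /K (_ : bscale m ^+ 4 = (bscale m ^+ 2) ^+ 2); last by rewrite -exprM.
  rewrite bscale_sqr exprVn invrK exprMn (_ : 3 ^+ 2 = 9 :> R); last by ring.
  rewrite ler_wpM2l//.
  by rewrite ler_pXn2r ?nnegrE// ler_nat leq_add2r leq_mul2r orbT.
rewrite (sintZ _ cb); apply: le_trans (ler_wpM2l _ (bell_even_integral m)) _.
  by rewrite divr_ge0// exprn_ge0// ltW.
by rewrite /K le_eqVlt; apply/orP; left; apply/eqP; move: (bscale m) d0 (pi : R) => d d0 p; field; rewrite gt_eqF.
Qed.

Lemma sint_yprof_sqr d : 0 < d -> sint (fun y : R => yprof d y ^+ 2) <= 4 * d ^+ 3.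
Proof.
move=> d0.
have cy : continuous (fun y : R => expR (- yw y / d)) := is_derive_cont (is_derive_yexp d).
apply: (@le_trans _ _ (sint (fun y => 4 * d ^+ 2 * expR (- yw y / d)))).
  apply: le_sint; [exact: (@cont_exp _ _ 2 _ (Cn_cont (Cn_yprof 0 d)))|exact: (@cont_scale _ _ _ _ cy)|].
  by move=> y hy; exact: yprof_sqr_le.
rewrite (sintZ _ cy); have := sint_yexp_le d0 => h.
rewrite [d ^+ 3]exprSr mulrA ler_wpM2l//; by rewrite mulr_ge0// sqr_ge0.
Qed.

Lemma sint_ddyprof_sqr d : 0 < d <= 1 -> sint (fun y : R => ddyprof d y ^+ 2) <= yconst / d.
Proof.
move=> hd; have /andP[d0 d1] := hd.
have cy : continuous (fun y : R => expR (- yw y / d)) := is_derive_cont (is_derive_yexp d).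
have yc0 : 0 <= yconst :> R by rewrite mulr_ge0// sqr_ge0.
apply: (@le_trans _ _ (sint (fun y => yconst / d ^+ 2 * expR (- yw y / d)))).
  apply: le_sint; [exact: (@cont_exp _ _ 2 _ (@cont_ddyprof d))|exact: (@cont_scale _ _ _ _ cy)|].
  by move=> y hy; exact: ddyprof_sqr_le.
rewrite (sintZ _ cy); apply: le_trans (ler_wpM2l _ (sint_yexp_le d0)) _.
  by rewrite divr_ge0// sqr_ge0.
by rewrite le_eqVlt; apply/orP; left; apply/eqP; move: (yconst : R) => c; field; rewrite gt_eqF.
Qed.

(* A ridge over x1 = 0, of width bscale m in x1 and concentrated in boundary
   layers of the same width; it vanishes at x1 = pi and has slope of order al at
   x2 = -pi, pi, whatever m. *)
Definition bump al m (x : R * R) : R := al * xprof m x.1 * yprof (bscale m) x.2.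

Lemma Cn_bump n al m : Cn n (bump al m).
Proof. exact: (Cn_tensor (Cn_scale al (Cn_xprof n m)) (Cn_yprof n (bscale m))). Qed.

Lemma periodic_bump al m : periodic (bump al m) (2 * pi, 0).
Proof. by move=> x; rewrite /bump /= addr0 /xprof /bell mulr_natl cosD2pi. Qed.

Lemma vanish_bump al m : vanish (bump al m).
Proof. by move=> x; rewrite /bump /= /yprof /yw sqrrN subrr !mul0r !mulr0. Qed.

Lemma bump_pi al m y : bump al m (pi, y) = 0.
Proof. by rewrite /bump /= /xprof /bell cospi subrr mul0r addn1 expr0n mulr0 mul0r. Qed.

Lemma bump_0 al m y : bump al m (0, y) = al * yprof (bscale m) y.
Proof. by rewrite /bump /= /xprof /bell cos0 -mulr2n divff// expr1n mulr1. Qed.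

(** The x1-profile contributes order d and the x2-profile order d^3, where d = [bscale m] tends to
    0. *)
Lemma cint_bump_sqr al m : cint (fun x => bump al m x ^+ 2) <= al ^+ 2 * (8 * pi * bscale m ^+ 4).
Proof.
have d0 := @bscale_gt0 R m; have pp := @pi_gt0 R.
have cX : continuous (fun x : R => xprof m x ^+ 2) := @cont_exp _ _ 2 _ (Cn_cont (Cn_xprof 0 m)).
have cY : continuous (fun y : R => yprof (bscale m) y ^+ 2) := @cont_exp _ _ 2 _ (Cn_cont (Cn_yprof 0 _)).
have -> : cint (fun x => bump al m x ^+ 2) =
    cint (fun x => (al ^+ 2 * xprof m x.1 ^+ 2) * yprof (bscale m) x.2 ^+ 2).
  by apply: eq_cint => x _; rewrite /bump !exprMn.
rewrite (cint_tensor (@cont_scale _ _ (al ^+ 2) _ cX) cY) (sintZ _ cX) -mulrA ler_wpM2l ?sqr_ge0//.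
have -> : 8 * pi * bscale m ^+ 4 = (2 * pi * bscale m) * (4 * bscale m ^+ 3) :> R by ring.
apply: ler_pM; [by apply: sint_ge0 => x _; exact: sqr_ge0..| |].
  exact: sint_xprof_sqr.
exact: sint_yprof_sqr.
Qed.

Lemma laplacian_bump al m x : laplacian (bump al m) x =
  al * ddxprof m x.1 * yprof (bscale m) x.2 + al * xprof m x.1 * ddyprof (bscale m) x.2.
Proof.
have h1 y : is_derive y (1 : R) (fun x => al * xprof m x) (al * dxprof m y).
  exact: (@is_deriveZ _ _ _ _ al _ _ _ (is_derive_xprof m y)).
have h2 y : is_derive y (1 : R) (fun x => al * dxprof m x) (al * ddxprof m y).
  exact: (@is_deriveZ _ _ _ _ al _ _ _ (is_derive_dxprof m y)).
exact: (laplacian_tensor x h1 h2 (is_derive_yprof (bscale m)) (is_derive_dyprof (bscale m))).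
Qed.

(** The two second derivatives scale as d^(-3) d^3 and d d^(-1), so the bound does not depend on m:
    the bump is scale-critical for H^2. *)
Lemma cint_laplacian_bump al m :
  cint (fun x => laplacian (bump al m) x ^+ 2) <= 2 * al ^+ 2 * (72 * pi + 2 * pi * yconst).
Proof.
have d0 := @bscale_gt0 R m; have pp := @pi_gt0 R.
have cX : continuous (fun x : R => xprof m x ^+ 2) := @cont_exp _ _ 2 _ (Cn_cont (Cn_xprof 0 m)).
have cY : continuous (fun y : R => yprof (bscale m) y ^+ 2) := @cont_exp _ _ 2 _ (Cn_cont (Cn_yprof 0 _)).
have cXX : continuous (fun x : R => ddxprof m x ^+ 2) := @cont_exp _ _ 2 _ (@cont_ddxprof m).
have cYY : continuous (fun y : R => ddyprof (bscale m) y ^+ 2) := @cont_exp _ _ 2 _ (@cont_ddyprof (bscale m)).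
have c1 : continuous (fun x : R * R => ddxprof m x.1 ^+ 2 * yprof (bscale m) x.2 ^+ 2).
  exact: (cont_mul (@Cn_fst R 0 _ cXX) (@Cn_snd R 0 _ cY)).
have c2 : continuous (fun x : R * R => xprof m x.1 ^+ 2 * ddyprof (bscale m) x.2 ^+ 2).
  exact: (cont_mul (@Cn_fst R 0 _ cX) (@Cn_snd R 0 _ cYY)).
have c12 := cont_add c1 c2.
apply: (@le_trans _ _ (cint (fun x : R * R => 2 * al ^+ 2 * (ddxprof m x.1 ^+ 2 * yprof (bscale m) x.2 ^+ 2
   + xprof m x.1 ^+ 2 * ddyprof (bscale m) x.2 ^+ 2)))).
  apply: le_cint.
  - exact: (@cont_exp _ _ 2 _ (@Cn_cont _ _ 0 _ (Cn_lap (Cn_bump 2 al m)))).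
  - exact: (@cont_scale _ _ _ _ c12).
  - move=> x _; rewrite laplacian_bump -!exprMn.
    move: (ddxprof _ _) (yprof _ _) (xprof _ _) (ddyprof _ _) => a b c e.
    rewrite -subr_ge0 (_ : _ - _ = (al * (a * b - c * e)) ^+ 2); first exact: sqr_ge0.
    by ring.
rewrite (cintZ _ c12) (cintD c1 c2) (cint_tensor cXX cY) (cint_tensor cX cYY).
apply: ler_wpM2l; first by rewrite mulr_ge0// sqr_ge0.
have h0 (u : R -> R) : 0 <= sint (fun x => u x ^+ 2) by apply: sint_ge0 => x _; exact: sqr_ge0.
apply: lerD.
  apply: (le_trans (ler_pM (h0 _) (h0 _) (sint_ddxprof_sqr m) (sint_yprof_sqr d0))).
  by rewrite le_eqVlt; apply/orP; left; apply/eqP; move: (bscale m) d0 (pi : R) => d d0 p; field; rewrite gt_eqF.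
have hd : 0 < @bscale R m <= 1 by rewrite d0 bscale_le1.
apply: (le_trans (ler_pM (h0 _) (h0 _) (sint_xprof_sqr m) (sint_ddyprof_sqr hd))).
by rewrite le_eqVlt; apply/orP; left; apply/eqP; move: (bscale m) d0 (pi : R) (yconst : R) => d d0 p c; field; rewrite gt_eqF.
Qed.

Lemma bump_H_norm (al eps gamma : R) : 0 < eps -> 0 < gamma ->
  exists m, (H_norm (2 - gamma) (bump al m) <= eps%:E)%E.
Proof.
move=> e0 g0; have pp := @pi_gt0 R.
have A0 : 0 <= 2 * al ^+ 2 * (72 * pi + 2 * pi * yconst) :> R.
  have yc0 : 0 <= yconst :> R by rewrite mulr_ge0// sqr_ge0.
  rewrite mulr_ge0//; first by rewrite mulr_ge0// sqr_ge0.
  by rewrite addr_ge0// mulr_ge0// ?mulr_ge0// ltW.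
have [d d0 hd] := H_norm_small e0 g0 A0.
have b0 : 0 <= al ^+ 2 * (8 * pi) by rewrite mulr_ge0 ?sqr_ge0// mulr_ge0// ltW.
pose m := Num.bound (al ^+ 2 * (8 * pi) / d).
have hm : al ^+ 2 * (8 * pi) / d < m%:R by apply: archi_boundP; rewrite divr_ge0// ltW.
exists m; apply: hd; [exact: Cn_bump|exact: periodic_bump|exact: vanish_bump| |exact: cint_laplacian_bump].
apply: le_trans (cint_bump_sqr al m) _; rewrite mulrA.
have q0 : (0 : R) < (4 * m + 1)%:R by rewrite ltr0n addn1.
apply: (@le_trans _ _ (al ^+ 2 * (8 * pi) * (4 * m + 1)%:R^-1)).
  rewrite ler_wpM2l// -bscale_sqr (_ : bscale m ^+ 4 = bscale m ^+ 2 * bscale m ^+ 2); last by rewrite -exprD.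
  by rewrite ler_piMr ?sqr_ge0// exprn_ile1 ?bscale_le1// ltW// bscale_gt0.
rewrite ler_pdivrMr// [d * _]mulrC -ler_pdivrMr//; apply: (le_trans (ltW hm)).
by rewrite ler_nat (leq_trans _ (leq_addr 1 _))// leq_pmull.
Qed.

Lemma yprof_lower d h (y : R) : 0 < d -> 0 < h <= 1 -> 2 * pi * h <= d / 2 -> `|y| = pi - h ->
  h * pi / 2 <= yprof d y.
Proof.
move=> d0 /andP[h0 h1] hd hy; have p2 := @pi_ge2 R.
have E : yw y = h * (2 * pi - h).
  by rewrite /yw -[y ^+ 2]real_normK ?num_real// hy; ring.
have w1 : h * pi <= yw y by rewrite E ler_wpM2l ?(ltW h0)//; lra.
have w2 : yw y <= d / 2.
  by apply: le_trans hd; rewrite E mulrC ler_wpM2r ?(ltW h0)//; lra.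
have e2 : 1 / 2 <= expR (- yw y / d).
  apply: le_trans (expR_ge1Dx _).
  have : yw y / d <= 1 / 2 by rewrite ler_pdivrMr//; lra.
  rewrite mulNr; lra.
have hp : 0 <= h * pi by rewrite mulr_ge0 ?(ltW h0)//; lra.
rewrite /yprof -mulrA -[2^-1]mul1r; rewrite mulrA.
exact: ler_pM.
Qed.

(** A maximum of [g] in the interior is exceeded at once, the bump being positive there. At a
    boundary maximum the bump vanishes, so one moves inward by h: [g] drops by at most L h while the
    bump rises by at least (L + 1) h. The amplitude 2 (L + 1)/pi is dictated by the lower bound h
    pi/2 of [yprof_lower]. *)
Lemma bump_excess (g dg : R -> R) (L ys : R) : (forall y : R, is_derive y (1 : R) g (dg y)) ->
  (forall y, - pi <= y <= pi -> `|dg y| <= L) -> 0 <= L -> - pi <= ys <= pi ->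
  forall m, exists2 y, - pi < y < pi & g ys < g y + bump (2 * (L + 1) / pi) m (0, y).
Proof.
move=> Dg hL L0 /andP[y1 y2] m; have pp := @pi_gt0 R; have p2 := @pi_ge2 R.
have al0 : 0 < 2 * (L + 1) / pi by rewrite divr_gt0// mulr_gt0// ltr_wpDl.
have d0 := @bscale_gt0 R m; set d := bscale m in d0 *.
(* Small compared with the layer width, so that the exponential factor of the bump is still at least
   1/2. *)
pose h : R := Num.min 1 (d / 2 / (2 * pi)).
have p20 : 0 < 2 * pi :> R by rewrite mulr_gt0.
have h0 : 0 < h by rewrite lt_min ltr01 !divr_gt0.
have h1 : h <= 1 by rewrite ge_min lexx.
have hd : 2 * pi * h <= d / 2 by rewrite mulrC -ler_pdivlMr// ge_min lexx orbT.
have h01 : 0 < h <= 1 by rewrite h0.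
have gain y : `|y| = pi - h -> (L + 1) * h <= bump (2 * (L + 1) / pi) m (0, y).
  move=> hy; rewrite bump_0 -/d; have := yprof_lower d0 h01 hd hy => k.
  apply: le_trans (ler_wpM2l (ltW al0) k).
  rewrite le_eqVlt; apply/orP; left; apply/eqP; move: (pi : R) pp => p p0.
  by field; rewrite gt_eqF.
have Lh : L * h < (L + 1) * h by rewrite ltr_pM2r// ltrDl.
have [e1|n1] := eqVneq ys pi.
  exists (pi - h); first by apply/andP; split; lra.
  have lt : pi - h < pi by rewrite gtrBl.
  have [c /andP[c1 c2] E] := mvt_derive Dg lt.
  have k : `|g pi - g (pi - h)| <= L * h.
    rewrite E normrM (_ : pi - (pi - h) = h); last by ring.
    rewrite (ger0_norm (ltW h0)) ler_wpM2r ?(ltW h0)//.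
    by apply: hL; apply/andP; split; lra.
  have := gain (pi - h); rewrite ger0_norm; last lra.
  by move=> /(_ erefl) k2; have := ler_norm (g pi - g (pi - h)); rewrite e1; lra.
have [e2|n2] := eqVneq ys (- pi).
  exists (- (pi - h)); first by apply/andP; split; lra.
  have lt : - pi < - (pi - h) by rewrite ltrN2 gtrBl.
  have [c /andP[c1 c2] E] := mvt_derive Dg lt.
  have k : `|g (- (pi - h)) - g (- pi)| <= L * h.
    rewrite E normrM (_ : - (pi - h) - - pi = h); last by ring.
    rewrite (ger0_norm (ltW h0)) ler_wpM2r ?(ltW h0)//.
    by apply: hL; apply/andP; split; lra.
  have := gain (- (pi - h)); rewrite normrN ger0_norm; last lra.
  move=> /(_ erefl) k2; have := ler_norm (- (g (- (pi - h)) - g (- pi))); rewrite normrN e2; lra.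
have i1 : - pi < ys by rewrite lt_neqAle eq_sym n2.
have i2 : ys < pi by rewrite lt_neqAle n1.
exists ys; first by rewrite i1.
rewrite ltrDl bump_0 mulr_gt0// /yprof mulr_gt0 ?expR_gt0//.
rewrite /yw; have -> : pi ^+ 2 - ys ^+ 2 = (pi - ys) * (ys + pi) by ring.
by rewrite mulr_gt0//; lra.
Qed.

End BumpNorms.

Theorem theorem1p5 (R : realType) (rho_s : R * R -> R)
    (rho_s_smooth : smooth_strip rho_s)
    (rho_s_stationary : IPM_stationary rho_s)
    (eps gamma : R) (eps_gt0 : 0 < eps) (gamma_gt0 : 0 < gamma) :
  exists rho0 : R * R -> R,
    [/\ smooth_strip rho0,
        (H_norm (2 - gamma)%R (fun x => (rho0 x - rho_s x)%R) <= eps%:E)%E &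
        forall rho : R -> R * R -> R,
          IPM_solution rho ->
          (forall x, strip x -> rho 0 x = rho0 x) ->
          forall s : R, 0 < s ->
            limf_esup
              (fun t : R => ((t `^ (- (s / 2)))%:E
                 * Hdot_norm (s + 1)%R (fun x => (rho t x - rho_s x)%R))%E)
              (+oo%R : set_system R)
            = +oo%E].
Proof.
have [G [CG pG rhoG shear]] := stationary_shear rho_s_stationary.
have pp := @pi_gt0 R.
have D y : is_derive y (1 : R) (fun y => G (0, y)) (dx2 G (0, y)).
  by apply: is_derive_y; exact: Cn_diff (CG 1%N).
have cg : continuous (fun y => G (0, y)) := is_derive_cont D.
have [L L0 hL] := clcell_bounded (Cn_cont (Cn_partial2 (CG 1%N))).
have hL' y : - pi <= y <= pi -> `|dx2 G (0, y)| <= L.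
  move=> hy; apply: hL; split; rewrite /= in_itv /=; last exact: hy.
  by apply/andP; split; lra.
have pnp : - pi <= pi :> R by lra.
(* As [rho_s] depends on x2 alone, its maximum over the strip is attained along x1 = 0; it serves as
   the level M. *)
have [ys ysin ymax] := @EVT_max R (fun y => G (0, y)) (- pi) pi pnp (continuous_subspaceT cg).
have hys : - pi <= ys <= pi by move: ysin; rewrite in_itv.
pose al := 2 * (L + 1) / pi.
have [m hm] := bump_H_norm al eps_gt0 gamma_gt0.
have [y hy exc] := bump_excess D hL' L0 hys m.
exists (fun x => rho_s x + bump al m x); split.
- exists (fun x => G x + bump al m x); split.
  + by move=> n; exact: Cn_add (CG n) (Cn_bump n al m).
  + by move=> x; rewrite pG periodic_bump.
  + by move=> x sx; rewrite rhoG.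
- by rewrite (_ : (fun x => _) = bump al m)//; apply/funext => x; rewrite addrC addKr.
move=> rho /ipm_ext_of[F [P [hF EF]]] rho0E s s0.
have [CF _ _ _] := hF.
have F0 x : strip x -> F (0, x) = G x + bump al m x.
  by move=> sx; rewrite -EF// rho0E// rhoG.
apply: (norm_growth (M := G (0, ys)) (D := fun t x => rho t x - rho_s x) hF _ _ _ s0).
(* On x1 = pi the bump vanishes, so the initial density there is at most the maximum of [rho_s]. *)
- move=> z hz; rewrite F0// bump_pi addr0 shear//=; apply: ymax.
  by rewrite in_itv.
(* The conserved excess is positive because the perturbed density exceeds M at the interior point
   (0, y). *)
- have c0 : continuous (fun x => F (0, x)) := continuous_slice (Cn_cont (CF 0%N)).
  have ce : continuous (fun x => Num.max (F (0, x) - G (0, ys)) 0 ^+ 2).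
    move=> x; have ce := is_derive_cont (is_derive_excess (G (0, ys))).
    exact: (cvg_comp (fun x => F (0, x)) _ (@c0 x) (ce (F (0, x)))).
  apply: (cint_gt0 (x0 := (0, y)) ce) => //=.
  + by move=> x _; exact: sqr_ge0.
  + by apply/andP; split; lra.
  + rewrite exprn_gt0// lt_max subr_gt0 F0 ?exc//.
    by case/andP: hy => a b; apply/andP; split; exact: ltW.
- move=> t t0 p q p0; apply: (coef_shear (G := G)) => //.
  + exact: continuous_slice (Cn_cont (CF 0%N)).
  + exact: Cn_cont (CG 0%N).
  + by move=> x sx; rewrite EF// rhoG.
Qed.
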